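(* Let $0<\gamma<1$. Let $S$ be any of the four operators $P^{\gamma,*}_{+}$, $P^{\gamma,*}_{-}$ (maximal functions) or $g^\gamma_{+}$, $g^\gamma_{-}$ (Littlewood–Paley square functions) associated to the Poisson semigroups $P^\gamma_{t,\pm}$. Then for every $1<p<\infty$, $S$ is bounded from $\ell^p(\mathbb{Z})$ into itself, i.e. there is a constant $C$ with $\|Sf\|_{\ell^p}\le C\|f\|_{\ell^p}$ for all $f\in\ell^p(\mathbb{Z})$, and $S$ is bounded from $\ell^1(\mathbb{Z})$ into weak-$\ell^1(\mathbb{Z})$, i.e. there is a constant $C$ with $\#\{n\in\mathbb{Z}:|Sf(n)|>\lambda\}\le \frac{C}{\lambda}\|f\|_{\ell^1}$ for all $\lambda>0$ and $f\in\ell^1(\mathbb{Z})$. For the maximal functions $P^{\gamma,*}_\pm$, the case $p=\infty$ is also allowed.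
   Context: For sequences $f$ on $\mathbb{Z}$ and $t\ge0$, $T_{t,\pm}f(n)=\sum_{j=0}^\infty e^{-t}\frac{t^j}{j!}f(n\pm j)$. For $0<\gamma<1$ and $t>0$ the Poisson semigroups are $$P_{t,\pm}^\gamma f(n)=\frac{t^{2\gamma}}{4^\gamma\Gamma(\gamma)}\int_0^\infty e^{-\frac{t^2}{4s}}\,T_{s,\pm}f(n)\,\frac{ds}{s^{1+\gamma}}=\sum_{j=0}^{\infty}\frac{t^{2\gamma}f(n\pm j)}{4^\gamma\Gamma(\gamma)\,j!}\int_0^{\infty}e^{-s-t^2/(4s)}s^{j-\gamma}\frac{ds}{s}.$$ The maximal functions are $P^{\gamma,*}_{\pm}f(n)=\sup_{t>0}|P_{t,\pm}^{\gamma}f(n)|$ and the Littlewood–Paley square functions are $$g^{\gamma}_{\pm}(f)(n)=\Big(\int_0^{\infty}|t\,\partial_tP^{\gamma}_{t,\pm}f(n)|^2\,\frac{dt}{t}\Big)^{1/2}.$$ *)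

(* Defs.v *)
From HB Require Import structures.
From mathcomp Require Import all_boot all_order all_algebra.
From mathcomp Require Import all_classical all_reals all_analysis.

Set Implicit Arguments.
Unset Strict Implicit.
Unset Printing Implicit Defensive.

Import Order.TTheory GRing.Theory Num.Theory.
Import numFieldNormedType.Exports.

Local Open Scope classical_set_scope.
Local Open Scope ring_scope.

(* The library puts the discrete sigma-algebra on nat but not on int. *)
HB.instance Definition _ := isPointed.Build int 0.
HB.instance Definition _ := @isMeasurable.Build default_measure_display
  int discrete_measurable discrete_measurable0
  discrete_measurableC discrete_measurableU.

Variant side := Plus | Minus.

Definition shift (d : side) (n : int) (j : nat) : int :=
  if d is Plus then n + j%:Z else n - j%:Z.

Section Operators.
Context {R : realType}.
Local Notation mu := (@lebesgue_measure R).
Implicit Types (d : side) (f : int -> R) (n : int) (s t gamma : R).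

Definition Gamma (x : R) : R :=
  \int[mu]_(s in `]0, +oo[) (s `^ (x - 1) * expR (- s)).

(* The total operators limn, the real-valued \int and derive1 below take their
   classical values whenever f is bounded, hence on every l^p(Z). *)
Definition heat d t f n : R :=
  limn (series (fun j => expR (- t) * (t ^+ j / j`!%:R) * f (shift d n j))).

Definition poisson gamma d t f n : R :=
  t `^ (2 * gamma) / (4 `^ gamma * Gamma gamma) *
  \int[mu]_(s in `]0, +oo[)
    (expR (- (t ^+ 2 / (4 * s))) * heat d s f n / s `^ (1 + gamma)).

Definition poisson_max gamma d f n : \bar R :=
  ereal_sup [set (`|poisson gamma d t f n|)%:E | t in [set t | 0 < t]].

Definition square_fun gamma d f n : \bar R :=
  ((\int[mu]_(t in `]0%R, +oo[)
     (`|t * derive1 (fun u => poisson gamma d u f n) t| ^+ 2 / t)%:E) `^ 2^-1)%E.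

Implicit Types (S : (int -> R) -> int -> \bar R).

(* l^p(Z) is L^p of the counting measure on int: every subset is measurable and
   only the empty set is negligible, so at p = +oo the norm is the supremum.
   S f is extended-real valued; a finite bound on its norm makes it finite. *)
Definition strong_type (p : \bar R) S : Prop :=
  exists C : R, forall f, finite_norm counting p f ->
    ('N[counting]_p[S f] <= C%:E * 'N[counting]_p[EFin \o f])%E.

Definition weak_type11 S : Prop :=
  exists C : R, forall f, finite_norm counting 1%E f ->
    forall lambda : R, 0 < lambda ->
    (counting [set n : int | lambda%:E < `|S f n|]
       <= (C / lambda)%:E * 'N[counting]_1[EFin \o f])%E.

End Operators.

(* Main.v *)
(* By the reflection n -> -n it suffices to treat the forward operators. The
   forward Poisson extension u(n, t) of f solves
     u_tt + (1 - 2 gamma) / t u_t = u(n, t) - u(n + 1, t),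
   and |u| and |t u_t| are dominated by the one-sided Hardy-Littlewood maximal
   function M f, which gives the maximal operators. For convex P this equation
   yields
     d/dt (t P'(u) u_t - 2 gamma P(u)) >= t P''(u) u_t^2 - t (P(u(n + 1)) - P(u(n))),
   and the last term telescopes in n. With P(x) = (x^2 + d^2)^(p/2) - d^p (Stein's
   convexity argument) this bounds the square function for 1 < p <= 2 and, with
   p = 1 and d the level, its truncation to {M f <= level}, hence the weak type
   (1, 1). For p > 2 the same identity with P(x) = x^2 is summed against weights
   living on the tents |m - n| <= t^2: this gives
     sum_n h(n) g(f)(n)^2 <= C sum_n (M f)^2 (M' h(n) + M' h(n - 1))
   for the two-sided maximal function M', and duality concludes. *)

Require Import Defs.
From mathcomp Require Import all_boot all_order all_algebra.
From mathcomp Require Import all_classical all_reals all_analysis.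
From mathcomp Require Import measurable_realfun.
From mathcomp Require Import ess_sup_inf.
From mathcomp Require Import zify ring lra.

Set Implicit Arguments.
Unset Strict Implicit.
Unset Printing Implicit Defensive.

Import Order.TTheory GRing.Theory Num.Theory.
Import numFieldNormedType.Exports.

Local Open Scope classical_set_scope.
Local Open Scope ring_scope.

(** * Sums over windows and the one-sided maximal function *)

Section Windows.
Context {R : realType}.
Implicit Types (F G : int -> R) (a b n : int) (L K : nat).

(** The semigroup is one-sided, hence not symmetric, and the extension equation is of second order
    in t but of first order in n, so a time t corresponds to t^2 sites. The split at p = 2 comes
    from the weight P''(u): for p <= 2 it is bounded below by a decreasing function of |u|, hence
    through the maximal function, whereas for p > 2 it would vanish with u, and P(x) = x^2 is used
    instead. Summing that energy against an arbitrary h fails, because the telescoping term then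
    meets differences of h. What is needed is a weight that decreases in t and does not grow when n
    moves left by one while t^2 increases by one; suprema of averages of h over windows containing
    the base of the tent have both properties. One may pass from h to such averages because the
    local energy at scale r grows by a controlled amount only from n + 1 to n, so it is dominated by
    a mean over the next r^2 sites. Since the square function may a priori be infinite, everything
    is proved for times in a compact interval and finite windows in n, with constants independent of
    both, and limits come last. *)

Definition wsum F a L : R := \sum_(k < L) F (a + k%:Z).

Lemma wsum0 F a : wsum F a 0 = 0.
Proof. by rewrite /wsum big_ord0. Qed.

Lemma wsumS F a L : wsum F a L.+1 = F a + wsum F (a + 1) L.
Proof.
rewrite /wsum big_ord_recl addr0; congr (_ + _); apply: eq_bigr => k _.
by congr F; rewrite /= /bump /=; lia.
Qed.

Lemma wsum_cat F a L K : wsum F a (L + K) = wsum F a L + wsum F (a + L%:Z) K.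
Proof.
rewrite /wsum big_split_ord /=; congr (_ + _); apply: eq_bigr => k _.
by congr F; lia.
Qed.

Lemma eq_wsum F G a L : F =1 G -> wsum F a L = wsum G a L.
Proof. by move=> FG; apply: eq_bigr => k _. Qed.

Lemma wsumD F G a L : wsum (fun n => F n + G n) a L = wsum F a L + wsum G a L.
Proof. exact: big_split. Qed.

Lemma wsumB F G a L : wsum (fun n => F n - G n) a L = wsum F a L - wsum G a L.
Proof. by rewrite /wsum sumrB. Qed.

Lemma wsumZ (c : R) F a L : wsum (fun n => c * F n) a L = c * wsum F a L.
Proof. by rewrite /wsum mulr_sumr. Qed.

Lemma wsum_cst (c : R) a L : wsum (fun=> c) a L = c * L%:R.
Proof. by rewrite /wsum sumr_const card_ord mulr_natr. Qed.

Lemma le_wsum_in F G a L :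
  (forall k, (k < L)%N -> F (a + k%:Z) <= G (a + k%:Z)) ->
  wsum F a L <= wsum G a L.
Proof. by move=> FG; apply: ler_sum => k _; apply: FG. Qed.

Lemma le_wsum F G a L : (forall n, F n <= G n) -> wsum F a L <= wsum G a L.
Proof. by move=> FG; apply: ler_sum. Qed.

Lemma wsum_ge0 F a L : (forall n, 0 <= F n) -> 0 <= wsum F a L.
Proof. by move=> F0; apply: sumr_ge0. Qed.

Lemma wsum_shift F n a L : wsum (fun m => F (m + n)) a L = wsum F (a + n) L.
Proof. by apply: eq_bigr => k _; congr F; lia. Qed.

Lemma wsum_telescope F a L :
  wsum (fun n => F (n + 1) - F n) a L = F (a + L%:Z) - F a.
Proof.
elim: L a => [|L IH] a; first by rewrite wsum0 addr0 subrr.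
rewrite wsumS IH (_ : a + 1 + L%:Z = a + L.+1%:Z); last by lia.
by rewrite addrC addrA subrK.
Qed.

Lemma wsum_rev F a L : wsum (F \o -%R) a L = wsum F (- a - L%:Z + 1) L.
Proof.
rewrite /wsum (reindex_inj rev_ord_inj) /=; apply: eq_bigr => k _.
by congr F; have := ltn_ord k; lia.
Qed.

Lemma wsum_sub F a L b K : (forall n, 0 <= F n) ->
  b <= a -> a + L%:Z <= b + K%:Z -> wsum F a L <= wsum F b K.
Proof.
move=> F0 ba ab.
have [i ai] : exists i : nat, a = b + i%:Z by exists `|a - b|%N; lia.
have [j Kj] : exists j : nat, K = (i + L + j)%N.
  by exists (K - (i + L))%N; lia.
rewrite Kj !wsum_cat -ai; have := wsum_ge0 b i F0.
by have := wsum_ge0 (b + (i + L)%N%:Z) j F0; lra.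
Qed.

Lemma wsum_ge1 F n a L : (forall n, 0 <= F n) ->
  a <= n -> n < a + L%:Z -> F n <= wsum F a L.
Proof.
move=> F0 an na; rewrite -[F n]addr0 -(wsum0 F (n + 1)) -wsumS.
by apply: wsum_sub => //; lia.
Qed.

(** For nonnegative [F] this bounds the sum over all integers without any limit; the passage to the
    counting measure is made once, in [tot_le_integral]. *)
Definition tot_le F (T : R) := forall a L, wsum F a L <= T.

Lemma tot_le_ge0 F (T : R) : tot_le F T -> 0 <= T.
Proof. by move=> /(_ 0 0%N); rewrite wsum0. Qed.

Lemma tot_le_pt F (T : R) n : tot_le F T -> F n <= T.
Proof. by move=> /(_ n 1%N); rewrite wsumS wsum0 addr0. Qed.

Lemma tot_le_rev F (T : R) : tot_le F T -> tot_le (F \o -%R) T.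
Proof. by move=> FK a L; rewrite wsum_rev. Qed.

Lemma tot_le_shift F (T : R) m : tot_le F T -> tot_le (fun n => F (n + m)) T.
Proof. by move=> FK a L; rewrite wsum_shift. Qed.

Lemma tot_leW F G (T : R) : (forall n, F n <= G n) -> tot_le G T -> tot_le F T.
Proof. by move=> FG GK a L; apply: le_trans (GK a L); apply: le_wsum. Qed.

Lemma tot_leD F G (T T' : R) : tot_le F T -> tot_le G T' ->
  tot_le (fun n => F n + G n) (T + T').
Proof. by move=> FK GK a L; rewrite wsumD lerD. Qed.

Lemma tot_leZ c F (T : R) : 0 <= c -> tot_le F T -> tot_le (fun n => c * F n) (c * T).
Proof. by move=> c0 FK a L; rewrite wsumZ ler_wpM2l. Qed.

(* The terms of a nonnegative series of finite sum are eventually small. *)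
Lemma tot_le_tail F (T e : R) : (forall n, 0 <= F n) -> tot_le F T -> 0 < e ->
  exists N : nat, forall n, N%:Z <= n -> F n <= e.
Proof.
move=> F0 FK e0; apply: contrapT => /forallNP nF.
have step (N : nat) : exists n : nat, (N <= n)%N /\ e < F n%:Z.
  have /existsNP[n /not_implyP[Nn /negP]] := nF N; rewrite -ltNge => en.
  by exists `|n|%N; split; [lia | rewrite (_ : `|n|%N%:Z = n) //; lia].
have big (m : nat) : exists L, m%:R * e <= wsum F 0 L.
  elim: m => [|m [L IH]]; first by exists 0%N; rewrite wsum0 mul0r.
  have [n [Ln en]] := step L; exists n.+1.
  rewrite -[n.+1](_ : (L + (n.+1 - L))%N = n.+1); last by lia.
  rewrite wsum_cat -natr1 mulrDl mul1r lerD// (le_trans (ltW en))//.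
  by apply: wsum_ge1 => //; lia.
have [m mK] : exists m : nat, T < m%:R * e.
  exists (Num.truncn (T / e)).+1; rewrite -ltr_pdivrMr//; exact: truncnS_gt.
by have [L] := big m; have := FK 0 L; lra.
Qed.

End Windows.

(** * The maximal function: covering, weak type (1, 1), interpolation *)

Section MaximalFunction.
Context {R : realType}.
Implicit Types (f : int -> R) (a n : int) (L : nat).

Definition bounded_seq f := exists B, forall n, `|f n| <= B.

(* One-sided: the averages run over [n, n + N]. *)
Definition maxfun f n : R :=
  sup [set wsum (fun m => `|f m|) n N.+1 / N.+1%:R | N in [set: nat]].

Lemma maxfun_has_sup f n : bounded_seq f ->
  has_sup [set wsum (fun m => `|f m|) n N.+1 / N.+1%:R | N in [set: nat]].
Proof.
move=> [B fB]; split; first by eexists; exists 0%N.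
exists B => _ [N _ <-]; rewrite ler_pdivrMr// -(wsum_cst B n); exact: le_wsum.
Qed.

Lemma wsum_le_maxfun f n L : bounded_seq f ->
  wsum (fun m => `|f m|) n L <= maxfun f n * L%:R.
Proof.
move=> /(maxfun_has_sup n) fS; case: L => [|N]; first by rewrite wsum0 mulr0.
by rewrite -ler_pdivrMr//; apply: ub_le_sup; [case: fS | exists N].
Qed.

Lemma abs_le_maxfun f n : bounded_seq f -> `|f n| <= maxfun f n.
Proof.
move=> fB; have := wsum_le_maxfun n 1 fB.
by rewrite wsumS wsum0 addr0 mulr1.
Qed.

Lemma maxfun_ge0 f n : bounded_seq f -> 0 <= maxfun f n.
Proof. by move=> fB; apply: le_trans (abs_le_maxfun n fB). Qed.

Lemma maxfun_le f n (T : R) :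
  (forall L, wsum (fun m => `|f m|) n L.+1 <= T * L.+1%:R) -> maxfun f n <= T.
Proof.
move=> H; apply: ge_sup; first by eexists; exists 0%N.
by move=> _ [N _ <-]; rewrite ler_pdivrMr.
Qed.

Lemma maxfun_le_bound f n (T : R) : (forall m, `|f m| <= T) -> maxfun f n <= T.
Proof.
by move=> fT; apply: maxfun_le => L; rewrite -(wsum_cst T n); exact: le_wsum.
Qed.

Lemma maxfun_gt f n (l : R) : bounded_seq f -> l < maxfun f n ->
  exists N, l * N.+1%:R < wsum (fun m => `|f m|) n N.+1.
Proof.
move=> fB lM; apply: contrapT => /forallNP H.
suff : maxfun f n <= l by rewrite leNgt lM.
by apply: maxfun_le => L; rewrite leNgt; apply/negP; exact: H.
Qed.

Definition above f (l : R) n : R := (l < maxfun f n)%R%:R.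

(* Greedy covering: scan from the left, and jump over the window that witnesses
   the first point of the level set. *)
Lemma maxfun_covering f (l : R) L a : bounded_seq f -> 0 <= l ->
  exists K, l * wsum (above f l) a L <= wsum (fun m => `|f m|) a K.
Proof.
move=> fB l0; elim/ltn_ind: L a => -[|L] IH a.
  by exists 0%N; rewrite !wsum0 mulr0.
have [lM|Ml] := ltP l (maxfun f a); last first.
  have [K HK] := IH L (ltnSn L) (a + 1).
  exists K.+1; rewrite !wsumS mulrDr {1}/above ltNge Ml /= mulr0 add0r.
  by rewrite (le_trans HK)// lerDr.
have [N HN] := maxfun_gt fB lM.
have len i : l * wsum (above f l) a i <= l * i%:R.
  rewrite ler_wpM2l// -[leRHS]mul1r -(wsum_cst 1 a); apply: le_wsum => n.
  by rewrite /above; case: (_ < _).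
have [LN|NL] := leqP L.+1 N.+1.
  exists N.+1; apply: le_trans (ltW HN); apply: le_trans (len _) _.
  by rewrite ler_wpM2l// ler_nat.
have [K HK] := IH (L.+1 - N.+1)%N ltac:(lia) (a + N.+1%:Z).
exists (N.+1 + K)%N; rewrite -(subnKC (ltnW NL)) !wsum_cat mulrDr.
by apply: lerD => //; apply: le_trans (ltW HN); exact: len.
Qed.

(** The part of [|f|] below [l / 2] contributes at most [l / 2] to any average, so [maxfun f > l]
    forces [maxfun g > l / 2] for the excess [g]. Keeping only the large values of [f] is what makes
    the sum over levels in [strong_maxfun] converge. *)
Lemma maxfun_covering2 f (l : R) L a : bounded_seq f -> 0 < l ->
  exists K, l / 2 * wsum (above f l) a L <=
    wsum (fun m => `|f m| * (l / 2 < `|f m|)%R%:R) a K.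
Proof.
move=> fB l0; pose g m : R := Num.max 0 (`|f m| - l / 2).
have g0 m : 0 <= g m by rewrite le_max lexx.
have gf m : `|g m| <= `|f m|.
  by rewrite (ger0_norm (g0 m)) ge_max; have := normr_ge0 (f m); lra.
have gB : bounded_seq g.
  by have [B HB] := fB; exists B => n; apply: le_trans (HB n).
have [K HK] := maxfun_covering L a gB (ltW (divr_gt0 l0 (ltr0n R 2))).
exists K; apply: le_trans (le_trans HK _).
  rewrite ler_wpM2l//; first by rewrite divr_ge0// ltW.
  apply: le_wsum => n; rewrite /above; case: (ltP l (maxfun f n)) => //= lM.
  rewrite ltNge; case: (leP (maxfun g n) (l / 2)) => //= gM.
  suff : maxfun f n <= l by rewrite leNgt lM.
  apply: maxfun_le => N; rewrite (_ : l = l / 2 + l / 2); last by lra.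
  rewrite mulrDl -[X in _ <= _ + X](wsum_cst (l / 2) n).
  apply: le_trans (lerD (le_trans (wsum_le_maxfun n N.+1 gB) _) (lexx _)).
    rewrite -wsumD; apply: le_wsum => m; rewrite (ger0_norm (g0 m)) /g.
    by rewrite -lerBlDr le_max lexx orbT.
  by rewrite ler_wpM2r.
apply: le_wsum => m; rewrite (ger0_norm (g0 m)) /g ge_max; apply/andP; split.
  by rewrite mulr_ge0.
by case: (ltP (l / 2) `|f m|) => /= lf; rewrite ?mulr1 ?mulr0; lra.
Qed.

Lemma weak_maxfun f (T l : R) : 0 < l -> tot_le (fun n => `|f n|) T ->
  tot_le (above f l) (T / l).
Proof.
move=> l0 fT a L.
have fB : bounded_seq f by exists T => n; exact: tot_le_pt fT.
have [K HK] := maxfun_covering L a fB (ltW l0).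
by rewrite ler_pdivlMr// mulrC (le_trans HK).
Qed.

(** By geometric growth, the terms below [Y] are dominated by the largest of them. *)
Lemma geometric_levels (r A Y : R) (k : nat) : 1 < r -> 0 <= A -> 0 <= Y ->
  \sum_(i < k) A * r ^+ i * (A * r ^+ i < Y)%R%:R <= r / (r - 1) * Y.
Proof.
move=> r1 A0 Y0; have rr : 0 < r - 1 by rewrite subr_gt0.
elim: k => [|k IH]; first by rewrite big_ord0 mulr_ge0// divr_ge0//; lra.
rewrite big_ord_recr /=; case: ltP => [AY|_]; last by rewrite mulr0 addr0.
rewrite mulr1; apply: (@le_trans _ _ (r / (r - 1) * (A * r ^+ k))); last first.
  by rewrite ler_wpM2l ?(ltW AY)// divr_ge0//; lra.
suff : \sum_(i < k) A * r ^+ i * (A * r ^+ i < Y)%R%:R <= A * r ^+ k / (r - 1).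
  move=> H; apply: le_trans (lerD H (lexx _)) _.
  by rewrite le_eqVlt; apply/orP; left; apply/eqP; field; lra.
elim: k {IH AY} => [|k IH]; first by rewrite big_ord0 divr_ge0// ?mulr_ge0// ltW.
rewrite big_ord_recr /=; apply: le_trans (lerD IH (_ : _ <= A * r ^+ k)) _.
  have Ar : 0 <= A * r ^+ k by rewrite mulr_ge0// exprn_ge0//; lra.
  by case: ltP; rewrite ?mulr1 ?mulr0.
by rewrite exprS le_eqVlt; apply/orP; left; apply/eqP; field; lra.
Qed.

(** A dyadic layer-cake bound that stops at a floor [d]: all the levels below [d] are paid for by
    the constant first term. *)
Lemma powR_levels (p d x : R) (k : nat) : 0 < p -> 0 < d -> 0 <= x ->
  x <= d * 2 ^+ k ->
  x `^ p <= d `^ p +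
    \sum_(i < k) (2 * (d * 2 ^+ i)) `^ p * (d * 2 ^+ i < x)%R%:R.
Proof.
move=> p0 d0 x0; elim: k => [|k IH].
  rewrite expr0 mulr1 big_ord0 addr0 => xd.
  by apply: ge0_ler_powR => //; rewrite ?nnegrE ltW.
rewrite big_ord_recr /= => xk; have [dx|xd] := ltP (d * 2 ^+ k) x; last first.
  by rewrite mulr0 addr0 IH.
rewrite mulr1 addrA; apply: le_trans (_ : _ <= (2 * (d * 2 ^+ k)) `^ p) _.
  apply: ge0_ler_powR; rewrite ?nnegrE// ?(ltW p0)//.
    by rewrite mulr_ge0// mulr_ge0// ?exprn_ge0// ltW.
  by rewrite (le_trans xk)// exprS; lra.
rewrite lerDr addr_ge0 ?powR_ge0// sumr_ge0// => i _.
by rewrite mulr_ge0 ?powR_ge0.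
Qed.

Lemma strong_maxfun (p : R) : 1 < p -> exists2 C, 0 <= C & forall f (T : R),
  bounded_seq f ->
  tot_le (fun n => `|f n| `^ p) T -> tot_le (fun n => maxfun f n `^ p) (C * T).
Proof.
move=> p1; have p0 : 0 < p by lra.
have q0 : 0 < p - 1 by lra.
pose r : R := 2 `^ (p - 1).
have r1 : 1 < r by have := @gt0_ltr_powR _ _ q0 1 2; rewrite powR1 !nnegrE; apply => //; lra.
(* For a level l, (2 l)^p is [2 * 2^p] times (l / 2) l^(p - 1), where l / 2 is the factor in
   [maxfun_covering2]; the rest is [geometric_levels] with ratio [r] and bound (2 x)^(p - 1). *)
pose C : R := 2 * 2 `^ p * (r / (r - 1)) * 2 `^ (p - 1).
have C0 : 0 <= C.
  by rewrite !mulr_ge0 ?powR_ge0// ?invr_ge0; lra.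
exists C => // f T fB fT a L; apply/ler_addgt0Pr => e e0.
(* The floor [d] depends on the window: its contribution over [L] sites is at most [e]. *)
have [d d0 de] : exists2 d : R, 0 < d & d `^ p * L%:R <= e.
  exists ((e / L.+1%:R) `^ p^-1); first by rewrite powR_gt0// divr_gt0.
  rewrite -powRrM mulVf ?gt_eqF// powRr1 ?divr_ge0 ?(ltW e0)//.
  by rewrite mulrAC ler_pdivrMr// ler_wpM2l ?ler_nat// ltW.
have [B HB] := fB; have MB n : maxfun f n <= B by exact: maxfun_le_bound.
have [k kB] : exists k : nat, B <= d * 2 ^+ k.
  exists (Num.truncn (B / d)).+1; rewrite mulrC -ler_pdivrMr//.
  apply: le_trans (ltW (truncnS_gt _)) _; rewrite -natrX ler_nat.
  exact: ltnW (ltn_expl _ _).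
have M0 n := maxfun_ge0 n fB.
(* One length [K] serves all levels, so that the sums over levels and over sites can be
   exchanged. *)
have [K HK] : exists K : nat, forall i, (i < k)%N ->
    (d * 2 ^+ i) / 2 * wsum (above f (d * 2 ^+ i)) a L <=
    wsum (fun m => `|f m| * ((d * 2 ^+ i) / 2 < `|f m|)%R%:R) a K.
  elim: k {kB} => [|k [K HK]]; first by exists 0%N.
  have [K' HK'] := @maxfun_covering2 f (d * 2 ^+ k) L a fB
    (mulr_gt0 d0 (exprn_gt0 k (ltr0n R 2))).
  exists (maxn K K') => i; rewrite ltnS leq_eqVlt => /orP[/eqP->|ik].
    apply: le_trans HK' _; apply: wsum_sub => [n|//|].
      by rewrite mulr_ge0.
    by rewrite lerD2l lez_nat leq_maxr.
  apply: le_trans (HK _ ik) _; apply: wsum_sub => [n|//|].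
    by rewrite mulr_ge0.
  by rewrite lerD2l lez_nat leq_maxl.
have pe (x : R) : 0 < x -> x `^ p = x * x `^ (p - 1).
  by move=> x0; rewrite mulr_powRB1// ltW.
have di0 i : 0 < d * 2 ^+ i by rewrite mulr_gt0// exprn_gt0.
have fK : wsum (fun n => `|f n| `^ p) a K <= T by exact: fT.
apply: (@le_trans _ _ (wsum (fun n => d `^ p +
    \sum_(i < k) (2 * (d * 2 ^+ i)) `^ p * above f (d * 2 ^+ i) n) a L)).
  by apply: le_wsum => n; apply: powR_levels => //; exact: le_trans (MB n) kB.
rewrite wsumD wsum_cst addrC lerD//.
rewrite /wsum exchange_big /=.
apply: le_trans (_ : _ <= \sum_(i < k) 2 * 2 `^ p * (d * 2 ^+ i) `^ (p - 1) *
   wsum (fun m => `|f m| * ((d * 2 ^+ i) / 2 < `|f m|)%R%:R) a K) _.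
  apply: ler_sum => i _; rewrite -mulr_sumr.
  rewrite powRM ?(ltW (di0 _))// (pe (d * _))//.
  apply: le_trans (_ : _ <= 2 * 2 `^ p * (d * 2 ^+ i) `^ (p - 1) *
     (d * 2 ^+ i / 2 * wsum (above f (d * 2 ^+ i)) a L)) _.
    rewrite le_eqVlt; apply/orP; left; apply/eqP.
    rewrite -/(wsum (above f (d * 2 ^+ i)) a L).
    by move: (wsum _ a L) => S; field.
  by rewrite ler_wpM2l ?HK// !mulr_ge0 ?powR_ge0.
under eq_bigr do rewrite -wsumZ.
rewrite /wsum exchange_big /=.
apply: (@le_trans _ _ (C * wsum (fun n => `|f n| `^ p) a K)); last first.
  by rewrite ler_wpM2l.
rewrite /wsum mulr_sumr; apply: ler_sum => j _.
set x := `|f _|; have [x0|x0] := leP x 0.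
  have -> : x = 0 by apply/eqP; rewrite eq_le x0 normr_ge0.
  rewrite powR0 ?gt_eqF// mulr0; apply: sumr_le0 => i _.
  by rewrite mul0r mulr0.
have := @geometric_levels r (d `^ (p - 1)) ((2 * x) `^ (p - 1)) k r1
  (powR_ge0 _ _) (powR_ge0 _ _).
rewrite powRM ?(ltW x0)// => H.
apply: le_trans (_ : _ <= 2 * 2 `^ p * x *
  (r / (r - 1) * (2 `^ (p - 1) * x `^ (p - 1)))) _; last first.
  rewrite (pe x x0) /C le_eqVlt; apply/orP; left; apply/eqP.
  by move: (r / (r - 1)) (x `^ _) (2 `^ (p - 1)) => w s s'; ring.
apply: le_trans (ler_wpM2l _ H); last by rewrite !mulr_ge0// ?powR_ge0// ltW.
rewrite mulr_sumr; apply: ler_sum => i _.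
have E : d `^ (p - 1) * r ^+ i = (d * 2 ^+ i) `^ (p - 1).
  rewrite powRM ?exprn_ge0 ?(ltW d0)//; congr (_ * _).
  by rewrite /r -!powR_mulrn ?powR_ge0// -!powRrM mulrC.
rewrite E -[in leRHS]powRM ?(ltW x0)//.
case: ltP => xi; last first.
  by rewrite !mulr0 !mulr_ge0// ?powR_ge0// ltW.
rewrite gt0_ltr_powR ?nnegrE// ?mulr_ge0 ?(ltW x0) ?exprn_ge0 ?(ltW d0)//; last lra.
by rewrite !mulr1 le_eqVlt; apply/orP; left; apply/eqP; ring.
Qed.

End MaximalFunction.

(** * Integrals of continuous functions over compact intervals *)

Section PointwiseDerivatives.
Context {R : realType}.
Implicit Types (f g : R -> R) (t a b : R).

Lemma der_eq f g t a b : is_derive t 1 f a -> f =1 g -> a = b ->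
  is_derive t 1 g b.
Proof. by move=> df /funext <- <-. Qed.

Lemma der_cst t a : is_derive t 1 (fun=> a) 0.
Proof. exact: is_derive_cst. Qed.

Lemma der_id t : is_derive t 1 id 1.
Proof. exact: is_derive_id. Qed.

Lemma derD f g t a b : is_derive t 1 f a -> is_derive t 1 g b ->
  is_derive t 1 (fun s => f s + g s) (a + b).
Proof. by move=> df dg; exact: is_deriveD. Qed.

Lemma derB f g t a b : is_derive t 1 f a -> is_derive t 1 g b ->
  is_derive t 1 (fun s => f s - g s) (a - b).
Proof. by move=> df dg; exact: is_deriveB. Qed.

Lemma derM f g t a b : is_derive t 1 f a -> is_derive t 1 g b ->
  is_derive t 1 (fun s => f s * g s) (a * g t + f t * b).
Proof.
move=> df dg; apply: is_derive_eq; rewrite /GRing.scale /=.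
by rewrite addrC [g t * a]mulrC.
Qed.

Lemma derZ f t a b : is_derive t 1 f b -> is_derive t 1 (fun s => a * f s) (a * b).
Proof. by move=> df; exact: is_deriveZ. Qed.

Lemma derX f n t a : is_derive t 1 f a ->
  is_derive t 1 (fun s => f s ^+ n) (n%:R * f t ^+ n.-1 * a).
Proof.
move=> df; elim: n => [|n IH].
  by apply: der_eq (der_cst t 1) _ _; rewrite ?mul0r.
apply: der_eq (derM df IH) _ _ => [s|/=]; first by rewrite exprS.
case: n {IH} => [|n] /=; first by rewrite expr0 !(mul0r, mulr0, mulr1, mul1r, addr0).
by rewrite exprS -[in RHS]natr1; ring.
Qed.

Lemma der_comp f g t a b : is_derive (g t) 1 f a -> is_derive t 1 g b ->
  is_derive t 1 (fun s => f (g s)) (a * b).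
Proof. by move=> df dg; exact: is_derive1_comp. Qed.

Lemma derV f t a : is_derive t 1 f a -> f t != 0 ->
  is_derive t 1 (fun s => (f s)^-1) (- a / f t ^+ 2).
Proof.
move=> df f0; apply: (is_derive_eq (is_deriveV f0 df)).
by rewrite /GRing.scale /= !mulNr mulrC.
Qed.

Lemma der_continuous f t a : is_derive t 1 f a -> {for t, continuous f}.
Proof.
by case=> dft _; apply: differentiable_continuous; apply/derivable1_diffP.
Qed.

End PointwiseDerivatives.

Section IntervalCalculus.
Context {R : realType}.
Local Notation mu := (@lebesgue_measure R).
Implicit Types (f g F : R -> R) (a b c t : R).

Definition cpos f := forall t, 0 < t -> {for t, continuous f}.

Definition Intg a b f : R := \int[mu]_(x in `[a, b]) f x.

Lemma cpos_within f a b : 0 < a -> cpos f -> {within `[a, b], continuous f}.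
Proof.
move=> a0 cf; apply: continuous_in_subspaceT => x /set_mem /=.
by rewrite in_itv /= => /andP[ax _]; apply: cf; exact: lt_le_trans ax.
Qed.

Lemma cpos_integrable f a b : 0 < a -> cpos f ->
  mu.-integrable `[a, b] (EFin \o f).
Proof.
move=> a0 cf; apply: continuous_compact_integrable; first exact: segment_compact.
exact: cpos_within.
Qed.

Lemma cpos_derive f (f' : R -> R) :
  (forall t, 0 < t -> is_derive t 1 f (f' t)) -> cpos f.
Proof.
by move=> df t t0; exact: der_continuous (df t t0).
Qed.

Lemma cpos_cst c : cpos (fun=> c).
Proof. by move=> t _; exact: cvg_cst. Qed.

Lemma cpos_id : cpos id.
Proof. by move=> t _. Qed.

Lemma cposD f g : cpos f -> cpos g -> cpos (fun t => f t + g t).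
Proof. by move=> cf cg t t0; apply: cvgD; [exact: cf | exact: cg]. Qed.

Lemma cposB f g : cpos f -> cpos g -> cpos (fun t => f t - g t).
Proof. by move=> cf cg t t0; apply: cvgB; [exact: cf | exact: cg]. Qed.

Lemma cposM f g : cpos f -> cpos g -> cpos (fun t => f t * g t).
Proof. by move=> cf cg t t0; apply: cvgM; [exact: cf | exact: cg]. Qed.

Lemma cposX f n : cpos f -> cpos (fun t => f t ^+ n).
Proof.
move=> cf; elim: n => [|n IH]; first exact: cpos_cst.
by under eq_fun do rewrite exprS; exact: cposM.
Qed.

Lemma cposV f : cpos f -> (forall t, 0 < t -> f t != 0) -> cpos (fun t => (f t)^-1).
Proof. by move=> cf f0 t t0; apply: cvgV; [exact: f0 | exact: cf]. Qed.

Lemma cpos_comp f g : continuous f -> cpos g -> cpos (fun t => f (g t)).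
Proof. by move=> cf cg t t0; apply: continuous_comp; [exact: cg|exact: cf]. Qed.

Lemma IntgD a b f g : 0 < a -> cpos f -> cpos g ->
  Intg a b (fun t => f t + g t) = Intg a b f + Intg a b g.
Proof. by move=> a0 cf cg; rewrite /Intg RintegralD//; exact: cpos_integrable. Qed.

Lemma IntgB a b f g : 0 < a -> cpos f -> cpos g ->
  Intg a b (fun t => f t - g t) = Intg a b f - Intg a b g.
Proof. by move=> a0 cf cg; rewrite /Intg RintegralB//; exact: cpos_integrable. Qed.

Lemma IntgZ a b (r : R) f : 0 < a -> cpos f ->
  Intg a b (fun t => r * f t) = r * Intg a b f.
Proof. by move=> a0 cf; rewrite /Intg RintegralZl//; exact: cpos_integrable. Qed.

Lemma le_Intg a b f g : 0 < a -> cpos f -> cpos g ->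
  (forall t, a <= t <= b -> f t <= g t) -> Intg a b f <= Intg a b g.
Proof.
move=> a0 cf cg fg; have If := cpos_integrable b a0 cf; have Ig := cpos_integrable b a0 cg.
by apply: le_Rintegral => //= x; rewrite in_itv /=; exact: fg.
Qed.

Lemma Intg_ge0 a b f : (forall t, a <= t <= b -> 0 <= f t) -> 0 <= Intg a b f.
Proof.
by move=> f0; apply: Rintegral_ge0 => x /=; rewrite in_itv /=; exact: f0.
Qed.

Lemma Intg_FTC a b f F : 0 < a -> a <= b -> cpos f ->
  (forall t, 0 < t -> is_derive t 1 F (f t)) -> Intg a b f = F b - F a.
Proof.
move=> a0; rewrite le_eqVlt => /predU1P[<-|ab] cf dF.
  by rewrite /Intg set_itv1 Rintegral_set1 subrr.
have cF := cpos_derive dF; have b0 := lt_trans a0 ab.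
rewrite /Intg /Rintegral (@continuous_FTC2 _ f F)//.
- exact: cpos_within.
- split.
  + move=> x; rewrite in_itv /= => /andP[ax _].
    by have [] := dF x (lt_trans a0 ax).
  + by apply: cvg_at_right_filter; exact: cF.
  + by apply: cvg_at_left_filter; exact: cF.
- move=> x; rewrite in_itv /= => /andP[ax _].
  by rewrite derive1E; have [_ ->] := dF x (lt_trans a0 ax).
Qed.

Lemma Intg_cst a b c : 0 < a -> a <= b -> Intg a b (fun=> c) = c * (b - a).
Proof.
move=> a0 ab; rewrite mulrBr; apply: (@Intg_FTC a b _ (fun t => c * t)) => //.
  exact: cpos_cst.
by move=> t _; have := derZ c (der_id t); rewrite mulr1.
Qed.

Lemma Intg_cat a b c f : 0 < a -> a <= b -> b <= c -> cpos f ->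
  Intg a b f + Intg b c f = Intg a c f.
Proof.
move=> a0 ab bc cf; have b0 := lt_le_trans a0 ab.
have := @Rintegral_itvB _ f (BLeft a) (BRight c) b
  (cpos_integrable _ a0 cf); rewrite !bnd_simp => /(_ ab bc).
rewrite /Intg Rintegral_itv_obnd_cbnd; last first.
  apply: integrableS (cpos_integrable c b0 cf) => //.
  exact: subset_itv_oc_cc.
by move=> <-; rewrite addrC subrK.
Qed.

Lemma le_Intg_itv a b c d f : 0 < c -> c <= a -> a <= b -> b <= d -> cpos f ->
  (forall t, 0 < t -> 0 <= f t) -> Intg a b f <= Intg c d f.
Proof.
move=> c0 ca ab bd cf f0.
have P x y : 0 < x -> 0 <= Intg x y f.
  by move=> x0; apply: Intg_ge0 => t /andP[xt _]; apply: f0; exact: lt_le_trans xt.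
have a0 := lt_le_trans c0 ca; have b0 := lt_le_trans a0 ab.
rewrite -(Intg_cat c0 (le_trans ca ab) bd)// -(Intg_cat c0 ca ab)//.
by have := P c a c0; have := P b d b0; lra.
Qed.

End IntervalCalculus.
Arguments cpos_cst {R} c.
Arguments cposX {R f} n.

(** * The extension problem; exponents up to 2 *)

Section Energy.
Context {R : realType}.
Implicit Types (n : int) (a b t x y : R).

(** Convexity in the form that the equation calls for: it turns the product of P'(u(n)) and u(n) -
    u(n + 1) into a difference of values of P, which telescopes. *)
Lemma tangent_below (P P1 P2 : R -> R) :
  (forall x, is_derive x 1 P (P1 x)) -> (forall x, is_derive x 1 P1 (P2 x)) ->
  (forall x, 0 <= P2 x) -> forall x y, P x - P y <= P1 x * (x - y).
Proof.
move=> dP dP1 P20.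
have cts (f f' : R -> R) : (forall x, is_derive x 1 f (f' x)) -> continuous f.
  by move=> df x; exact: der_continuous (df x).
have mvt (f f' : R -> R) : (forall x, is_derive x 1 f (f' x)) ->
    forall x y, x < y -> exists2 c, x < c < y & f y - f x = f' c * (y - x).
  move=> df x y xy; have cf : {within `[x, y], continuous f}.
    by apply: continuous_subspaceT; exact: cts df.
  have [c] := @MVT R f f' x y xy (fun z _ => df z) cf.
  by rewrite in_itv /=; exists c.
move=> x y; have [xy|xy|->] := ltgtP x y; last by rewrite !subrr mulr0.
  have [c /andP[xc cy] E] := mvt _ _ dP _ _ xy.
  have [d _ E'] := mvt _ _ dP1 _ _ xc.
  have : 0 <= (P1 c - P1 x) * (y - x) by rewrite E' !mulr_ge0//; lra.
  by lra.
have [c /andP[yc cx] E] := mvt _ _ dP _ _ xy.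
have [d _ E'] := mvt _ _ dP1 _ _ cx.
have : 0 <= (P1 x - P1 c) * (x - y) by rewrite E' !mulr_ge0//; lra.
by lra.
Qed.

(* The extension problem u_tt + (kappa / t) u_t = u(n) - u(n + 1), with v = u_t;
   for the Poisson semigroup kappa = 1 - 2 gamma. *)
Definition extension (kappa : R) (u v : int -> R -> R) :=
  (forall n t, 0 < t -> is_derive t 1 (u n) (v n t)) /\
  (forall n t, 0 < t ->
     is_derive t 1 (v n) (u n t - u (n + 1) t - kappa * v n t / t)).

Variables (kappa : R) (u v : int -> R -> R).
Hypothesis uv : extension kappa u v.

Lemma ext_cu n : cpos (u n).
Proof. by apply: (@cpos_derive _ _ (v n)) => t; exact: (proj1 uv). Qed.

Lemma ext_cv n : cpos (v n).
Proof. exact: cpos_derive (proj2 uv n). Qed.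

(* Integrate the derivative of [t P'(u) v - (1 - kappa) P(u)]. *)
Lemma energy (P P1 P2 : R -> R) n a b :
  (forall x, is_derive x 1 P (P1 x)) -> (forall x, is_derive x 1 P1 (P2 x)) ->
  (forall x, 0 <= P2 x) -> continuous P2 -> 0 < a -> a <= b ->
  Intg a b (fun t => t * P2 (u n t) * v n t ^+ 2) <=
  (b * P1 (u n b) * v n b - (1 - kappa) * P (u n b)) -
  (a * P1 (u n a) * v n a - (1 - kappa) * P (u n a)) +
  Intg a b (fun t => t * (P (u (n + 1) t) - P (u n t))).
Proof.
move=> dP dP1 P20 cP2 a0 ab; have [du dv] := uv.
have cu := ext_cu; have cv := ext_cv.
have cts (f f' : R -> R) : (forall x, is_derive x 1 f (f' x)) -> continuous f.
  by move=> df x; exact: der_continuous (df x).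
have cP m : cpos (fun t => P (u m t)) by apply: cpos_comp (cu m); exact: cts dP.
have cP1 m : cpos (fun t => P1 (u m t)).
  by apply: cpos_comp (cu m); exact: cts dP1.
have cA : cpos (fun t => t * P2 (u n t) * v n t ^+ 2).
  apply: cposM; last by apply: cposX; exact: cv.
  by apply: cposM; [exact: cpos_id | exact: (cpos_comp cP2 (cu n))].
have cB : cpos (fun t => t * P1 (u n t) * (u n t - u (n + 1) t)).
  apply: cposM; last exact: cposB (cu _) (cu _).
  by apply: cposM; [exact: cpos_id | exact: cP1].
have cC : cpos (fun t => t * (P (u (n + 1) t) - P (u n t))).
  by apply: cposM; [exact: cpos_id | exact: cposB].
have <- : Intg a b (fun t => t * P2 (u n t) * v n t ^+ 2 +
    t * P1 (u n t) * (u n t - u (n + 1) t)) =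
  (b * P1 (u n b) * v n b - (1 - kappa) * P (u n b)) -
  (a * P1 (u n a) * v n a - (1 - kappa) * P (u n a)).
  apply: (@Intg_FTC _ a b _
    (fun t => t * P1 (u n t) * v n t - (1 - kappa) * P (u n t))) => //.
    exact: cposD.
  move=> t t0; have dut := du n t t0; have dvt := dv n t t0.
  have H := derB (derM (derM (der_id t) (der_comp (dP1 (u n t)) dut)) dvt)
    (derZ (1 - kappa) (der_comp (dP (u n t)) dut)).
  by apply: der_eq H _ _ => //=; field; lra.
rewrite IntgD// -addrA lerDl -IntgD//.
apply: Intg_ge0 => t /andP[aft _]; have t0 := lt_le_trans a0 aft.
have := tangent_below dP dP1 P20 (u n t) (u (n + 1) t).
by rewrite -(ler_pM2l t0); lra.
Qed.

End Energy.

Lemma powR_pred {R : realType} (x r : R) : 0 < x -> x `^ r = x * x `^ (r - 1).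
Proof.
move=> x0; rewrite -{2}[x]powRr1 ?ltW// -powRD ?(gt_eqF x0) ?implybT//.
by congr (_ `^ _); ring.
Qed.

Lemma half_sub1_le0 {R : realType} (p : R) : p <= 2 -> p / 2 - 1 <= 0.
Proof. lra. Qed.

(** * Smooth convex substitutes for |x|^p, 1 <= p <= 2 *)

Section ConvexPower.
Context {R : realType}.
Variables (p d : R).
Hypotheses (p1 : 1 <= p) (p2 : p <= 2) (d0 : 0 < d).
Implicit Types x : R.

Let p_ge0 : 0 <= p. Proof. exact: le_trans ler01 p1. Qed.
Let p1_ge0 : 0 <= p - 1. Proof. by rewrite subr_ge0. Qed.

Let X x := x ^+ 2 + d ^+ 2.

Let X_gt0 x : 0 < X x.
Proof. by rewrite /X ltr_wpDl ?sqr_ge0// exprn_gt0. Qed.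

(* A smooth convex substitute for |x|^p, with a nondegenerate second
   derivative at 0. *)
Definition cpow x := X x `^ (p / 2) - (d ^+ 2) `^ (p / 2).
Definition cpow1 x := p * x * X x `^ (p / 2 - 1).
Definition cpow2 x := p * X x `^ (p / 2 - 1 - 1) * ((p - 1) * x ^+ 2 + d ^+ 2).

Let derX2 x : is_derive x 1 X (2 * x).
Proof.
apply: der_eq (derD (derX 2 (der_id x)) (der_cst x (d ^+ 2))) _ _ => //=.
by rewrite expr1; ring.
Qed.

Let derXp (r : R) x :
  is_derive x 1 (fun y => X y `^ r) (r * X x `^ (r - 1) * (2 * x)).
Proof. exact: (der_comp (is_derive1_powR r (X_gt0 x)) (derX2 x)). Qed.

Lemma cpow_derive x : is_derive x 1 cpow (cpow1 x).
Proof.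
apply: der_eq (derB (derXp (p / 2) x) (der_cst x ((d ^+ 2) `^ (p / 2)))) _ _ => //.
by rewrite /cpow1; field.
Qed.

Lemma cpow1_derive x : is_derive x 1 cpow1 (cpow2 x).
Proof.
apply: der_eq (derM (derZ p (der_id x)) (derXp (p / 2 - 1) x)) _ _ => //=.
have XE : X x `^ (p / 2 - 1) = X x * X x `^ (p / 2 - 1 - 1).
  exact: powR_pred.
rewrite /cpow2 XE; move: (X x `^ _) => Y.
by rewrite /X; field.
Qed.

Lemma cpow2_ge0 x : 0 <= cpow2 x.
Proof.
rewrite /cpow2; apply: mulr_ge0; first by rewrite mulr_ge0 ?powR_ge0.
by rewrite addr_ge0 ?sqr_ge0// mulr_ge0 ?sqr_ge0.
Qed.

Lemma cpow2_continuous : continuous cpow2.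
Proof.
move=> x; exact: (der_continuous (derM (derZ p (derXp (p / 2 - 1 - 1) x))
  (derD (derZ (p - 1) (derX 2 (der_id x))) (der_cst x (d ^+ 2))))).
Qed.

Let Xpow_le x (r : R) : x != 0 -> r <= 0 -> X x `^ r <= `|x| `^ (2 * r).
Proof.
move=> x0 r0; rewrite powRrM powR_mulrn// real_normK ?num_real//.
have x2 : 0 < x ^+ 2 by rewrite exprn_even_gt0.
rewrite -[r]opprK !(powRN _ (- r)) lef_pV2 ?posrE ?powR_gt0//.
apply: ge0_ler_powR; rewrite ?nnegrE ?sqr_ge0 ?(ltW (X_gt0 x))//; first by rewrite oppr_ge0.
by rewrite /X lerDl sqr_ge0.
Qed.

Lemma cpow1_le x : `|cpow1 x| <= p * `|x| `^ (p - 1).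
Proof.
rewrite /cpow1 !normrM (ger0_norm (powR_ge0 _ _)) (ger0_norm p_ge0).
have [->|x0] := eqVneq x 0.
  by rewrite normr0 mulr0 mul0r mulr_ge0 ?powR_ge0.
rewrite -mulrA ler_wpM2l//.
apply: (@le_trans _ _ (`|x| * `|x| `^ (2 * (p / 2 - 1)))).
  by rewrite ler_wpM2l// Xpow_le// half_sub1_le0.
rewrite -{1}[`|x|]powRr1// -powRD; last by rewrite normr_eq0 x0 implybT.
by rewrite le_eqVlt; apply/orP; left; apply/eqP; congr (_ `^ _); field.
Qed.

Lemma cpow_0 : cpow 0 = 0.
Proof. by rewrite /cpow /X expr0n add0r subrr. Qed.

Lemma cpow_ge0 x : 0 <= cpow x.
Proof.
have := tangent_below cpow_derive cpow1_derive cpow2_ge0 0 x.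
by rewrite cpow_0 /cpow1 mulr0 !mul0r sub0r oppr_le0.
Qed.

Lemma cpow_le x : cpow x <= p * `|x| `^ p.
Proof.
have := tangent_below cpow_derive cpow1_derive cpow2_ge0 x 0.
rewrite cpow_0 !subr0 => /le_trans -> //.
apply: le_trans (ler_norm _) _; rewrite normrM.
apply: le_trans (ler_wpM2r (normr_ge0 _) (cpow1_le x)) _.
by rewrite -mulrA [_ * `|x|]mulrC mulr_powRB1// (lt_le_trans ltr01).
Qed.

Lemma cpow2_ge x : p * (p - 1) * X x `^ (p / 2 - 1) <= cpow2 x.
Proof.
have XE : X x `^ (p / 2 - 1) = X x * X x `^ (p / 2 - 1 - 1).
  exact: powR_pred.
rewrite XE /cpow2; have : 0 <= p * X x `^ (p / 2 - 1 - 1).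
  by rewrite mulr_ge0 ?powR_ge0.
have : (p - 1) * X x <= (p - 1) * x ^+ 2 + d ^+ 2.
  by rewrite /X mulrDr lerD2l ler_piMl ?sqr_ge0// lerBlDr.
move=> H Y0; have := ler_wpM2l Y0 H.
by apply: le_trans; rewrite le_eqVlt; apply/orP; left; apply/eqP; ring.
Qed.

End ConvexPower.

(** At [p = 1] the bound [cpow2_ge] is void, its factor [p - 1] being 0. What remains is d^2 (x^2 +
    d^2)^(-3/2), comparable to 1 / d only where [|x| <= d]; this is why the weak type estimate is
    truncated at the level. *)
Lemma cpow2_ge_weak {R : realType} (d x : R) : 0 < d -> `|x| <= d ->
  2 `^ (- (3 / 2)) / d <= cpow2 1 d x.
Proof.
move=> d0 xd; rewrite /cpow2 subrr mul0r add0r mul1r.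
have E : 1 / 2 - 1 - 1 = - (3 / 2) :> R by field.
have D : 2 * d ^+ 2 != 0 by rewrite mulf_neq0 ?expf_neq0 ?gt_eqF.
rewrite E; have -> : 2 `^ (- (3 / 2)) / d =
    (2 * d ^+ 2) `^ (- (3 / 2)) * d ^+ 2 :> R.
  rewrite powRM ?sqr_ge0// -mulrA; congr (_ * _).
  rewrite -powR_mulrn ?(ltW d0)// -powRrM -powRD ?(gt_eqF d0) ?implybT//.
  by rewrite -powR_inv1 ?(ltW d0)//; congr (_ `^ _); field.
rewrite ler_wpM2r ?sqr_ge0// !powRN lef_pV2 ?posrE ?powR_gt0//.
- apply: ge0_ler_powR; rewrite ?nnegrE ?addr_ge0 ?sqr_ge0 ?mulr_ge0 ?(ltW d0)//.
  rewrite (_ : 2 * d ^+ 2 = d ^+ 2 + d ^+ 2); last by ring.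
  by rewrite lerD2r -real_normK ?num_real// lerXn2r// nnegrE ltW.
- by rewrite mulr_gt0 ?exprn_gt0.
- by rewrite ltr_wpDl ?sqr_ge0 ?exprn_gt0.
Qed.

Lemma powR_sqr_add {R : realType} (p x d : R) : 0 < p -> 0 <= x -> 0 <= d ->
  (x ^+ 2 + d ^+ 2) `^ (p / 2) <= 2 `^ (p / 2) * (x `^ p + d `^ p).
Proof.
move=> p0 x0 d0.
have sq (y : R) : 0 <= y -> (y ^+ 2) `^ (p / 2) = y `^ p.
  by move=> y0; rewrite -powR_mulrn// -powRrM; congr (_ `^ _); field.
have main (y z : R) : 0 <= y -> y <= z ->
    (y ^+ 2 + z ^+ 2) `^ (p / 2) <= 2 `^ (p / 2) * (y `^ p + z `^ p).
  move=> y0 yz; have z0 := le_trans y0 yz.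
  apply: (@le_trans _ _ ((2 * z ^+ 2) `^ (p / 2))).
    apply: ge0_ler_powR; rewrite ?nnegrE ?addr_ge0 ?sqr_ge0 ?mulr_ge0 ?invr_ge0 ?sqr_ge0 ?(ltW p0)//.
    rewrite (_ : 2 * z ^+ 2 = z ^+ 2 + z ^+ 2); last by ring.
    by rewrite lerD2r lerXn2r// nnegrE.
  by rewrite powRM ?sqr_ge0// sq// ler_wpM2l ?powR_ge0// lerDr powR_ge0.
have [xd|/ltW dx] := leP x d; first exact: main.
by rewrite addrC [x `^ p + _]addrC; exact: main.
Qed.

Lemma window_past (a : int) (L N : nat) :
  exists2 L' : nat, (L <= L')%N & N%:Z <= a + L'%:Z.
Proof. by exists (L + N + `|a|)%N; lia. Qed.

(** * Summed energy and the square function for exponents up to 2 *)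

Section SmallExponents.
Context {R : realType}.
Implicit Types (n : int) (a b t x y : R).

(** Decay is asked on the right only: after telescoping in [n], the integral at the right end must
    be small, while the one at the left end has the good sign. *)
Definition uniform_tail (u : int -> R -> R) := forall e : R, 0 < e ->
  exists N : nat, forall n t, N%:Z <= n -> 0 < t -> `|u n t| <= e.

(** The constant collects [p * K] for each of the boundary terms in [v] at [a] and [b], and
    [2 * p * K] for the term [(1 - kappa) * P(u)] at [a]; the same term at [b] has the good sign. *)
Lemma energy_sum (kappa : R) (u v : int -> R -> R) (p d K a b : R) :
  extension kappa u v -> -1 <= kappa <= 1 -> uniform_tail u ->
  1 <= p -> p <= 2 -> 0 < d -> 0 < a -> a <= b ->
  (forall t, 0 < t ->
    tot_le (fun n => `|u n t| `^ (p - 1) * `|t * v n t|) K) ->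
  (forall t, 0 < t -> tot_le (fun n => `|u n t| `^ p) K) ->
  tot_le (fun n => Intg a b (fun t => t * cpow2 p d (u n t) * v n t ^+ 2))
    (4 * p * K).
Proof.
move=> uv /andP[kap1 kap2] ut p1 p2 d0 a0 ab vK uK A L.
have p0 : 0 <= p := le_trans ler01 p1.
have pp : 0 < p := lt_le_trans ltr01 p1.
have b0 : 0 < b := lt_le_trans a0 ab.
have D1 := cpow_derive p d0; have D2 := cpow1_derive p d0.
have C2 := @cpow2_continuous _ p d d0; have G2 := cpow2_ge0 d p1.
have cu := ext_cu uv; have cv := ext_cv uv.
have cP n : cpos (fun t => t * cpow p d (u n t)).
  apply: cposM; first exact: cpos_id.
  apply: cpos_comp (cu n) => x; exact: der_continuous (D1 x).
pose J n := Intg a b (fun t => t * cpow p d (u n t)).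
have F0 n : 0 <= Intg a b (fun t => t * cpow2 p d (u n t) * v n t ^+ 2).
  apply: Intg_ge0 => t /andP[aft _].
  by rewrite mulr_ge0 ?sqr_ge0// mulr_ge0//; apply: ltW; exact: lt_le_trans aft.
have J0 n : 0 <= J n.
  apply: Intg_ge0 => t /andP[aft _].
  rewrite mulr_ge0 ?cpow_ge0//; apply: ltW; exact: lt_le_trans aft.
have bnd t : 0 < t ->
    tot_le (fun n => `|t * cpow1 p d (u n t) * v n t|) (p * K).
  move=> t0; apply: tot_leW (tot_leZ p0 (vK t t0)) => n.
  rewrite [t * _]mulrC -mulrA normrM mulrA.
  by rewrite ler_wpM2r// cpow1_le.
have bnd2 t : 0 < t -> tot_le (fun n => (1 - kappa) * cpow p d (u n t)) (2 * (p * K)).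
  move=> t0; apply: tot_leW (tot_leZ (ler0n _ 2) (tot_leZ p0 (uK t t0))) => n.
  apply: ler_pM => //; rewrite ?cpow_ge0 ?cpow_le//; lra.
apply/ler_addgt0Pr => e e0.
(* [eta] is the bound on [|u|] that makes the integral at the right end at most [e]; [M + 1] avoids
   a division by zero when [a = b]. *)
have [eta eta0 etae] : exists2 eta, 0 < eta & b * (p * eta `^ p) * (b - a) <= e.
  pose M := b * p * (b - a).
  have M0 : 0 <= M by rewrite !mulr_ge0 ?subr_ge0 ?(ltW b0).
  have M1 : 0 < M + 1 by rewrite ltr_wpDl.
  exists ((e / (M + 1)) `^ p^-1); first by rewrite powR_gt0// divr_gt0.
  rewrite -powRrM mulVf ?gt_eqF// powRr1 ?divr_ge0 ?(ltW e0) ?(ltW M1)//.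
  rewrite (_ : b * _ * _ = e * (M / (M + 1))); last first.
    by move: (M + 1)^-1 => w; rewrite /M; ring.
  by rewrite ler_piMr ?(ltW e0)// ler_pdivrMr// mul1r lerDl.
have [N HN] := ut _ eta0.
(* The terms are nonnegative, so the window may be prolonged to where [u] is small. *)
have [L' LL' NL'] := window_past A L N.
have JN : J (A + L'%:Z) <= e.
  apply: le_trans etae; rewrite -(Intg_cst _ a0 ab).
  apply: (le_Intg a0 (cP _) (@cpos_cst _ _)) => t /andP[aft tb].
  have t0 := lt_le_trans a0 aft.
  have Pt := le_trans (cpow_le p1 p2 d0 (u (A + L'%:Z) t))
    (ler_wpM2l p0 (ge0_ler_powR p0 (normr_ge0 _) (ltW eta0) (HN _ _ NL' t0))).
  exact: ler_pM (ltW t0) (cpow_ge0 p1 d0 _) tb Pt.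
apply: (@le_trans _ _ (wsum (fun n =>
    Intg a b (fun t => t * cpow2 p d (u n t) * v n t ^+ 2)) A L')).
  by apply: wsum_sub => //; rewrite lerD2l lez_nat.
pose T n t : R := `|t * cpow1 p d (u n t) * v n t|.
apply: (@le_trans _ _ (wsum (fun n =>
    T n b + T n a + (1 - kappa) * cpow p d (u n a) + (J (n + 1) - J n)) A L')).
  apply: le_wsum => n.
  apply: le_trans (energy uv n D1 D2 G2 C2 a0 ab) _.
  rewrite (_ : Intg a b _ = J (n + 1) - J n); last first.
    by rewrite /J -IntgB//; congr Intg; apply/funext => t; ring.
  rewrite lerD2r /T.
  have := ler_norm (b * cpow1 p d (u n b) * v n b).
  have := ler_norm (- (a * cpow1 p d (u n a) * v n a)); rewrite normrN.
  have : 0 <= (1 - kappa) * cpow p d (u n b) by rewrite mulr_ge0 ?cpow_ge0//; lra.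
  by move=> h1 h2 h3; lra.
rewrite wsumD wsum_telescope 2!wsumD.
move: (bnd b b0 A L') (bnd a a0 A L') (bnd2 a a0 A L') (J0 A) JN.
rewrite /T; do 3!move: (wsum _ _ _) => ?; move: (J _) (J _) => ? ?; clear.
by lra.
Qed.

End SmallExponents.

Section SmallExponentBounds.
Context {R : realType}.
Implicit Types (n : int) (a b t x y : R).

(** The square of the square function with times cut to [a, b]: |t v|^2 / t is t v^2. *)
Definition gsq (v : int -> R -> R) a b n := Intg a b (fun t => t * v n t ^+ 2).

Lemma gsq_ge0 (v : int -> R -> R) a b n : 0 < a -> 0 <= gsq v a b n.
Proof.
move=> a0; apply: Intg_ge0 => t /andP[aft _].
by rewrite mulr_ge0 ?sqr_ge0//; apply: ltW; exact: lt_le_trans aft.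
Qed.

Lemma gsq_weighted (kappa : R) (u v : int -> R -> R) (w : R) (P2 : R -> R) a b n :
  extension kappa u v -> 0 < a -> continuous P2 ->
  (forall t, a <= t <= b -> w <= P2 (u n t)) ->
  w * gsq v a b n <= Intg a b (fun t => t * P2 (u n t) * v n t ^+ 2).
Proof.
move=> uv a0 cP wP; have cv := @ext_cv _ _ _ _ uv n; have cu := @ext_cu _ _ _ _ uv n.
have c1 : cpos (fun t => t * v n t ^+ 2).
  by apply: cposM; [exact: cpos_id | exact: cposX].
rewrite -IntgZ//; apply: le_Intg => //.
- by apply: cposM c1; exact: cpos_cst.
- apply: cposM; last exact: cposX.
  by apply: cposM; [exact: cpos_id | exact: (cpos_comp cP cu)].
move=> t /andP[aft tb]; have t0 := lt_le_trans a0 aft.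
rewrite mulrA [w * t]mulrC ler_wpM2r ?sqr_ge0// ler_wpM2l ?(ltW t0)//.
by rewrite wP// aft.
Qed.

(** Either [G <= X], or the nonpositive exponent [p / 2 - 1] reverses the order of [G] and [X]. This
    replaces Hoelder's inequality over the sites. *)
Lemma powR_split (p X G : R) : p / 2 - 1 <= 0 -> 0 < p -> 0 < X -> 0 <= G ->
  G `^ (p / 2) <= X `^ (p / 2) + X `^ (p / 2 - 1) * G.
Proof.
move=> p2 p0 X0 G0; have hp : 0 < p / 2 by rewrite divr_gt0.
have [GX|XG] := leP G X.
  apply: (@le_trans _ _ (X `^ (p / 2))).
    by apply: ge0_ler_powR; rewrite ?nnegrE// ltW.
  by rewrite lerDl mulr_ge0 ?powR_ge0.
have G1 := lt_trans X0 XG.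
rewrite (powR_pred (p / 2) G1); apply: (@le_trans _ _ (X `^ (p / 2 - 1) * G)).
  rewrite mulrC ler_wpM2r// -[p / 2 - 1]opprK !(powRN _ (- _)).
  rewrite lef_pV2 ?posrE ?powR_gt0//.
  by apply: ge0_ler_powR; rewrite ?nnegrE ?oppr_ge0// ltW.
by rewrite lerDr powR_ge0.
Qed.

(* For [p < 2], [cpow2] degenerates where [u] is large, at worst like
   [(m^2 + d^2)^(p/2 - 1)]; [powR_split] trades this weight for the power [p/2]. *)
Lemma gsq_strong_le2 (kappa p : R) : -1 <= kappa <= 1 -> 1 < p -> p <= 2 ->
  exists2 C, 0 <= C & forall (u v : int -> R -> R) (m : int -> R) (K a b : R),
  extension kappa u v -> (forall n, 0 <= m n) ->
  (forall n t, 0 < t -> `|u n t| <= m n) ->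
  (forall n t, 0 < t -> `|t * v n t| <= m n) ->
  tot_le (fun n => m n `^ p) K -> 0 < a -> a <= b ->
  tot_le (fun n => gsq v a b n `^ (p / 2)) (C * K).
Proof.
move=> kap p1 p2; have p0 : 0 < p by lra.
have pm : 0 < p - 1 by rewrite subr_gt0.
have h0 := half_sub1_le0 p2.
have hp : 0 <= p / 2 by rewrite divr_ge0// ltW.
pose c := 2 `^ (p / 2).
have c0 : 0 <= c by exact: powR_ge0.
(* [c] comes from [powR_sqr_add], and [4 / (p - 1)] is the energy bound [4 * p * K] divided by the
   curvature factor [p * (p - 1)]. *)
exists (c + 4 / (p - 1)); first by rewrite addr_ge0// divr_ge0// ltW.
move=> u v m K a b uv m0 um vm mK a0 ab A L.
have ut : uniform_tail u.
  move=> e e0; have e1 : 0 < e `^ p by rewrite powR_gt0.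
  have [N HN] := tot_le_tail (fun n => powR_ge0 _ _) mK e1.
  exists N => n t Nn t0; apply: le_trans (um n t t0) _.
  have [//|/(gt0_ltr_powR p0)] := leP (m n) e.
  by rewrite !nnegrE (ltW e0) m0 => /(_ isT isT); rewrite ltNge HN.
have bu (t : R) : 0 < t -> tot_le (fun n => `|u n t| `^ p) K.
  move=> t0; apply: tot_leW mK => n.
  by apply: ge0_ler_powR; rewrite ?nnegrE ?(ltW p0)// um.
have bv (t : R) : 0 < t -> tot_le (fun n => `|u n t| `^ (p - 1) * `|t * v n t|) K.
  move=> t0; apply: tot_leW mK => n.
  rewrite -(mulr_powRB1 (m0 n) p0) mulrC; apply: ler_pM; rewrite ?powR_ge0 ?vm//.
  by apply: ge0_ler_powR; rewrite ?nnegrE ?(ltW pm)// um.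
apply/ler_addgt0Pr => e e0.
(* The regularization costs c d^p per site; [d] makes this at most [e] over the window. *)
have [d d0 de] : exists2 d : R, 0 < d & c * d `^ p * L%:R <= e.
  exists ((e / (c * L%:R + 1)) `^ p^-1).
    by rewrite powR_gt0// divr_gt0// ltr_wpDl// mulr_ge0.
  have w0 : 0 < c * L%:R + 1 by rewrite ltr_wpDl// mulr_ge0.
  rewrite -powRrM mulVf ?gt_eqF// powRr1 ?divr_ge0 ?(ltW e0) ?(ltW w0)//.
  rewrite (_ : _ * _ * _ = e * (c * L%:R / (c * L%:R + 1))); last first.
    by move: (_ + 1)^-1 => z; ring.
  by rewrite ler_piMr ?(ltW e0)// ler_pdivrMr// mul1r lerDl.
have H := energy_sum uv kap ut (ltW p1) p2 d0 a0 ab bv bu A L.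
set F := (fun n => Intg a b _) in H.
apply: (@le_trans _ _ (wsum (fun n => c * (m n `^ p) + c * d `^ p + 
   (p * (p - 1))^-1 * F n) A L)).
  apply: le_wsum => n; pose X := m n ^+ 2 + d ^+ 2.
  have X0 : 0 < X by rewrite ltr_wpDl ?sqr_ge0// exprn_gt0.
  apply: le_trans (powR_split h0 p0 X0 (gsq_ge0 v b n a0)) _.
  apply: lerD; first by rewrite -mulrDr; apply: powR_sqr_add => //; exact: ltW.
  rewrite ler_pdivlMl ?mulr_gt0// mulrA.
  apply: (gsq_weighted uv a0 (@cpow2_continuous _ p d d0)) => t /andP[aft _].
  have t0 := lt_le_trans a0 aft.
  apply: le_trans (cpow2_ge (ltW p1) p2 d0 _).
  rewrite ler_wpM2l ?mulr_ge0 ?(ltW p0) ?(ltW pm)//.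
  have Y0 : 0 < u n t ^+ 2 + d ^+ 2 by rewrite ltr_wpDl ?sqr_ge0// exprn_gt0.
  rewrite -[p / 2 - 1]opprK !(powRN _ (- _)) lef_pV2 ?posrE ?powR_gt0//.
  apply: ge0_ler_powR; rewrite ?nnegrE ?oppr_ge0 ?(ltW X0) ?(ltW Y0)//.
  by rewrite lerD2r -real_normK ?num_real// lerXn2r ?nnegrE// um.
rewrite !wsumD wsumZ wsum_cst wsumZ.
have mA := mK A L.
have H1 : (p * (p - 1))^-1 * wsum F A L <= 4 / (p - 1) * K.
  rewrite mulrC ler_pdivrMr ?mulr_gt0//.
  apply: le_trans H _; rewrite le_eqVlt; apply/orP; left; apply/eqP.
  by field; rewrite gt_eqF.
have H2 := ler_wpM2l c0 mA.
by move: H1 H2 de; clear; lra.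
Qed.

(** The total energy at [p = 1] is at most [4 * K], and where [m n <= l] the curvature along [u n]
    is at least [c / l]. The resulting factor [l] becomes 1 / l after Chebyshev's inequality at
    level l^2. *)
Lemma gsq_weak (kappa : R) : -1 <= kappa <= 1 ->
  exists2 C, 0 <= C & forall (u v : int -> R -> R) (m : int -> R) (K a b l : R),
  extension kappa u v -> uniform_tail u ->
  (forall n t, 0 < t -> `|u n t| <= m n) ->
  (forall t, 0 < t -> tot_le (fun n => `|u n t|) K) ->
  (forall t, 0 < t -> tot_le (fun n => `|t * v n t|) K) -> 0 < a -> a <= b ->
  0 < l ->
  tot_le (fun n => (m n <= l)%R%:R * gsq v a b n) (C * l * K).
Proof.
move=> kap; pose c : R := 2 `^ (- (3 / 2)).
have c0 : 0 < c by rewrite powR_gt0.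
exists (4 / c); first by rewrite divr_ge0// ltW.
move=> u v m K a b l uv ut um uK vK a0 ab l0 A L.
have bu (t : R) : 0 < t -> tot_le (fun n => `|u n t| `^ 1) K.
  by move=> t0; apply: tot_leW (uK t t0) => n; rewrite powRr1.
have bv (t : R) : 0 < t -> tot_le (fun n => `|u n t| `^ (1 - 1) * `|t * v n t|) K.
  by move=> t0; apply: tot_leW (vK t t0) => n; rewrite subrr powRr0 mul1r.
have H := energy_sum uv kap ut (lexx 1) (ler1n _ 2) l0 a0 ab bv bu A L.
set F := (fun n => Intg a b _) in H.
apply: (@le_trans _ _ (wsum (fun n => (l / c) * F n) A L)); last first.
  rewrite wsumZ; apply: le_trans (ler_wpM2l _ H) _; first by rewrite divr_ge0// ltW.
  by rewrite le_eqVlt; apply/orP; left; apply/eqP; field; rewrite gt_eqF.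
apply: le_wsum => n; have G0 := gsq_ge0 v b n a0.
have F0 : 0 <= F n.
  apply: Intg_ge0 => t /andP[aft _]; have t0 := lt_le_trans a0 aft.
  by rewrite mulr_ge0 ?sqr_ge0// mulr_ge0 ?(ltW t0)// cpow2_ge0.
case: (leP (m n) l) => [ml|_] /=; last by rewrite mul0r mulr_ge0// divr_ge0// ltW.
rewrite mul1r -ler_pdivrMl ?divr_gt0// invf_div.
apply: (gsq_weighted uv a0 (@cpow2_continuous _ 1 l l0)) => t /andP[aft _].
apply: cpow2_ge_weak => //; apply: le_trans (um n t _) ml.
exact: lt_le_trans aft.
Qed.

End SmallExponentBounds.

(** * Exponents above 2 *)

Section Averaging.
Context {R : realType}.
Implicit Types (n : int) (r t x y z : R).

(** Completing the square in th z, where th is the cutoff: the left side is at most b^2 v^2 / 2 with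
    b = 2 th' - k th / t. Both factors of th are at most [7 * r], so th <= 49, and |b| <= (14 + 49)
    / r; half of 63^2 is below 2000. *)
Lemma cutoff_square_bound r t (k v z : R) : 0 < r -> r <= t <= 8 * r -> -1 <= k <= 1 ->
  - 2 * (((t - r) * (8 * r - t) / r ^+ 2) ^+ 2 * z ^+ 2 +
    (2 * ((t - r) * (8 * r - t) / r ^+ 2) * ((9 * r - 2 * t) / r ^+ 2) -
       k * ((t - r) * (8 * r - t) / r ^+ 2) ^+ 2 / t) * v * z) <=
  2000 / r ^+ 2 * v ^+ 2.
Proof.
move=> r0 /andP[rt tr] /andP[k1 k2].
have t0 : 0 < t by exact: lt_le_trans rt.
pose th := (t - r) * (8 * r - t) / r ^+ 2.
pose b := 2 * ((9 * r - 2 * t) / r ^+ 2) - k * th / t.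
have r2 : 0 < r ^+ 2 by rewrite exprn_gt0.
have th0 : 0 <= th by rewrite divr_ge0 ?(ltW r2)// mulr_ge0// subr_ge0.
have th1 : th <= 49.
  rewrite ler_pdivrMr// (_ : 49 * r ^+ 2 = (7 * r) * (7 * r)); last by ring.
  by apply: ler_pM; rewrite ?subr_ge0//; lra.
have b1 : b <= 63 / r /\ - (63 / r) <= b.
  have A1 : 2 * ((9 * r - 2 * t) / r ^+ 2) <= 14 / r.
    rewrite mulrA ler_pdivrMr// (_ : 14 / r * r ^+ 2 = 14 * r); last by field; lra.
    lra.
  have A2 : - (14 / r) <= 2 * ((9 * r - 2 * t) / r ^+ 2).
    rewrite mulrA ler_pdivlMr// (_ : - (14 / r) * r ^+ 2 = - 14 * r); last by field; lra.
    lra.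
  have T1 : 0 <= th / t by rewrite divr_ge0// ltW.
  have T2 : th / t <= 49 / r.
    by apply: ler_pM; rewrite ?invr_ge0 ?(ltW t0)// lef_pV2 ?posrE.
  have T3 : k * th / t <= 49 / r.
    by rewrite -mulrA; apply: le_trans T2; rewrite ler_piMl.
  have T4 : - (49 / r) <= k * th / t.
    rewrite -mulrA lerNl -mulNr; apply: le_trans T2; rewrite ler_piMl//; lra.
  have -> : 63 / r = 14 / r + 49 / r by field; lra.
  by move: A1 A2 T3 T4; rewrite /b; clear; split; lra.
have b2 : b ^+ 2 <= 3969 / r ^+ 2.
  rewrite (_ : 3969 / r ^+ 2 = (63 / r) ^+ 2); last by field; lra.
  by rewrite -real_normK ?num_real// lerXn2r ?nnegrE ?divr_ge0 ?(ltW r0)// ler_norml; case: b1 => -> ->.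
rewrite (_ : - 2 * _ = - 2 * (th ^+ 2 * z ^+ 2 + th * b * v * z)); last first.
  by rewrite /b /th; field; rewrite !gt_eqF.
apply: (@le_trans _ _ (b ^+ 2 * v ^+ 2 / 2)).
  have : 0 <= (2 * (th * z) + b * v) ^+ 2 by exact: sqr_ge0.
  by move: (th) (b) => x y; clear; lra.
apply: (@le_trans _ _ (3969 / r ^+ 2 * v ^+ 2 / 2)).
  by rewrite ler_wpM2r// ler_wpM2r ?sqr_ge0.
have : 0 <= v ^+ 2 / r ^+ 2 by rewrite divr_ge0 ?sqr_ge0.
rewrite [v ^+ 2 / _]mulrC; move: (r ^+ 2)^-1 (v ^+ 2) => c w.
by clear; lra.
Qed.

(** A parabola that vanishes at [r] and [8 * r], so that integrations by parts leave no boundary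
    term, and stays at least 4 on [2r, 4r]. *)
Definition cutoff r t := (t - r) * (8 * r - t) / r ^+ 2.

Lemma cutoff_derive r t : is_derive t 1 (cutoff r) ((9 * r - 2 * t) / r ^+ 2).
Proof.
apply: der_eq (derM (derM (derB (der_id t) (der_cst t r))
  (derB (der_cst t (8 * r)) (der_id t))) (der_cst t (r ^+ 2)^-1)) _ _ => //=.
by ring.
Qed.

Lemma cutoff_cpos r : cpos (cutoff r).
Proof. by move=> t _; exact: der_continuous (cutoff_derive r t). Qed.

Arguments cutoff_cpos : clear implicits.

(** Integrate the derivative of th^2 v z, with z = u(n) - u(n + 1), to get 0. By the equation v_t
    contains z, which gives th^2 z^2, and z_t = v(n) - v(n + 1) gives [B]. Since v(n)^2 - v(n + 1)^2
    <= 2 v(n) (v(n) - v(n + 1)), the energy difference is at most the integral of [2 * B], hence of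
    [- 2 * A]. *)
Lemma cutoff_step : exists2 D : R, 0 <= D &
  forall (kappa : R) (u v : int -> R -> R) r n,
  extension kappa u v -> -1 <= kappa <= 1 -> 0 < r ->
  Intg r (8 * r) (fun t => cutoff r t ^+ 2 * v n t ^+ 2) <=
  Intg r (8 * r) (fun t => cutoff r t ^+ 2 * v (n + 1) t ^+ 2) +
  D / r ^+ 2 * Intg r (8 * r) (fun t => v n t ^+ 2).
Proof.
have [D [D0 HD]] : exists D : R, 0 <= D /\ D = 2000.
  by exists 2000; split; [exact: ler0n | reflexivity].
exists D; first exact: D0.
move=> kappa u v r n uv kap r0; have cv m : cpos (v m) by exact: (@ext_cv _ _ _ _ uv m).
have cu m : cpos (u m) by exact: (@ext_cu _ _ _ _ uv m).
have r8 : r <= 8 * r by lra.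
pose th := cutoff r; pose z t := u n t - u (n + 1) t.
have cz : cpos z := cposB (@cu n) (@cu (n + 1)).
have cth2 : cpos (fun t => th t ^+ 2) := cposX 2 (cutoff_cpos r).
pose A t := th t ^+ 2 * z t ^+ 2 +
   (2 * th t * ((9 * r - 2 * t) / r ^+ 2) - kappa * th t ^+ 2 / t) * v n t * z t.
pose B t := th t ^+ 2 * v n t * (v n t - v (n + 1) t).
have cB : cpos B := cposM (cposM cth2 (@cv n)) (cposB (@cv n) (@cv (n + 1))).
have ctv m : cpos (fun t => th t ^+ 2 * v m t ^+ 2) := cposM cth2 (cposX 2 (@cv m)).
have ct : cpos (fun t : R => t^-1).
  by apply: cposV => [|t t0]; [exact: cpos_id | rewrite gt_eqF].
have cA : cpos A.
  apply: cposD; first exact: (cposM cth2 (cposX 2 cz)).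
  apply: (cposM (cposM _ (@cv n)) cz); apply: cposB.
    apply: (cposM (cposM (cpos_cst 2) (cutoff_cpos r))).
    apply: (cposM _ (cpos_cst (r ^+ 2)^-1)).
    exact: (cposB (cpos_cst _) (cposM (cpos_cst 2) (@cpos_id R))).
  exact: (cposM (cposM (cpos_cst kappa) cth2) ct).
have dF t : 0 < t -> is_derive t 1 (fun t => th t ^+ 2 * v n t * z t) (A t + B t).
  move=> t0; have du := proj1 uv n t t0; have du1 := proj1 uv (n + 1) t t0.
  have dv := proj2 uv n t t0.
  apply: der_eq (derM (derM (derX 2 (cutoff_derive r t)) dv) (derB du du1)) _ _ => [//|].
  rewrite /A /B /z /th expr1 /=; move: (cutoff r t) => c.
  move: (v n t) (v (n + 1) t) (u n t) (u (n + 1) t) => v0 v1 u0 u1.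
  by move: (_ / r ^+ 2) => d; move: (t^-1) => s; ring.
have AB : Intg r (8 * r) (fun t => A t + B t) = 0.
  rewrite (Intg_FTC r0 r8 (cposD cA cB) dF) /th /cutoff.
  by rewrite !subrr mulr0 !mul0r expr0n !mul0r subrr.
have lo : Intg r (8 * r) (fun t => th t ^+ 2 * v n t ^+ 2 - th t ^+ 2 * v (n + 1) t ^+ 2)
    <= Intg r (8 * r) (fun t => 2 * B t).
  apply: le_Intg => //.
  - exact: (cposB (ctv n) (ctv (n + 1))).
  - exact: (cposM (cpos_cst 2) cB).
  move=> t _; rewrite -subr_ge0 (_ : _ - _ = th t ^+ 2 * (v n t - v (n + 1) t) ^+ 2).
    by rewrite mulr_ge0 ?sqr_ge0.
  by rewrite /B; ring.
have hi : Intg r (8 * r) (fun t => - 2 * A t) <=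
    Intg r (8 * r) (fun t => D / r ^+ 2 * v n t ^+ 2).
  apply: le_Intg => //.
  - exact: (cposM (cpos_cst (- 2)) cA).
  - exact: (cposM (cpos_cst _) (cposX 2 (@cv n))).
  by move=> t tr; rewrite HD; exact: cutoff_square_bound.
rewrite (IntgB _ r0 (ctv n) (ctv (n + 1))) (IntgZ _ _ r0 cB) in lo.
rewrite (IntgZ _ _ r0 cA) (IntgZ _ _ r0 (cposX 2 (@cv n))) in hi.
rewrite (IntgD _ r0 cA cB) in AB.
move: lo hi AB; do 5!move: (Intg _ _ _) => ?; move: (D / _ * _) => ?.
by clear; lra.
Qed.

(* The local energy [E(n)], cut off to [r, 8r], satisfies
   [E(n) <= E(n + 1) + C / r^2 gsq(n)], so it is controlled by its average over the
   next [r^2] sites. *)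
Lemma dyadic_average : exists2 C : R, 0 <= C &
  forall (kappa : R) (u v : int -> R -> R) (rho : nat) r n,
  extension kappa u v -> -1 <= kappa <= 1 -> 0 < r -> r ^+ 2 = rho%:R ->
  gsq v (2 * r) (4 * r) n <=
  C / rho%:R * wsum (gsq v r (8 * r)) n rho.
Proof.
have [D D0 step0] := cutoff_step.
have [B [B0 HB]] : exists B : R, 0 <= B /\ B = 49 ^+ 2.
  by exists (49 ^+ 2); rewrite sqr_ge0.
exists ((B + D) / 4); first by rewrite divr_ge0// addr_ge0.
move=> kappa u v rho r n uv kap r0 rE; have cv m : cpos (v m) by exact: (@ext_cv _ _ _ _ uv m).
have r8 : r <= 8 * r by lra.
have r2 : 0 < r ^+ 2 by rewrite exprn_gt0.
pose y := gsq v r (8 * r); pose Y m := Intg r (8 * r) (fun t => v m t ^+ 2).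
pose E m := Intg r (8 * r) (fun t => cutoff r t ^+ 2 * v m t ^+ 2).
have cE m : cpos (fun t => cutoff r t ^+ 2 * v m t ^+ 2).
  exact: (cposM (cposX 2 (cutoff_cpos r)) (cposX 2 (@cv m))).
have cy m : cpos (fun t => t * v m t ^+ 2).
  exact: (cposM (@cpos_id R) (cposX 2 (@cv m))).
have y0 m : 0 <= y m by exact: gsq_ge0.
have Yy m : Y m <= y m / r.
  rewrite ler_pdivlMr// mulrC -(IntgZ _ _ r0 (cposX 2 (@cv m))); apply: (le_Intg r0) => //.
    exact: (cposM (cpos_cst r) (cposX 2 (@cv m))).
  by move=> t /andP[rt _]; rewrite ler_wpM2r ?sqr_ge0.
have Ey m : E m <= B / r * y m.
  rewrite mulrAC -mulrA; apply: (le_trans _ (ler_wpM2l B0 (Yy m))).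
  rewrite -(IntgZ _ _ r0 (cposX 2 (@cv m))); apply: (le_Intg r0 (cE m)).
    exact: (cposM (cpos_cst B) (cposX 2 (@cv m))).
  move=> t /andP[rt tr]; rewrite ler_wpM2r ?sqr_ge0//.
  rewrite HB.
  have c0 : 0 <= cutoff r t by rewrite divr_ge0 ?(ltW r2)// mulr_ge0// subr_ge0.
  rewrite lerXn2r ?nnegrE// ler_pdivrMr//.
  rewrite (_ : 49 * r ^+ 2 = (7 * r) * (7 * r)); last by ring.
  by apply: ler_pM; rewrite ?subr_ge0//; move: rt tr; clear; lra.
have step m : E m <= E (m + 1) + D / r ^+ 3 * y m.
  apply: le_trans (step0 _ _ _ _ m uv kap r0) _; rewrite lerD2l.
  apply: le_trans (ler_wpM2l _ (Yy m)) _; first by rewrite divr_ge0// ltW.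
  by rewrite le_eqVlt; apply/orP; left; apply/eqP; field; rewrite gt_eqF.
have Dr0 : 0 <= D / r ^+ 3 by rewrite divr_ge0// exprn_ge0// ltW.
have steps (k : nat) : E n <= E (n + k%:Z) + D / r ^+ 3 * wsum y n k.
  elim: k => [|k IH]; first by rewrite addr0 wsum0 mulr0 addr0.
  apply: le_trans IH _; rewrite -[k.+1]addn1 wsum_cat wsumS wsum0 addr0 mulrDr.
  rewrite (_ : n + (k + 1)%N%:Z = n + k%:Z + 1); last by rewrite PoszD addrA.
  by rewrite [_ * _ + _ * y _]addrC addrA lerD2r; exact: step.
(* Averaging [steps] over [rho] sites: since [rho = r ^+ 2], the accumulated error has the size of
   the main term. *)
have sumE : rho%:R * E n <= (B + D) / r * wsum y n rho.
  have -> : rho%:R * E n = \sum_(k < rho) E n.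
    by rewrite sumr_const card_ord mulr_natl.
  apply: (@le_trans _ _ (\sum_(k < rho) (B / r * y (n + k%:Z) +
      D / r ^+ 3 * wsum y n rho))).
    apply: ler_sum => k _; apply: le_trans (steps k) _; apply: lerD => //.
    by rewrite ler_wpM2l//; apply: wsum_sub => //; rewrite lerD2l lez_nat ltnW.
  rewrite big_split /= -mulr_sumr sumr_const card_ord -mulr_natl -rE.
  rewrite -/(wsum y n rho); move: (wsum _ _ _) => s.
  by rewrite le_eqVlt; apply/orP; left; apply/eqP; field; rewrite gt_eqF.
(* On [2r, 4r] the cutoff is at least 4, so [t <= 4 * r <= r / 4 * cutoff r t ^+ 2]. *)
have xE : gsq v (2 * r) (4 * r) n <= r / 4 * E n.
  rewrite -(IntgZ _ _ r0 (cE n)).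
  apply: (@le_trans _ _ (Intg (2 * r) (4 * r) (fun t => r / 4 * (cutoff r t ^+ 2 * v n t ^+ 2)))).
    have r20 : 0 < 2 * r by rewrite mulr_gt0.
    apply: (le_Intg r20 (cy n)).
      exact: (cposM (cpos_cst (r / 4)) (cE n)).
    move=> t /andP[rt tr]; rewrite mulrA ler_wpM2r ?sqr_ge0//.
    have c4 : 4 <= cutoff r t.
      rewrite ler_pdivlMr// (_ : 4 * r ^+ 2 = r * (4 * r)); last by ring.
      by apply: ler_pM; rewrite ?mulr_ge0 ?(ltW r0)//; move: rt tr; clear; lra.
    have c16 : 16 <= cutoff r t ^+ 2.
      by rewrite (_ : 16 = 4 ^+ 2); [rewrite lerXn2r ?nnegrE ?(le_trans (ler0n R 4) c4) | ring].
    apply: (@le_trans _ _ (r / 4 * 16)).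
      by move: tr; clear; lra.
    by rewrite ler_wpM2l// divr_ge0// ltW.
  apply: le_Intg_itv; rewrite ?ler_pM2r//.
  - by rewrite -{1}[r]mul1r ler_pM2r// ler1n.
  - by rewrite ler_nat.
  - by rewrite ler_nat.
  - exact: (cposM (cpos_cst (r / 4)) (cE n)).
  by move=> t _; exact: mulr_ge0 (divr_ge0 (ltW r0) (ler0n R 4)) (mulr_ge0 (sqr_ge0 _) (sqr_ge0 _)).
apply: le_trans xE _; rewrite [leRHS]mulrAC ler_pdivlMr -?rE//.
apply: (@le_trans _ _ (r / 4 * ((B + D) / r * wsum y n rho))).
  have r40 : 0 <= r / 4 := divr_ge0 (ltW r0) (ler0n R 4).
  apply: le_trans (ler_wpM2l r40 sumE); rewrite -rE.
  by rewrite le_eqVlt; apply/orP; left; apply/eqP; ring.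
rewrite -/y; move: (wsum _ _ _) => s.
rewrite (_ : r / 4 * _ = (B + D) / 4 * s); last by field; rewrite gt_eqF.
by [].
Qed.

End Averaging.

(** * Summation by parts against monotone weights *)

Section AbelSummation.
Context {R : realType}.
Implicit Types (w b c : nat -> R) (M : R) (A : nat).

Lemma abel_monotone w b M A : (forall a, 0 <= w a) -> (forall a, w a.+1 <= w a) ->
  (forall a, `|b a| <= M) -> \sum_(a < A) w a * (b a.+1 - b a) <= 2 * M * w 0%N.
Proof.
(* The induction runs on the sharper bound [w 0 * (M - b 0)], which reproduces itself when the first
   term is split off. *)
move=> w0 wd bM; apply: (@le_trans _ _ (w 0%N * (M - b 0%N))); last first.
  rewrite mulrC ler_wpM2r//; have := bM 0%N; rewrite ler_norml => /andP[+ _].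
  by clear; lra.
elim: A w b w0 wd bM => [|A IH] w b w0 wd bM.
  rewrite big_ord0 mulr_ge0// subr_ge0.
  by have := bM 0%N; rewrite ler_norml => /andP[].
rewrite big_ord_recl /=.
apply: le_trans (lerD (lexx _) (IH (w \o succn) (b \o succn) _ _ _)) _ => //=.
have H : w 1%N * (M - b 1%N) <= w 0%N * (M - b 1%N).
  by rewrite ler_wpM2r// subr_ge0; have := bM 1%N; rewrite ler_norml => /andP[].
apply: le_trans (lerD (lexx _) H) _; rewrite -mulrDr.
by rewrite le_eqVlt; apply/orP; left; apply/eqP; congr (_ * _); ring.
Qed.

(** After the first term, [w' a.+1 <= w a] turns the differences of two weights into decrements of
    [w] alone, and these telescope. *)
Lemma abel_shift w w' c M A : (forall a, 0 <= w a) -> (forall a, w a.+1 <= w a) ->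
  (forall a, w' a.+1 <= w a) -> 0 <= w' 0%N -> (forall a, 0 <= c a <= M) ->
  \sum_(a < A) c a * (w' a - w a) <= M * (w' 0%N + w 0%N).
Proof.
move=> w0 wd ww w'0 cM; have M0 : 0 <= M by case/andP: (cM 0%N); exact: le_trans.
case: A => [|A]; first by rewrite big_ord0 mulr_ge0// addr_ge0.
rewrite big_ord_recl [leRHS]mulrDr /=; apply: lerD.
  have [c0 cM0] := andP (cM 0%N); apply: (@le_trans _ _ (c 0%N * w' 0%N)).
    by rewrite ler_wpM2l// gerBl.
  by rewrite ler_wpM2r.
apply: (@le_trans _ _ (\sum_(a < A) M * (w a - w a.+1))).
  apply: ler_sum => a _; have [c0 cMa] := andP (cM a.+1).
  apply: (@le_trans _ _ (c a.+1 * (w a - w a.+1))).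
    by rewrite ler_wpM2l// lerB.
  by rewrite ler_wpM2r// subr_ge0.
rewrite -mulr_sumr ler_wpM2l//.
suff -> : \sum_(a < A) (w a - w a.+1) = w 0%N - w A by rewrite gerBl.
elim: A => [|A IH]; first by rewrite big_ord0 subrr.
by rewrite big_ord_recr /= IH addrA subrK.
Qed.

End AbelSummation.

(** * The quadratic energy summed against weights *)

Section Tent.
Context {R : realType}.
Implicit Types (n lo : int) (L A a : nat) (t x eps : R).

(* The times are indexed by their squares, the natural scale in [n]. *)
Definition sqtime eps a : R := if a is 0 then eps else Num.sqrt a%:R.

Lemma sqtime_gt0 eps a : 0 < eps -> 0 < sqtime eps a.
Proof. by case: a => [//|a _]; rewrite /sqtime sqrtr_gt0. Qed.

Lemma sqtime_le eps a : eps <= 1 -> sqtime eps a <= sqtime eps a.+1.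
Proof.
case: a => [|a _]; rewrite /sqtime; first by rewrite sqrtr1.
by rewrite ler_sqrt// ler_nat.
Qed.

(** It bounds the integral of t over one time cell by 1, so one cell in time matches one site in
    [n]. *)
Lemma sqtime_step eps a : 0 < eps -> eps <= 1 ->
  sqtime eps a.+1 * (sqtime eps a.+1 - sqtime eps a) <= 1.
Proof.
move=> e0 e1; case: a => [|a]; rewrite /sqtime.
  by rewrite sqrtr1 mul1r gerBl ltW.
set x := Num.sqrt a.+2%:R; set y := Num.sqrt a.+1%:R.
have x2 : x ^+ 2 = a.+2%:R by rewrite sqr_sqrtr.
have y2 : y ^+ 2 = a.+1%:R by rewrite sqr_sqrtr.
have y0 : 0 <= y by exact: sqrtr_ge0.
have yx : y <= x by rewrite ler_sqrt// ler_nat.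
have E : x ^+ 2 = y ^+ 2 + 1 by rewrite x2 y2 -natr1.
have := ler_wpM2l y0 yx; rewrite mulrBr -!expr2 E.
by move: (y ^+ 2) => z; rewrite [x * y]mulrC; move: (y * x) => q; clear; lra.
Qed.

(* Sum the energy identity for [P x = x^2] by parts in [a] for the boundary terms,
   and in [n] for the telescoping ones. *)
Lemma tent_energy (kappa : R) (u v : int -> R -> R) (m : int -> R)
    (w : int -> nat -> R) eps lo L A :
  extension kappa u v -> -1 <= kappa <= 1 ->
  (forall n t, 0 < t -> `|u n t| <= m n) ->
  (forall n t, 0 < t -> `|t * v n t| <= m n) ->
  (forall n a, 0 <= w n a) -> (forall n a, w n a.+1 <= w n a) ->
  (forall n a, w (n - 1) a.+1 <= w n a) ->
  (forall a, w (lo + L%:Z) a = 0) -> 0 < eps -> eps <= 1 ->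
  wsum (fun n => \sum_(a < A) w n a * gsq v (sqtime eps a) (sqtime eps a.+1) n) lo L
  <= 5 * wsum (fun n => m n ^+ 2 * (w (n - 1) 0%N + w n 0%N)) lo L.+1.
Proof.
move=> uv /andP[k1 k2] um vm w0 wd ws wL e0 e1.
pose s := sqtime eps; have s0 a : 0 < s a by exact: sqtime_gt0.
have sle a : s a <= s a.+1 by exact: sqtime_le.
have cu n : cpos (u n) by exact: (@ext_cu _ _ _ _ uv n).
have cv n : cpos (v n) by exact: (@ext_cv _ _ _ _ uv n).
have ctu n : cpos (fun t => t * u n t ^+ 2).
  exact: (cposM (@cpos_id R) (cposX 2 (@cu n))).
have ctv n : cpos (fun t => t * v n t ^+ 2).
  exact: (cposM (@cpos_id R) (cposX 2 (@cv n))).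
have m0 n : 0 <= m n by apply: le_trans (um n 1 ltr01).
(* [c] telescopes in [n] and [b] in time; up to constants both are bounded by [m n ^+ 2]. *)
pose c n a := Intg (s a) (s a.+1) (fun t => t * u n t ^+ 2).
pose b n a := s a * (2 * u n (s a)) * v n (s a) - (1 - kappa) * u n (s a) ^+ 2.
have c0 n a : 0 <= c n a <= m n ^+ 2.
  apply/andP; split.
    apply: Intg_ge0 => t /andP[st _].
    exact: mulr_ge0 (le_trans (ltW (s0 a)) st) (sqr_ge0 _).
  apply: (@le_trans _ _ (s a.+1 * m n ^+ 2 * (s a.+1 - s a))).
    rewrite -(Intg_cst _ (s0 a) (sle a)).
    apply: (le_Intg (s0 a) (ctu n) (cpos_cst _)) => t /andP[st ts].
    have t0 := lt_le_trans (s0 a) st.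
    apply: (ler_pM (ltW t0) (sqr_ge0 _) ts).
    by rewrite -real_normK ?num_real// lerXn2r ?nnegrE// um.
  rewrite mulrAC -[leRHS]mul1r ler_wpM2r ?sqr_ge0//.
  exact: sqtime_step.
have bm n a : `|b n a| <= 4 * m n ^+ 2.
  have U := um n (s a) (s0 a); have V := vm n (s a) (s0 a).
  have P1 : `|s a * (2 * u n (s a)) * v n (s a)| <= 2 * m n ^+ 2.
    rewrite (_ : s a * _ * _ = 2 * (u n (s a) * (s a * v n (s a)))); last by ring.
    by rewrite !normrM -normrM ger0_norm// ler_wpM2l// expr2 ler_pM.
  have P2 : `|(1 - kappa) * u n (s a) ^+ 2| <= 2 * m n ^+ 2.
    rewrite ger0_norm; last by rewrite mulr_ge0 ?sqr_ge0// subr_ge0.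
    apply: ler_pM; rewrite ?sqr_ge0 ?subr_ge0//; first by move: k1; clear; lra.
    by rewrite -real_normK ?num_real// lerXn2r ?nnegrE.
  apply: le_trans (ler_normB _ _) _; apply: le_trans (lerD P1 P2) _.
  by move: (m n ^+ 2) => z; clear; lra.
have en n a : 2 * gsq v (s a) (s a.+1) n <=
    (b n a.+1 - b n a) + (c (n + 1) a - c n a).
  have D1 (x : R) : is_derive x 1 (fun y => y ^+ 2) (2 * x).
    by apply: der_eq (derX 2 (der_id x)) _ _ => //=; rewrite expr1 mulr1.
  have D2 (x : R) : is_derive x 1 (fun y => 2 * y) 2.
    by apply: der_eq (derZ 2 (der_id x)) _ _ => //=; rewrite mulr1.
  have C2 : continuous (fun _ : R => 2 : R) by move=> x; exact: cvg_cst.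
  have H := energy uv n D1 D2 (fun=> ler0n R 2) C2 (s0 a) (sle a).
  apply: le_trans (le_trans _ H) _.
    rewrite -(IntgZ _ _ (s0 a) (ctv n)); apply: le_Intg (s0 a) _ _ _.
    - exact: (cposM (cpos_cst 2) (ctv n)).
    - exact: (cposM (cposM (@cpos_id R) (cpos_cst 2)) (cposX 2 (@cv n))).
    - by move=> t _; rewrite mulrA [t * 2]mulrC.
  rewrite lerD2l /c -(IntgB _ (s0 a) (ctu _) (ctu _)).
  apply: le_Intg (s0 a) _ _ _.
  - exact: (cposM (@cpos_id R) (cposB (cposX 2 (@cu _)) (cposX 2 (@cu _)))).
  - exact: (cposB (ctu _) (ctu _)).
  - by move=> t _; rewrite mulrBr.
pose Tb := wsum (fun n => \sum_(a < A) w n a * (b n a.+1 - b n a)) lo L.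
pose Tc := wsum (fun n => \sum_(a < A) w n a * (c (n + 1) a - c n a)) lo L.
set G := wsum _ lo L; set M := wsum _ lo L.+1.
have GT : 2 * G <= Tb + Tc.
  rewrite /G -wsumZ -wsumD; apply: le_wsum => n; rewrite mulr_sumr -big_split /=.
  by apply: ler_sum => a _; rewrite -mulrDr mulrCA ler_wpM2l.
have TbM : Tb <= 8 * M.
  rewrite -wsumZ; apply: (@le_trans _ _ (wsum (fun n => 8 * (m n ^+ 2 * (w (n - 1) 0%N + w n 0%N))) lo L)).
    apply: le_wsum => n; apply: le_trans (abel_monotone A (w0 n) (wd n) (bm n)) _.
    rewrite (_ : 2 * _ * _ = 8 * (m n ^+ 2 * w n 0%N)); last by ring.
    by rewrite ler_wpM2l// ler_wpM2l ?sqr_ge0// lerDr.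
  apply: wsum_sub => //; last by rewrite lerD2l lez_nat.
  by move=> n; rewrite mulr_ge0// mulr_ge0 ?sqr_ge0// addr_ge0.
have TcM : Tc <= M.
  (* Summation by parts in [n] moves the difference from [c] to the weights. The window grows by one
     site, whose contribution to [F2] is 0 because [w] vanishes at [lo + L]. *)
  apply: (@le_trans _ _ (wsum (fun n => \sum_(a < A) c n a * (w (n - 1) a - w n a)) lo L.+1)); last first.
    by apply: le_wsum => n; apply: abel_shift.
  pose F1 n := \sum_(a < A) w (n - 1) a * c n a.
  pose F2 n := \sum_(a < A) w n a * c n a.
  have cc n a : 0 <= c n a by case/andP: (c0 n a).
  have -> : Tc = wsum F1 (lo + 1) L - wsum F2 lo L.
    rewrite -wsum_shift -wsumB; apply: eq_wsum => n; rewrite /F1 /F2 -sumrB.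
    by apply: eq_bigr => a _; rewrite addrK mulrBr.
  have -> : wsum (fun n => \sum_(a < A) c n a * (w (n - 1) a - w n a)) lo L.+1 =
      wsum F1 lo L.+1 - wsum F2 lo L.+1.
    rewrite -wsumB; apply: eq_wsum => n; rewrite /F1 /F2 -sumrB.
    by apply: eq_bigr => a _; rewrite mulrBr ![c n a * _]mulrC.
  apply: lerB.
    apply: wsum_sub => [n||].
    - by apply: sumr_ge0 => a _; rewrite mulr_ge0.
    - by rewrite lerDl.
    - by rewrite -addrA lerD2l -PoszD lez_nat add1n.
  rewrite -addn1 wsum_cat wsumS wsum0 addr0 /F2.
  rewrite big1 ?addr0// => a _; by rewrite wL mul0r.
have MM : 0 <= M.
  by apply: wsum_ge0 => n; rewrite mulr_ge0 ?sqr_ge0// addr_ge0.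
(* Altogether [2 * G <= 8 * M + M], which leaves room in the factor 5. *)
by move: GT TbM TcM MM; move: (Tb) (Tc) (G) (M) => x1 x2 x3 x4; clear; lra.
Qed.

End Tent.

Lemma window_split (c n : int) (L : nat) : c <= n -> n < c + L%:Z ->
  exists i j : nat, [/\ L = (i + j)%N, n = c + i%:Z, (0 < j)%N & (i < L)%N].
Proof. by move=> cn nc; exists `|n - c|%N, (L - `|n - c|)%N; split; lia. Qed.

Lemma window_rev (n c : int) (i : nat) : n = c + i%:Z ->
  - (- n) - i.+1%:Z + 1 = c.
Proof. lia. Qed.

Lemma window_weight_ge (n : int) (a L : nat) (c A : int) :
  c <= n - a%:Z -> n + a%:Z < c + L%:Z -> [/\ c <= n, n < c + L%:Z & (0 < L)%N].
Proof. by move=> *; split; lia. Qed.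

Lemma window_weight_mono (n c e : int) (a : nat) :
  c <= n - a.+1%:Z -> n + a.+1%:Z < e -> c <= n - a%:Z /\ n + a%:Z < e.
Proof. by move=> *; split; lia. Qed.

Lemma window_weight_shift (n c e : int) (a : nat) :
  c <= (n - 1) - a.+1%:Z -> (n - 1) + a.+1%:Z < e -> c <= n - a%:Z /\ n + a%:Z < e.
Proof. by move=> *; split; lia. Qed.

Lemma window_weight_out (n c e A : int) (a : nat) :
  A <= n -> n + a%:Z < e -> e <= A -> False.
Proof. lia. Qed.

Lemma window_pred (n : int) (i : nat) : n - i%:Z = - ((- n) + i%:Z).
Proof. lia. Qed.

(** * Window weights dominated by the two-sided maximal function *)

Section Weights.
Context {R : realType}.
Implicit Types (h : int -> R) (n c A : int) (a L : nat).

Definition maxfun2 h n := maxfun h n + maxfun (h \o -%R) (- n).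

Lemma bounded_rev h : bounded_seq h -> bounded_seq (h \o -%R).
Proof. by case=> B hB; exists B => n; exact: hB. Qed.

(** Cut the window at [n]: each half is a one-sided average starting at [n], the left one after
    reflection. The site [n] is counted in both, and neither half is longer than [L]. *)
Lemma average_le_maxfun2 h n c L : (forall k, 0 <= h k) -> bounded_seq h ->
  c <= n -> n < c + L%:Z -> wsum h c L <= maxfun2 h n * L%:R.
Proof.
move=> h0 hB cn nc; have [i [j [-> nE j0 iL]]] := window_split cn nc.
rewrite /maxfun2 mulrDl addrC wsum_cat -nE; apply: lerD.
  have := wsum_le_maxfun (- n) i.+1 (bounded_rev hB).
  rewrite (@eq_wsum _ _ (h \o -%R)); last by move=> k; rewrite /= ger0_norm.
  rewrite wsum_rev (window_rev nE) => H.
  apply: (@le_trans _ _ (wsum h c i.+1)).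
    by apply: wsum_sub => //; rewrite lerD2l lez_nat leqnSn.
  apply: le_trans H _; rewrite ler_wpM2l ?maxfun_ge0//; first exact: bounded_rev.
  by rewrite ler_nat -addn1 leq_add2l.
have := wsum_le_maxfun n j hB.
rewrite (@eq_wsum _ _ h); last by move=> k; rewrite /= ger0_norm.
move=> H; apply: le_trans H _; rewrite ler_wpM2l ?maxfun_ge0//.
by rewrite ler_nat leq_addl.
Qed.

Lemma maxfun2_ge0 h n : bounded_seq h -> 0 <= maxfun2 h n.
Proof. by move=> hB; rewrite addr_ge0 ?maxfun_ge0//; exact: bounded_rev. Qed.

(** The value 0 keeps the set nonempty when no window fits. The weight then vanishes from [A] on,
    the boundary condition of [tent_energy]. *)
Definition wset h A n a : set R := [set x | x = 0 \/ exists c L,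
  [/\ c <= n - a%:Z, n + a%:Z < c + L%:Z, c + L%:Z <= A & x = wsum h c L / L%:R]].

(* The largest average over a window of (-oo, A) that contains [n - a, n + a].
   Both defining constraints relax when n moves right by one and a decreases. *)
Definition wt h A n a : R := sup (wset h A n a).

Section Properties.
Variables (h : int -> R).
Hypotheses (h0 : forall k, 0 <= h k) (hB : bounded_seq h).

Lemma wset_ub A n a x : wset h A n a x -> x <= maxfun2 h n.
Proof.
case=> [->|[c [L [cn nc _ ->]]]]; first exact: maxfun2_ge0.
have [cn' nc' L0] := window_weight_ge A cn nc.
by rewrite ler_pdivrMr ?ltr0n//; exact: average_le_maxfun2.
Qed.

Lemma wset_has_sup A n a : has_sup (wset h A n a).
Proof. by split; [exists 0; left | exists (maxfun2 h n) => x; exact: wset_ub]. Qed.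

Lemma wt_le A n a : wt h A n a <= maxfun2 h n.
Proof.
by apply: ge_sup; [exists 0; left | move=> x; exact: wset_ub].
Qed.

Lemma wt_ge0 A n a : 0 <= wt h A n a.
Proof. by apply: ub_le_sup; [case: (wset_has_sup A n a) | left]. Qed.

Lemma wt_sub A n a n' a' : wset h A n a `<=` wset h A n' a' ->
  wt h A n a <= wt h A n' a'.
Proof.
move=> S; apply: ge_sup; first by exists 0; left.
move=> x /S Sx; apply: ub_le_sup Sx; by case: (wset_has_sup A n' a').
Qed.

Lemma wt_mono A n a : wt h A n a.+1 <= wt h A n a.
Proof.
apply: wt_sub => x [->|[c [L [cn nc cA ->]]]]; [by left | right].
by have [? ?] := window_weight_mono cn nc; exists c, L; split.
Qed.

Lemma wt_shift A n a : wt h A (n - 1) a.+1 <= wt h A n a.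
Proof.
apply: wt_sub => x [->|[c [L [cn nc cA ->]]]]; [by left | right].
by have [? ?] := window_weight_shift cn nc; exists c, L; split.
Qed.

Lemma wt_out A n a : A <= n -> wt h A n a = 0.
Proof.
move=> An; apply/eqP; rewrite eq_le wt_ge0 andbT.
apply: ge_sup; first by exists 0; left.
move=> x [->//|[c [L [cn nc cA _]]]]; exfalso; exact: window_weight_out An nc cA.
Qed.

Lemma wsum_le_wt A n a c L : c <= n - a%:Z -> n + a%:Z < c + L%:Z ->
  c + L%:Z <= A -> wsum h c L <= wt h A n a * L%:R.
Proof.
move=> cn nc cA; have [_ _ L0] := window_weight_ge A cn nc.
rewrite -ler_pdivrMr ?ltr0n//; apply: ub_le_sup.
  by case: (wset_has_sup A n a).
by right; exists c, L.
Qed.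

End Properties.
End Weights.

Section DyadicSums.
Context {R : realType}.

(** Times in [r, 8r] with r = 2^i have indices from 4^i to 4^(i + 3). Each such block is three
    consecutive quarter-scale blocks, so an index is covered at most three times. *)
Lemma dyadic_overlap (F : nat -> R) (I : nat) : (forall a, 0 <= F a) ->
  \sum_(i < I) \sum_(4 ^ i <= a < 4 ^ (i + 3)) F a <=
  3 * \sum_(0 <= a < 4 ^ (I + 3)) F a.
Proof.
move=> F0.
have le4 i j : (i <= j)%N -> (4 ^ i <= 4 ^ j)%N by move=> ij; rewrite leq_exp2l.
have shifted c : (c <= 3)%N ->
    \sum_(i < I) \sum_(4 ^ (i + c) <= a < 4 ^ (i + c).+1) F a <=
    \sum_(0 <= a < 4 ^ (I + 3)) F a.
  move=> c3; apply: (@le_trans _ _ (\sum_(4 ^ c <= a < 4 ^ (I + c)) F a)).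
    elim: (I) => [|J IH]; first by rewrite big_ord0 big_geq// add0n.
    rewrite big_ord_recr /= addSn.
    rewrite (@big_cat_nat _ _ _ (4 ^ (J + c))%N (4 ^ c)) ?le4 ?leq_addl ?leqnSn//=.
    by rewrite lerD2r.
  rewrite (@big_cat_nat _ _ _ (4 ^ c)%N 0 (4 ^ (I + 3)))//=; last first.
    by rewrite le4// (leq_trans c3)// leq_addl.
  rewrite (@big_cat_nat _ _ _ (4 ^ (I + c))%N (4 ^ c) (4 ^ (I + 3)))/=; first last.
  - by rewrite le4// leq_add2l.
  - by rewrite le4// leq_addl.
  have P i j : 0 <= \sum_(i <= a < j) F a by apply: sumr_ge0.
  by rewrite addrCA lerDl addr_ge0.
have split3 (i : nat) : \sum_(4 ^ i <= a < 4 ^ (i + 3)) F a =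
   \sum_(4 ^ (i + 0) <= a < 4 ^ (i + 0).+1) F a +
   (\sum_(4 ^ (i + 1) <= a < 4 ^ (i + 1).+1) F a +
    \sum_(4 ^ (i + 2) <= a < 4 ^ (i + 2).+1) F a).
  rewrite addn0 !addn1 addn2 addn3.
  rewrite (@big_cat_nat _ _ _ (4 ^ i.+1)%N)/= ?le4//; last by rewrite ltnW.
  congr (_ + _); rewrite (@big_cat_nat _ _ _ (4 ^ i.+2)%N)/= ?le4//.
under eq_bigr do rewrite split3.
rewrite !big_split /=.
rewrite (_ : 3 = 1 + (1 + 1)); last by ring.
by rewrite !mulrDl !mul1r !lerD// shifted.
Qed.

End DyadicSums.

Lemma window_center (n A : int) (a i j : nat) : (a < i)%N -> (a < j)%N ->
  n + j%:Z <= A ->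
  [/\ n - i%:Z <= n - a%:Z, n + a%:Z < (n - i%:Z) + (i + j)%N%:Z
    & (n - i%:Z) + (i + j)%N%:Z <= A].
Proof. by move=> *; split; lia. Qed.

Lemma window_back (n : int) (rho : nat) :
  (0 < rho)%N -> n - (64 * rho)%N%:Z <= - (- n) - rho%:Z + 1 /\
    - (- n) - rho%:Z + 1 + rho%:Z <= n - (64 * rho)%N%:Z + (64 * rho + 65 * rho)%N%:Z.
Proof. by move=> ?; split; lia. Qed.

(** * The weighted quadratic inequality *)

Section WeightedBound.
Context {R : realType}.
Implicit Types (n lo : int) (L A a : nat) (t x eps : R).

Lemma gsq_cat (v : int -> R -> R) n (x y z : R) : cpos (v n) ->
  0 < x -> x <= y -> y <= z -> gsq v x z n = gsq v x y n + gsq v y z n.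
Proof.
move=> cv x0 xy yz; rewrite /gsq Intg_cat//.
exact: (cposM (@cpos_id R) (cposX 2 cv)).
Qed.

Lemma gsq_sqtime (v : int -> R -> R) n eps (i j : nat) : cpos (v n) ->
  0 < eps -> eps <= 1 -> (i <= j)%N ->
  gsq v (sqtime eps i) (sqtime eps j) n =
  \sum_(i <= a < j) gsq v (sqtime eps a) (sqtime eps a.+1) n.
Proof.
move=> cv e0 e1 /subnK <-; elim: (j - i)%N => [|k IH].
  by rewrite big_geq// /gsq /Intg set_itv1 Rintegral_set1.
have inc : sqtime eps i <= sqtime eps (k + i).
  elim: k {IH} => [//|k IH]; exact: le_trans IH (sqtime_le _ e1).
rewrite addSn big_nat_recr ?leq_addl//= -IH.
exact: (gsq_cat cv (sqtime_gt0 _ e0) inc (sqtime_le _ e1)).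
Qed.

Lemma sqtime_pow eps (i : nat) : sqtime eps (4 ^ i) = 2 ^+ i.
Proof.
have : (0 < 4 ^ i)%N by rewrite expn_gt0.
case E : (4 ^ i)%N => [//|k] _; rewrite /sqtime -E.
by rewrite natrX (_ : 4%:R = 2 ^+ 2 :> R) -?exprM ?[(2 * i)%N]mulnC ?exprM ?sqrtr_sqr ?ger0_norm ?exprn_ge0// expr2 -natrM.
Qed.

Lemma gsq_dyadic (v : int -> R -> R) n eps (I : nat) : cpos (v n) ->
  0 < eps -> eps <= 1 ->
  gsq v eps (2 * 2 ^+ I) n =
  gsq v eps 2 n + \sum_(i < I) gsq v (2 * 2 ^+ i) (4 * 2 ^+ i) n.
Proof.
move=> cv e0 e1; elim: I => [|I IH]; first by rewrite mulr1 big_ord0 addr0.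
rewrite big_ord_recr /= addrA -IH.
have -> : 2 * 2 ^+ I.+1 = 4 * 2 ^+ I :> R by rewrite exprS; ring.
have p1 : 1 <= 2 ^+ I :> R by rewrite exprn_ege1// ler1n.
apply: gsq_cat => //; last by rewrite ler_wpM2r ?ler_nat// (le_trans ler01).
by move: e1 p1; move: (2 ^+ I) => z; clear; lra.
Qed.

(** [dyadic_average] spreads each dyadic piece over the next r^2 sites; a change of index moves this
    average from the energy to [h], where the window weights dominate it. The pieces are then
    regrouped by [dyadic_overlap] into the sum of [tent_energy]. *)
Lemma gsq_weighted_bound : exists2 C : R, 0 <= C &
  forall (kappa : R) (u v : int -> R -> R) (m h : int -> R) eps lo L (I : nat) S,
  extension kappa u v -> -1 <= kappa <= 1 ->
  (forall n t, 0 < t -> `|u n t| <= m n) ->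
  (forall n t, 0 < t -> `|t * v n t| <= m n) ->
  (forall n, 0 <= h n) -> bounded_seq h -> 0 < eps -> eps <= 1 ->
  tot_le (fun n => m n ^+ 2 * (maxfun2 h (n - 1) + maxfun2 h n)) S ->
  wsum (fun n => h n * gsq v eps (2 * 2 ^+ I) n) lo L <= C * S.
Proof.
have [D D0 avg] := @dyadic_average R.
have [B [B0 HB]] : exists B : R, 0 <= B /\ B = (64 + 65)%N%:R.
  by eexists; split; [|reflexivity]; exact: ler0n.
exists (((5 + 5)%N%:R + 3 * (D * B)) * 5).
  by rewrite mulr_ge0// addr_ge0// mulr_ge0// mulr_ge0.
move=> kappa u v m h eps lo L I S uv kap um vm h0 hB e0 e1 mS.
have cv n : cpos (v n) by exact: (@ext_cv _ _ _ _ uv n).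
pose s := sqtime eps; pose e n a := gsq v (s a) (s a.+1) n.
have e_ge0 n a : 0 <= e n a by apply: gsq_ge0; exact: sqtime_gt0.
(* [L2] leaves room for shifts by less than [4 ^ I] sites and for the short windows of [near0]; [L3]
   leaves room for windows that reach [65 * 4 ^ I] sites further. *)
pose L2 := (L + 4 ^ I + 5)%N; pose L3 := (L2 + 65 * 4 ^ I)%N.
pose A := lo + L3%:Z; pose N := (4 ^ (I + 3))%N.
pose F n a := wt h A n a * e n a.
have F0 n a : 0 <= F n a by rewrite mulr_ge0 ?wt_ge0.
pose FA n := \sum_(0 <= a < N) F n a.
have FA0 n : 0 <= FA n by apply: sumr_ge0.
have nA n (j : nat) : n < lo + L2%:Z -> (j <= 65 * 4 ^ I)%N -> n + j%:Z <= A.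
  rewrite /A /L3 PoszD addrA => nL jI; apply: lerD; first exact: ltW.
  by rewrite lez_nat.
pose FL3 := wsum FA lo L2.
have L2in k : (k < L2)%N -> lo + k%:Z < lo + L2%:Z by move=> kL; rewrite ltrD2l ltz_nat.
(* Times up to 2 are the indices below 4. There [h n] is at most its sum over the [5 + 5] sites
   around [n], hence at most that many times the weight. *)
have near0 : wsum (fun n => h n * gsq v eps 2 n) lo L <= (5 + 5)%N%:R * FL3.
  apply: (@le_trans _ _ (wsum (fun n => (5 + 5)%N%:R * FA n) lo L)); last first.
    rewrite wsumZ ler_wpM2l//; apply: wsum_sub => //.
    by rewrite lerD2l lez_nat /L2 -addnA leq_addr.
  apply: le_wsum_in => k kL; set n := lo + k%:Z.
  have -> : gsq v eps 2 n = \sum_(0 <= a < 4) e n a.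
    rewrite -(gsq_sqtime (@cv n) e0 e1 (leq0n 4)).
    by rewrite (_ : sqtime eps 4 = 2)// -[4%N]/(4 ^ 1)%N sqtime_pow.
  have NE : (4 <= N)%N by rewrite /N -{1}[4%N]expn1 leq_exp2l// addn_gt0 orbT.
  apply: (@le_trans _ _ ((5 + 5)%N%:R * \sum_(0 <= a < 4) F n a)).
    rewrite !mulr_sumr !big_nat; apply: ler_sum => a /andP[_ a4].
    rewrite mulrA ler_wpM2r//.
    have kL2 : (k < L)%N by [].
    have nI : n + 5%:Z <= A.
      rewrite /A /n -addrA lerD2l -PoszD lez_nat /L3 /L2.
      by apply: leq_trans (leq_addr _ _); rewrite leq_add2r (leq_trans (ltnW kL)) ?leq_addr.
    have a5 : (a < 5)%N by exact: ltn_trans a4 _.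
    have [W1 W2 W3] := window_center a5 a5 nI.
    have := wsum_le_wt h0 hB W1 W2 W3; rewrite mulrC; apply: le_trans.
    apply: wsum_ge1 => //; first by rewrite gerBl.
    by rewrite (_ : n - 5%:Z + (5 + 5)%N%:Z = n + 5%:Z) ?ltrDl// PoszD addrA subrK.
  rewrite ler_wpM2l// /FA (big_cat_nat (leq0n 4) NE)/= lerDl.
  exact: sumr_ge0.
have far (i : 'I_I) : wsum (fun n => h n * gsq v (2 * 2 ^+ i) (4 * 2 ^+ i) n) lo L
    <= D * B * wsum (fun n => \sum_(4 ^ i <= a < 4 ^ (i + 3)) F n a) lo L2.
  pose rho := (4 ^ i)%N; pose r : R := 2 ^+ i.
  have r0 : 0 < r by rewrite exprn_gt0.
  have rE : r ^+ 2 = rho%:R.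
    by rewrite /r /rho -exprM mulnC exprM natrX expr2 -natrM.
  have rho0 : (0 < rho)%N by rewrite expn_gt0.
  have rhoI : (rho <= 4 ^ I)%N by rewrite leq_exp2l// ltnW.
  have R0 : 0 < rho%:R :> R by rewrite ltr0n.
  pose y := gsq v r (8 * r).
  have y0 n : 0 <= y n by exact: gsq_ge0.
  have yE n : y n = \sum_(rho <= a < 4 ^ (i + 3)) e n a.
    rewrite -(gsq_sqtime (@cv n) e0 e1) ?leq_exp2l ?leq_addr// !sqtime_pow.
    congr (gsq _ _ _ _); rewrite exprD mulrC; congr (_ * _).
    by rewrite -natrX.
  apply: (@le_trans _ _ (wsum (fun n => D / rho%:R * (h n * wsum y n rho)) lo L)).
    apply: le_wsum => n; rewrite mulrCA ler_wpM2l//.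
    exact: avg uv kap r0 rE.
  have -> : wsum (fun n => D / rho%:R * (h n * wsum y n rho)) lo L =
     D / rho%:R * \sum_(k < rho) wsum (fun n => h n * y (n + k%:Z)) lo L.
    rewrite wsumZ; congr (_ * _); rewrite /wsum exchange_big /=.
    by apply: eq_bigr => j _; rewrite mulr_sumr.
  (* The change of index [n + k] to [n]: from here on it is [h] that is averaged, over the [rho]
     sites ending at [n]. *)
  apply: (@le_trans _ _ (D / rho%:R * \sum_(k < rho) wsum (fun n => h (n - k%:Z) * y n) lo L2)).
    rewrite ler_wpM2l// ?divr_ge0//; apply: ler_sum => k _.
    have -> : wsum (fun n => h n * y (n + k%:Z)) lo L =
        wsum (fun n => h (n - k%:Z) * y n) (lo + k%:Z) L.
      by rewrite -wsum_shift; apply: eq_wsum => n; rewrite addrK.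
    apply: wsum_sub => [n||]; [by rewrite mulr_ge0| by rewrite lerDl|].
    rewrite -addrA lerD2l -PoszD lez_nat /L2 addnC -addnA leq_add2l.
    by rewrite (leq_trans (ltnW (ltn_ord k)))// (leq_trans rhoI)// leq_addr.
  have -> : \sum_(k < rho) wsum (fun n => h (n - k%:Z) * y n) lo L2 =
      wsum (fun n => y n * \sum_(k < rho) h (n - k%:Z)) lo L2.
    rewrite /wsum exchange_big /=; apply: eq_bigr => j _.
    by rewrite mulr_sumr; apply: eq_bigr => k _; rewrite mulrC.
  rewrite -!wsumZ; apply: le_wsum_in => k kL2; set n := lo + k%:Z.
  rewrite yE mulr_suml !mulr_sumr !big_nat; apply: ler_sum => a /andP[_ ar].
  rewrite -mulrA -[leRHS]mulrA ler_wpM2l// mulrCA /F.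
  rewrite (_ : B * _ = e n a * (B * wt h A n a)); last by ring.
  rewrite ler_wpM2l//.
  rewrite mulrC ler_pdivrMr//.
  have a64 : (a < 64 * rho)%N by move: ar; rewrite expnD mulnC.
  have a65 : (a < 65 * rho)%N by apply: leq_trans a64 _; rewrite leq_mul2r leqnSn orbT.
  have nI : n + (65 * rho)%N%:Z <= A.
    by apply: nA; [exact: L2in | rewrite leq_mul2l rhoI orbT].
  have [W1 W2 W3] := window_center a64 a65 nI.
  have H := wsum_le_wt h0 hB W1 W2 W3.
  have -> : \sum_(k < rho) h (n - k%:Z) = wsum h (- (- n) - rho%:Z + 1) rho.
    by rewrite -wsum_rev; apply: eq_bigr => j _; rewrite window_pred.
  (* This window contains both these [rho] sites and the base [n - a, n + a] of the tent, since
     [a < 64 * rho]. *)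
  apply: (@le_trans _ _ (wt h A n a * (64 * rho + 65 * rho)%N%:R)).
    apply: le_trans H; have [V1 V2] := window_back n rho0.
    exact: wsum_sub.
  by rewrite HB -mulnDl natrM mulrA [_ * wt _ _ _ _]mulrC.
have tent : FL3 <= 5 * S.
  apply: (@le_trans _ _ (wsum FA lo L3)).
    by apply: wsum_sub => //; rewrite lerD2l lez_nat leq_addr.
  have H := tent_energy (w := wt h A) N uv kap um vm (wt_ge0 h0 hB A)
    (wt_mono h0 hB A) (wt_shift h0 hB A) (fun a => wt_out h0 hB a (lexx A)) e0 e1.
  rewrite (@eq_wsum _ _ (fun n => \sum_(a < N) F n a)); last first.
    by move=> n; rewrite /FA big_mkord.
  apply: le_trans H _; rewrite ler_wpM2l//; apply: le_trans (mS lo L3.+1).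
  apply: le_wsum => n; rewrite ler_wpM2l ?sqr_ge0//.
  by apply: lerD; exact: wt_le.
rewrite (@eq_wsum _ _ (fun n => h n * gsq v eps 2 n +
  \sum_(i < I) h n * gsq v (2 * 2 ^+ i) (4 * 2 ^+ i) n)); last first.
  by move=> n; rewrite gsq_dyadic// mulrDr mulr_sumr.
rewrite wsumD.
have tail : wsum (fun n => \sum_(i < I) h n * gsq v (2 * 2 ^+ i) (4 * 2 ^+ i) n) lo L
   <= 3 * (D * B) * FL3.
  rewrite /wsum exchange_big /=.
  apply: (@le_trans _ _ (\sum_(i < I) D * B * wsum (fun n => \sum_(4 ^ i <= a < 4 ^ (i + 3)) F n a) lo L2)).
    by apply: ler_sum => i _; exact: far.
  rewrite -mulr_sumr (_ : 3 * _ * _ = D * B * (3 * FL3)); last by ring.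
  rewrite ler_wpM2l ?mulr_ge0// /FL3 /wsum exchange_big /= mulr_sumr; apply: ler_sum => k _.
  exact: dyadic_overlap.
apply: le_trans (lerD near0 tail) _; rewrite -mulrDl -mulrA.
apply: (ler_wpM2l _ tent); apply: addr_ge0; first exact: ler0n.
by rewrite mulr_ge0// mulr_ge0.
Qed.

End WeightedBound.

Lemma window_hull (lo a : int) (L L' : nat) : exists b : int, exists i j : nat,
  [/\ lo = b + i%:Z, b <= a & a + L'%:Z <= b + (i + L + j)%N%:Z].
Proof.
by exists (lo - `|lo - a|%N%:Z), `|lo - a|%N, (`|lo - a| + L')%N; split; lia.
Qed.

Lemma window_left (lo b : int) (i k L : nat) : lo = b + i%:Z -> (k < i)%N ->
  ~ (lo <= b + k%:Z < lo + L%:Z).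
Proof. lia. Qed.

Lemma window_right (lo b : int) (i k L : nat) : lo = b + i%:Z ->
  ~ (lo <= b + (i + L)%N%:Z + k%:Z < lo + L%:Z).
Proof. lia. Qed.

(** * Duality for exponents above 2 *)

Section LargeExponents.
Context {R : realType}.
Implicit Types (n lo : int) (L : nat).

Lemma wsum_support (F : int -> R) lo L : (forall n, 0 <= F n) ->
  (forall n, ~ (lo <= n < lo + L%:Z) -> F n = 0) -> tot_le F (wsum F lo L).
Proof.
move=> F0 Fz a L'; have [b [i [j [E ba ab]]]] := window_hull lo a L L'.
apply: le_trans (wsum_sub F0 ba ab) _; rewrite !wsum_cat -E.
have z1 : wsum F b i = 0.
  by apply: big1 => k _; apply: Fz; exact: window_left E (ltn_ord k).
have z2 : wsum F (b + (i + L)%N%:Z) j = 0.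
  by apply: big1 => k _; apply: Fz; exact: window_right E.
by rewrite z1 z2 add0r addr0.
Qed.

(** The two cases compare [a] with [e] times the power 1 / (q - 1) of [b]. The constants are not
    optimal, but the small factor falls on the power of [b], the one to be absorbed. *)
Lemma young_eps (q e a b : R) : 1 < q -> 0 < e -> 0 <= a -> 0 <= b ->
  a * b <= e `^ (1 - q) * a `^ q + e * b `^ (q / (q - 1)).
Proof.
move=> q1 e0 a0 b0; have qm : 0 < q - 1 by rewrite subr_gt0.
have q0 : 0 < q by exact: lt_trans q1.
pose q' := q / (q - 1); have q'0 : 0 < q' by rewrite divr_gt0.
have q'1 : q' - 1 = (q - 1)^-1 by rewrite /q'; field; rewrite gt_eqF.
have [ab|ba] := leP a (e * b `^ (q' - 1)).
  apply: (@le_trans _ _ (e * b `^ q')).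
    by rewrite -(mulr_powRB1 b0 q'0) mulrCA [a * b]mulrC ler_wpM2l.
  by rewrite lerDr mulr_ge0 ?powR_ge0.
apply: (@le_trans _ _ (e `^ (1 - q) * a `^ q)); last first.
  by rewrite lerDl mulr_ge0 ?powR_ge0// ltW.
have bE : b = (b `^ (q' - 1)) `^ (q - 1).
  by rewrite -powRrM q'1 mulVf ?powRr1// gt_eqF.
have H : b <= (a / e) `^ (q - 1).
  rewrite bE; apply: ge0_ler_powR; rewrite ?nnegrE ?powR_ge0 ?divr_ge0 ?(ltW qm) ?(ltW e0)//.
  by rewrite ler_pdivlMr// mulrC ltW.
apply: le_trans (ler_wpM2l a0 H) _.
rewrite powRM ?invr_ge0 ?(ltW e0)// mulrA mulr_powRB1// mulrC ler_wpM2r ?powR_ge0//.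
by rewrite -powR_inv1 ?(ltW e0)// -powRrM mulN1r opprB.
Qed.

Lemma powR_add_le (q x y : R) : 0 < q -> 0 <= x -> 0 <= y ->
  (x + y) `^ q <= 2 `^ q * (x `^ q + y `^ q).
Proof.
move=> q0 x0 y0.
have main (a b : R) : 0 <= a -> a <= b -> (a + b) `^ q <= 2 `^ q * (a `^ q + b `^ q).
  move=> a0 ab; have b0 := le_trans a0 ab.
  apply: (@le_trans _ _ ((2 * b) `^ q)).
    apply: ge0_ler_powR; rewrite ?nnegrE ?addr_ge0 ?mulr_ge0 ?(ltW q0)//.
    by rewrite mulr_natl mulr2n lerD2r.
  by rewrite powRM// ler_wpM2l ?powR_ge0// lerDr powR_ge0.
have [xy|/ltW yx] := leP x y; first exact: main.
by rewrite addrC [x `^ q + _]addrC; exact: main.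
Qed.

(* Duality with [h = G^(p/2 - 1)] restricted to a finite window, on which the sum of
   [G^(p/2)] is finite and can be absorbed. *)
Lemma gsq_strong_gt2 (p : R) : 2 < p -> exists2 C, 0 <= C &
  forall (kappa : R) (u v : int -> R -> R) (m : int -> R) (K eps : R) (I : nat),
  extension kappa u v -> -1 <= kappa <= 1 ->
  (forall n t, 0 < t -> `|u n t| <= m n) ->
  (forall n t, 0 < t -> `|t * v n t| <= m n) ->
  tot_le (fun n => m n `^ p) K -> 0 < eps -> eps <= 1 ->
  tot_le (fun n => gsq v eps (2 * 2 ^+ I) n `^ (p / 2)) (C * K).
Proof.
move=> p2; pose q := p / 2; have q1 : 1 < q by rewrite ltr_pdivlMr ?mul1r.
have qm : 0 < q - 1 by rewrite subr_gt0.
have q0 : 0 < q by exact: lt_trans q1.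
pose q' := q / (q - 1); have q'0 : 0 < q' by rewrite divr_gt0.
have q'1 : 1 < q' by rewrite ltr_pdivlMr// mul1r gtrBl.
have [D D0 HD] := @gsq_weighted_bound R.
have [B B0 HB] := strong_maxfun q'1.
pose B' := 2 `^ q' * (B + B); have B'0 : 0 <= B' by rewrite mulr_ge0 ?powR_ge0 ?addr_ge0.
have DB0 : 0 <= D * B' by rewrite mulr_ge0.
(* With this [e] the term in [S] on the right of [SD] is at most [S / 2]; absorbing it doubles
   [2 * (D * A * K)], whence the constant. *)
pose e := (4 * (D * B') + 1)^-1; have e0 : 0 < e by rewrite invr_gt0 ltr_wpDl// mulr_ge0.
have eB : D * B' * e <= 4^-1.
  rewrite /e; move: (D * B') DB0 => z z0.
  have z1 : 0 < 4 * z + 1 by rewrite ltr_wpDl// mulr_ge0.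
  by rewrite ler_pdivrMr//; move: z0; clear; lra.
pose A := e `^ (1 - q); have A0 : 0 <= A by exact: powR_ge0.
exists (4 * (D * A)); first by rewrite mulr_ge0// mulr_ge0.
move=> kappa u v m K eps I uv kap um vm mK e1 e2 lo L.
pose G := gsq v eps (2 * 2 ^+ I).
have G0 n : 0 <= G n by exact: gsq_ge0.
have m0 n : 0 <= m n by exact: le_trans (um n 1 ltr01).
(* On the window both h G and h^q' equal G^q, so the maximal theorem at the conjugate exponent [q']
   leads back to the same sum [S]. *)
pose h n := G n `^ (q - 1) * (lo <= n < lo + L%:Z)%R%:R.
have h0 n : 0 <= h n by rewrite mulr_ge0 ?powR_ge0.
have hout n : ~ (lo <= n < lo + L%:Z) -> h n = 0.
  by move=> /negP/negbTE; rewrite /h => ->; rewrite mulr0.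
have hin n : lo <= n < lo + L%:Z -> h n = G n `^ (q - 1).
  by rewrite /h => ->; rewrite mulr1.
have hB : bounded_seq h.
  exists (wsum h lo L) => n; rewrite ger0_norm//.
  exact: tot_le_pt (wsum_support h0 hout).
have win (k : nat) : (k < L)%N -> lo <= lo + k%:Z < lo + L%:Z.
  by move=> kL; rewrite lerDl ltrD2l ltz_nat kL.
pose S := wsum (fun n => G n `^ q) lo L.
have hq : tot_le (fun n => `|h n| `^ q') S.
  have -> : S = wsum (fun n => `|h n| `^ q') lo L.
    apply: eq_bigr => k _; rewrite ger0_norm// hin ?win// -powRrM.
    by congr (_ `^ _); rewrite /q'; field; rewrite gt_eqF.
  apply: wsum_support => [n|n nw]; first exact: powR_ge0.
  by rewrite hout// normr0 powR0// gt_eqF.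
have Mh : tot_le (fun n => maxfun2 h n `^ q') (B' * S).
  rewrite /B' -mulrA; apply: (@tot_leW _ _ (fun n =>
    2 `^ q' * (maxfun h n `^ q' + maxfun (h \o -%R) (- n) `^ q'))).
    by move=> n; apply: powR_add_le => //; apply: maxfun_ge0 => //; exact: bounded_rev.
  apply: tot_leZ; first exact: powR_ge0.
  rewrite mulrDl; apply: tot_leD; first exact: HB.
  apply: (@tot_le_rev _ (fun n => maxfun (h \o -%R) n `^ q')).
  by apply: HB; [exact: bounded_rev | exact: (tot_le_rev hq)].
have MS : tot_le (fun n => m n ^+ 2 * (maxfun2 h (n - 1) + maxfun2 h n))
    ((A * K + e * (B' * S)) + (A * K + e * (B' * S))).
  have one n k : m n ^+ 2 * maxfun2 h k <= A * m n `^ p + e * maxfun2 h k `^ q'.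
    have -> : m n `^ p = (m n ^+ 2) `^ q.
      by rewrite -powR_mulrn// -powRrM; congr (_ `^ _); rewrite /q; field.
    by apply: young_eps => //; rewrite ?sqr_ge0 ?maxfun2_ge0.
  apply: (@tot_leW _ _ (fun n =>
    (A * m n `^ p + e * maxfun2 h (n - 1) `^ q') + (A * m n `^ p + e * maxfun2 h n `^ q'))).
    by move=> n; rewrite mulrDr lerD.
  have mA := tot_leZ A0 mK; have he := tot_leZ (ltW e0) Mh.
  apply: tot_leD; last exact: tot_leD.
  exact: (tot_leD mA (tot_le_shift (-1) he)).
have SD : S <= D * ((A * K + e * (B' * S)) + (A * K + e * (B' * S))).
  apply: le_trans (HD kappa u v m h eps lo L I _ uv kap um vm h0 hB e1 e2 MS).
  apply: le_wsum_in => k kL; rewrite hin ?win//.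
  by rewrite mulrC mulr_powRB1//; exact: G0.
have S0 : 0 <= S by apply: wsum_ge0 => n; exact: powR_ge0.
have E : D * ((A * K + e * (B' * S)) + (A * K + e * (B' * S))) =
   2 * (D * A * K) + 2 * (D * B' * e * S) by ring.
rewrite -/S; rewrite E in SD.
have := ler_wpM2r S0 eB; move: SD S0.
rewrite (_ : 4 * (D * A) * K = 4 * (D * A * K)); last by ring.
move: (D * A * K) (D * B' * e * S) (S) => x y z; clear; lra.
Qed.

End LargeExponents.

(** * The heat semigroup *)

Section PoissonTransform.
Context {R : realType}.
Implicit Types (c d : nat -> R) (s : R).

(** A class that contains bounded and linearly growing sequences, thus the values and the partial
    sums of a bounded [f], is stable under shifts, and makes all the exponential series converge. *)
Definition geometric c := exists B : R, forall j, `|c j| <= B * 2 ^+ j.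

Lemma geometric_bounded c (B : R) : (forall j, `|c j| <= B) -> geometric c.
Proof.
move=> cB; exists B => j; apply: le_trans (cB j) _.
rewrite ler_peMr//; first by apply: le_trans (cB 0%N).
by rewrite exprn_ege1// ler1n.
Qed.

Lemma geometric_shift c : geometric c -> geometric (c \o succn).
Proof.
case=> B cB; exists (B * 2) => j; apply: le_trans (cB j.+1) _.
by rewrite exprS mulrA.
Qed.

Lemma geometric_opp c : geometric c -> geometric (fun j => - c j).
Proof. by case=> B cB; exists B => j; rewrite normrN. Qed.

Lemma geometric_add c d : geometric c -> geometric d -> geometric (fun j => c j + d j).
Proof.
case=> B cB [D dD]; exists (B + D) => j; apply: le_trans (ler_normD _ _) _.
by rewrite mulrDl lerD.
Qed.

Lemma geometric_scale (k : R) c : geometric c -> geometric (fun j => k * c j).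
Proof.
case=> B cB; exists (`|k| * B) => j; rewrite normrM -mulrA.
by rewrite ler_wpM2l.
Qed.

Lemma geometric_linear (B : R) c : 0 <= B -> (forall j, `|c j| <= B * j%:R) -> geometric c.
Proof.
move=> B0 cB; exists B => j; apply: le_trans (cB j) _.
by rewrite ler_wpM2l// -natrX ler_nat ltnW// ltn_expl.
Qed.

Definition egf c : nat -> R := fun j => c j / j`!%:R.

(* The expectation of c at a Poisson random variable of parameter s. *)
Definition ptrans c s : R :=
  limn (series (fun j => expR (- s) * (s ^+ j / j`!%:R) * c j)).

Lemma egf_cvg c s : geometric c -> cvgn (pseries (egf c) s).
Proof.
case=> B cB; apply: normed_cvg.
have B0 : 0 <= B by have := cB 0%N; rewrite mulr1; apply: le_trans.
apply: (@series_le_cvg _ _ (fun j => B * exp_coeff (2 * `|s|) j)).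
- by move=> j /=.
- by move=> j; rewrite mulr_ge0// exp_coeff_ge0// mulr_ge0.
- move=> j; rewrite /egf /exp_coeff/= !normrM normfV normr_nat normrX exprMn.
  rewrite mulrAC mulrA mulrA ler_wpM2r ?invr_ge0//.
  by rewrite ler_wpM2r ?exprn_ge0.
- exact: (@is_cvg_seriesZ _ _ B (is_cvg_series_exp_coeff _)).
Qed.

Arguments egf_cvg : clear implicits.

Lemma ptransE c s : geometric c -> ptrans c s = expR (- s) * limn (pseries (egf c) s).
Proof.
move=> /(egf_cvg c s) cc.
rewrite -[RHS](@lim_seriesZ _ _ (expR (- s)) cc); congr (limn (series _)).
apply/funext => j; transitivity (expR (- s) * (egf c j * s ^+ j)); last by [].
by rewrite /egf; ring.
Qed.

Lemma ptrans_cvg c s : geometric c ->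
  cvgn (series (fun j => expR (- s) * (s ^+ j / j`!%:R) * c j)).
Proof.
move=> /(egf_cvg c s) cc.
rewrite (_ : (fun j => _) = expR (- s) *: (fun j => egf c j * s ^+ j)).
  exact: is_cvg_seriesZ.
apply/funext => j; transitivity (expR (- s) * (egf c j * s ^+ j)); last by [].
by rewrite /egf; ring.
Qed.

Arguments ptrans_cvg : clear implicits.

Lemma pseries_diffs_egf c : pseries_diffs (egf c) = egf (c \o succn).
Proof.
apply/funext => j; rewrite /pseries_diffs /egf /= factS natrM.
by rewrite invfM mulrCA mulVKf// pnatr_eq0.
Qed.

Lemma egf_derive c s : geometric c ->
  is_derive s 1 (fun x => limn (pseries (egf c) x)) (limn (pseries (egf (c \o succn)) s)).
Proof.
move=> gc; rewrite -pseries_diffs_egf.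
have gc1 := geometric_shift gc; have gc2 := geometric_shift gc1.
apply: (@pseries_snd_diffs _ _ (`|s| + 1)).
- exact: egf_cvg.
- by rewrite pseries_diffs_egf; exact: egf_cvg.
- by rewrite !pseries_diffs_egf; exact: egf_cvg.
- by rewrite [ltRHS]ger0_norm ?addr_ge0// ltrDl.
Qed.

Lemma ptransD c d s : geometric c -> geometric d ->
  ptrans (fun j => c j + d j) s = ptrans c s + ptrans d s.
Proof.
move=> gc gd; have := lim_seriesD (ptrans_cvg c s gc) (ptrans_cvg d s gd).
by move=> <-; congr (limn (series _)); apply/funext => j; exact: mulrDr.
Qed.

Lemma ptransZ (k : R) c s : geometric c -> ptrans (fun j => k * c j) s = k * ptrans c s.
Proof.
move=> gc; have := @lim_seriesZ _ _ k (ptrans_cvg c s gc).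
rewrite [RHS in _ = RHS -> _]/GRing.scale /= => <-.
by congr (limn (series _)); apply/funext => j; exact: mulrCA.
Qed.

Lemma ptransB c d s : geometric c -> geometric d ->
  ptrans (fun j => c j - d j) s = ptrans c s - ptrans d s.
Proof.
move=> gc gd; have := lim_seriesB (ptrans_cvg c s gc) (ptrans_cvg d s gd).
by move=> <-; congr (limn (series _)); apply/funext => j; exact: mulrBr.
Qed.

(** Differentiating the generating function shifts [c], and the factor [expR (- s)] subtracts [c]
    itself. Applied to the translates of [f] this is the heat equation. *)
Lemma ptrans_derive c s : geometric c ->
  is_derive s 1 (ptrans c) (ptrans (fun j => c j.+1 - c j) s).
Proof.
move=> gc; have gc1 := geometric_shift gc.
have dE : is_derive s 1 (fun x : R => expR (- x)) (- expR (- s)).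
  have := @der_comp _ expR (fun x => - x) s _ _ (is_derive_expR (- s)) (is_deriveNid s 1).
  by rewrite mulrN1.
apply: der_eq (derM dE (egf_derive s gc)) _ _.
  by move=> x /=; rewrite ptransE.
rewrite (ptransB s gc1 gc) !ptransE//; ring.
Qed.

Lemma le_ptrans c d s : 0 <= s -> geometric c -> geometric d ->
  (forall j, c j <= d j) -> ptrans c s <= ptrans d s.
Proof.
move=> s0 gc gd cd; apply: lim_series_le; [exact: ptrans_cvg|exact: ptrans_cvg|].
move=> j; rewrite ler_wpM2l//.
by rewrite mulr_ge0 ?expR_ge0// divr_ge0 ?exprn_ge0.
Qed.

Lemma ptrans_cst (k : R) s : ptrans (fun=> k) s = k.
Proof.
have gk : geometric (fun=> 1 : R) by apply: (@geometric_bounded _ 1) => j; rewrite normr1.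
rewrite (_ : (fun=> k) = (fun=> k * 1)); last by rewrite mulr1.
rewrite (ptransZ k s gk) ptransE// (_ : limn _ = expR s) ?expRN ?mulVf ?mulr1//.
  by rewrite gt_eqF// expR_gt0.
congr (limn (series _)); apply/funext => j.
by rewrite /egf /exp_coeff /= mul1r mulrC.
Qed.

Lemma ptrans_0 c : geometric c -> ptrans c 0 = c 0%N.
Proof.
move=> gc; rewrite ptransE// oppr0 expR0 mul1r.
have -> : limn (pseries (egf c) 0) = egf c 0%N.
  apply/(@lim_near_cst _ _ _ _ _ (egf c 0%N)) => //.
  exists 1%N => // -[//|n] _ /=.
  rewrite /pseries /series /= big_nat_recl// expr0 mulr1 big1 ?addr0// => i _.
  by rewrite expr0n mulr0.
by rewrite /egf fact0 divr1.
Qed.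

(** The forward difference of the identity is 1, so the mean of a Poisson variable and its parameter
    have the same derivative, and both vanish at 0. *)
Lemma ptrans_id s : ptrans (fun j => j%:R) s = s.
Proof.
have gi : geometric (fun j : nat => j%:R : R).
  by apply: (@geometric_linear 1) => // j; rewrite mul1r normr_nat.
have H (x : R) : is_derive x 1 (fun y => ptrans (fun j => j%:R) y - y) 0.
  apply: der_eq (derB (ptrans_derive x gi) (der_id x)) _ _ => //.
  rewrite (_ : (fun j : nat => _) = (fun=> 1)) ?ptrans_cst ?subrr//.
  by apply/funext => j; rewrite -natr1 addrAC subrr add0r.
have := is_derive_0_is_cst s 0 H; rewrite ptrans_0// !subr0 => /eqP.
by rewrite subr_eq0 => /eqP.
Qed.

Lemma ptrans_continuous c : geometric c -> continuous (ptrans c).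
Proof. by move=> gc s; exact: der_continuous (ptrans_derive s gc). Qed.

Lemma ptrans_norm c s : 0 <= s -> geometric c ->
  `|ptrans c s| <= ptrans (fun j => `|c j|) s.
Proof.
move=> s0 gc; have ga : geometric (fun j => `|c j|).
  by have [B cB] := gc; exists B => j; rewrite normr_id.
have gn := geometric_opp ga.
rewrite ler_norml; apply/andP; split; last first.
  by apply: le_ptrans => // j; exact: ler_norm.
have -> : - ptrans (fun j => `|c j|) s = ptrans (fun j => - `|c j|) s.
  rewrite -mulN1r -ptransZ//; congr ptrans.
  by apply/funext => j; rewrite mulN1r.
by apply: le_ptrans => // j; rewrite lerNl -normrN ler_norm.
Qed.

End PoissonTransform.

Lemma shift_succ (n : int) (j : nat) : n + 1 + j%:Z = n + j.+1%:Z.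
Proof. lia. Qed.

(** * Heat averages of bounded sequences and their primitive in time *)

Section HeatSemigroup.
Context {R : realType}.
Implicit Types (f : int -> R) (n a : int) (s : R).

Definition ht f n s := ptrans (fun j => f (n + j%:Z)) s.

Lemma heat_minus f n s : heat Minus s f n = ht (f \o -%R) (- n) s.
Proof.
rewrite /ht /ptrans; congr (limn (series _)); apply/funext => j /=.
by rewrite opprD opprK.
Qed.

Lemma ht_geometric f n : bounded_seq f -> geometric (fun j => f (n + j%:Z)).
Proof. by case=> B fB; exact: geometric_bounded. Qed.

Lemma bounded_norm f : bounded_seq f -> bounded_seq (fun n => `|f n|).
Proof. by case=> B fB; exists B => n; rewrite normr_id. Qed.

Lemma ht_derive f n s : bounded_seq f ->
  is_derive s 1 (ht f n) (ht f (n + 1) s - ht f n s).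
Proof.
move=> fB; have g n' := ht_geometric n' fB.
apply: der_eq (ptrans_derive s (g n)) _ _ => //.
rewrite /ht -ptransB//; congr (ptrans _ s); apply/funext => j.
by rewrite shift_succ.
Qed.

Lemma ht_continuous f n : bounded_seq f -> continuous (ht f n).
Proof. by move=> fB; apply: ptrans_continuous; exact: ht_geometric. Qed.

Lemma ht_norm f n s : bounded_seq f -> 0 <= s -> `|ht f n s| <= ht (fun m => `|f m|) n s.
Proof. by move=> fB s0; apply: ptrans_norm => //; exact: ht_geometric. Qed.

Lemma ht_le f n s (E : R) : bounded_seq f -> 0 <= s ->
  (forall j : nat, f (n + j%:Z) <= E) -> ht f n s <= E.
Proof.
move=> fB s0 fE; rewrite -[leRHS](ptrans_cst E s); apply: le_ptrans => //.
  exact: ht_geometric.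
by apply: (@geometric_bounded _ _ `|E|).
Qed.

Lemma ht_ge0 f n s : bounded_seq f -> 0 <= s -> (forall m, 0 <= f m) -> 0 <= ht f n s.
Proof.
move=> fB s0 f0; rewrite -[leLHS](ptrans_cst 0 s); apply: le_ptrans => //.
  by apply: (@geometric_bounded _ _ 0) => j; rewrite normr0.
exact: ht_geometric.
Qed.

Lemma ht_wsum f s a (L : nat) : bounded_seq f ->
  geometric (fun j => wsum f (a + j%:Z) L) /\
  wsum (fun n => ht f n s) a L = ptrans (fun j => wsum f (a + j%:Z) L) s.
Proof.
move=> fB; elim: L a => [|L IH] a.
  rewrite wsum0; split.
    by apply: (@geometric_bounded _ _ 0) => j; rewrite wsum0 normr0.
  by rewrite (_ : (fun j => _) = fun=> 0) ?ptrans_cst//; apply/funext => j; rewrite wsum0.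
have [g1 E1] := IH (a + 1); have g0 := ht_geometric a fB.
have E : (fun j : nat => wsum f (a + j%:Z) L.+1) =
    (fun j => f (a + j%:Z) + wsum f (a + 1 + j%:Z) L).
  by apply/funext => j; rewrite wsumS addrAC.
rewrite E; split; first exact: geometric_add.
by rewrite wsumS E1 ptransD.
Qed.

Lemma ht_tot f s (T : R) : 0 <= s -> tot_le (fun n => `|f n|) T ->
  tot_le (fun n => ht (fun m => `|f m|) n s) T.
Proof.
move=> s0 fT a L; have fB : bounded_seq (fun m => `|f m|).
  by exists T => n; rewrite normr_id; exact: tot_le_pt fT.
have [g ->] := ht_wsum s a L fB.
rewrite -[leRHS](ptrans_cst T s); apply: le_ptrans => //.
by apply: (@geometric_bounded _ _ `|T|).
Qed.

(* The primitive of the heat averages vanishing at 0, obtained from the partial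
   sums by summation by parts. *)
Definition htsum f n s := ptrans (fun j => wsum (fun m => `|f m|) n j) s.

Lemma htsum_geometric f n : bounded_seq f ->
  geometric (fun j => wsum (fun m => `|f m|) n j).
Proof.
move=> fB; apply: (@geometric_linear _ (maxfun f n)); first exact: maxfun_ge0.
by move=> j; rewrite ger0_norm ?wsum_le_maxfun// wsum_ge0.
Qed.

Lemma htsum_derive f n s : bounded_seq f ->
  is_derive s 1 (htsum f n) (ht (fun m => `|f m|) n s).
Proof.
move=> fB; apply: der_eq (ptrans_derive s (htsum_geometric n fB)) _ _ => //.
congr (ptrans _ s); apply/funext => j.
by rewrite -addn1 wsum_cat wsumS wsum0 addr0 addrAC subrr add0r.
Qed.

Lemma htsum_ge0 f n s : bounded_seq f -> 0 <= s -> 0 <= htsum f n s.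
Proof.
move=> fB s0; rewrite -[leLHS](ptrans_cst 0 s); apply: le_ptrans => //.
- by apply: (@geometric_bounded _ _ 0) => j; rewrite normr0.
- exact: htsum_geometric.
- by move=> j; rewrite wsum_ge0.
Qed.

(** A sum of j terms is at most j times the maximal function, and the mean of j is [s]. *)
Lemma htsum_le f n s : bounded_seq f -> 0 <= s -> htsum f n s <= maxfun f n * s.
Proof.
move=> fB s0; have gi : geometric (fun j : nat => j%:R : R).
  by apply: (@geometric_linear _ 1) => // j; rewrite mul1r normr_nat.
rewrite -{2}[s]ptrans_id -ptransZ//; apply: le_ptrans => //.
- exact: htsum_geometric.
- exact: geometric_scale.
- by move=> j; exact: wsum_le_maxfun.
Qed.

End HeatSemigroup.

(** * The Poisson semigroup *)

Section HalfLine.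
Context {R : realType}.
Local Notation mu := (@lebesgue_measure R).
Implicit Types (f g : R -> R) (s t b : R) (N k : nat).

Definition Half f : R := \int[mu]_(s in `]0, +oo[) f s.

(** The upper end has the form up to which [gsq_dyadic] decomposes the times, so one index governs
    both ends. *)
Definition exh N : set R := `[2 ^- N, 2 * 2 ^+ N]%classic.

Lemma exh_gt0 N : 0 < 2 ^- N :> R.
Proof. by rewrite invr_gt0 exprn_gt0. Qed.

Lemma exh_le N : 2 ^- N <= 2 * 2 ^+ N :> R.
Proof.
apply: (@le_trans _ _ 1); first by rewrite invf_le1 ?exprn_gt0// exprn_ege1// ler1n.
by rewrite -exprS exprn_ege1// ler1n.
Qed.

Lemma exh_homo : {homo exh : n m / (n <= m)%N >-> (n <= m)%O}.
Proof.
move=> n m nm; apply/subsetPset; apply: subset_itv; rewrite bnd_simp.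
  by rewrite lef_pV2 ?posrE ?exprn_gt0// ler_weXn2l// ler1n.
by rewrite ler_wpM2l// ler_weXn2l// ler1n.
Qed.

Lemma exh_bigcup : \bigcup_N exh N = `]0, +oo[%classic :> set R.
Proof.
apply/seteqP; split => [x [N _]|x]; rewrite /exh /= !in_itv /= ?andbT.
  by move=> /andP[Nx _]; apply: lt_le_trans Nx; exact: exh_gt0.
move=> x0; pose N := (Num.truncn x + Num.truncn x^-1).+1.
have NN : N%:R <= 2 ^+ N :> R by rewrite -natrX ler_nat ltnW// ltn_expl.
have le1 (y : R) : 0 < y -> (Num.truncn y <= Num.truncn x + Num.truncn x^-1)%N -> y <= 2 ^+ N.
  move=> y0 yN; apply: le_trans NN; apply: le_trans (ltW (truncnS_gt y)) _.
  by rewrite ler_nat ltnS.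
exists N => //=; rewrite in_itv /=; apply/andP; split.
  rewrite -[x]invrK lef_pV2 ?posrE ?invr_gt0 ?exprn_gt0//.
  by apply: le1; rewrite ?invr_gt0 ?leq_addl.
apply: le_trans (le1 _ x0 (leq_addr _ _)) _.
by rewrite ler_peMl ?exprn_ge0// ler1n.
Qed.

Lemma cpos_measurable f : cpos f -> measurable_fun (`]0, +oo[%classic : set R) f.
Proof.
move=> cf; apply: open_continuous_measurable_fun; first exact: interval_open.
by move=> x /set_mem /=; rewrite in_itv /= andbT => x0; exact: cf.
Qed.

Lemma cpos_integrable_le f g : cpos f -> (forall s, 0 < s -> `|f s| <= g s) ->
  mu.-integrable `]0, +oo[ (EFin \o g) -> mu.-integrable `]0, +oo[ (EFin \o f).
Proof.
move=> cf fg; apply: le_integrable => //.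
  by apply/measurable_EFinP; exact: cpos_measurable.
move=> x /=; rewrite in_itv /= andbT => x0; rewrite lee_fin.
exact: le_trans (fg _ x0) (ler_norm _).
Qed.

Lemma exh_cvg_ge0 f : cpos f -> (forall s, 0 < s -> 0 <= f s) ->
  (\int[mu]_(s in exh N) (f s)%:E)%E @[N --> \oo] -->
  (\int[mu]_(s in `]0%R, +oo[) (f s)%:E)%E.
Proof.
move=> cf f0; rewrite -exh_bigcup; apply: ge0_nondecreasing_set_cvg_integral.
- exact: exh_homo.
- by move=> N; exact: measurable_itv.
- move=> N; have := cpos_integrable (2 * 2 ^+ N) (exh_gt0 N) cf.
  by move=> /measurable_int.
- move=> N x; rewrite /exh /= in_itv /= => /andP[Nx _]; rewrite lee_fin f0//.
  by apply: lt_le_trans Nx; exact: exh_gt0.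
Qed.

Lemma half_line_le f (K : R) : cpos f -> (forall s, 0 < s -> 0 <= f s) ->
  (forall N, Intg (2 ^- N) (2 * 2 ^+ N) f <= K) ->
  (\int[mu]_(s in `]0%R, +oo[) (f s)%:E <= K%:E)%E.
Proof.
move=> cf f0 fK; have cvg := exh_cvg_ge0 cf f0.
rewrite -(cvg_lim _ cvg)//; apply: lime_le; first by apply/cvg_ex; eexists; exact: cvg.
apply: nearW => N; have If := cpos_integrable (2 * 2 ^+ N) (exh_gt0 N) cf.
by rewrite -[leLHS](fineK (integrable_fin_num _ If))// lee_fin; exact: fK.
Qed.

Lemma half_cvg_ge0 f : cpos f -> (forall s, 0 < s -> 0 <= f s) ->
  mu.-integrable `]0, +oo[ (EFin \o f) ->
  (fun N => Intg (2 ^- N) (2 * 2 ^+ N) f) @ \oo --> Half f.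
Proof.
move=> cf f0 If; apply: fine_cvg; rewrite fineK; last exact: integrable_fin_num.
exact: exh_cvg_ge0.
Qed.

Lemma half_cvg f : cpos f -> mu.-integrable `]0, +oo[ (EFin \o f) ->
  (fun N => Intg (2 ^- N) (2 * 2 ^+ N) f) @ \oo --> Half f.
Proof.
move=> cf If; have ca : cpos (fun s => `|f s|).
  by apply: (cpos_comp _ cf); exact: norm_continuous.
have Ia : mu.-integrable `]0, +oo[ (EFin \o (fun s => `|f s|)).
  exact: (integrable_abse If).
have cs : cpos (fun s => `|f s| + f s) := cposD ca cf.
have Is : mu.-integrable `]0, +oo[ (EFin \o (fun s => `|f s| + f s)).
  exact: (integrableD _ Ia If).
have s0 s : 0 < s -> 0 <= `|f s| + f s.
  by move=> _; rewrite -lerBlDr sub0r -normrN ler_norm.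
(* Monotone convergence applies to [|f| + f] and to [|f|], whose difference is [f]. *)
have -> : Half f = Half (fun s => `|f s| + f s) - Half (fun s => `|f s|).
  by rewrite /Half RintegralD// addrAC subrr add0r.
have -> : (fun N => Intg (2 ^- N) (2 * 2 ^+ N) f) =
  (fun N => Intg (2 ^- N) (2 * 2 ^+ N) (fun s => `|f s| + f s)) \-
  (fun N => Intg (2 ^- N) (2 * 2 ^+ N) (fun s => `|f s|)).
  apply/funext => N /=; rewrite IntgD ?exh_gt0//.
  by rewrite addrAC subrr add0r.
by apply: cvgB; apply: half_cvg_ge0.
Qed.

Lemma half_integrable f (K : R) : cpos f -> (forall s, 0 < s -> 0 <= f s) ->
  (forall N, Intg (2 ^- N) (2 * 2 ^+ N) f <= K) ->
  mu.-integrable `]0, +oo[ (EFin \o f) /\ Half f <= K.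
Proof.
move=> cf f0 fK; have H := half_line_le cf f0 fK.
have If : mu.-integrable `]0, +oo[ (EFin \o f).
  apply/integrableP; split.
    by apply/measurable_EFinP; exact: cpos_measurable.
  apply: le_lt_trans (ltry K); apply: le_trans H; apply: ge0_le_integral => //.
  - by apply/measurable_EFinP; exact: cpos_measurable (cpos_comp (@norm_continuous _ _) cf).
  - by apply/measurable_EFinP; exact: cpos_measurable.
  - by move=> x /=; rewrite in_itv /= andbT lee_fin => x0; rewrite ger0_norm// f0.
split => //; rewrite -lee_fin fineK//; exact: integrable_fin_num.
Qed.

Lemma half_le f g : cpos f -> cpos g -> mu.-integrable `]0, +oo[ (EFin \o f) ->
  mu.-integrable `]0, +oo[ (EFin \o g) ->
  (forall s, 0 < s -> f s <= g s) -> Half f <= Half g.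
Proof.
move=> cf cg If Ig fg; apply: le_Rintegral => //= x.
by rewrite in_itv /= andbT; exact: fg.
Qed.

Lemma half_norm_le f g : cpos f -> cpos g ->
  mu.-integrable `]0, +oo[ (EFin \o g) ->
  (forall s, 0 < s -> `|f s| <= g s) -> `|Half f| <= Half g.
Proof.
move=> cf cg Ig fg; have If := cpos_integrable_le cf fg Ig.
apply: le_trans (le_normr_Rintegral _ If) _ => //.
apply: half_le => //; last exact: (integrable_abse If).
by apply: (cpos_comp _ cf); exact: norm_continuous.
Qed.

End HalfLine.

(** * The subordination kernel and its majorant *)

Section Kernel.
Context {R : realType}.
Local Notation mu := (@lebesgue_measure R).
Implicit Types (f h : R -> R) (s t b g y : R) (N k : nat).

(** The majorant of the kernel, used with b = t^2: it decreases in [s] and has an elementary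
    primitive. *)
Definition psi g b s : R := (s + b) `^ (- (1 + g)).

Lemma powR_derive (r x : R) : 0 < x -> is_derive x 1 (fun y => y `^ r) (r * x `^ (r - 1)).
Proof. exact: is_derive1_powR. Qed.

Lemma psi_derive g b s : 0 < b -> 0 < s ->
  is_derive s 1 (fun x => - (x + b) `^ (- g) / g) ((- g) * psi g b s * (- g^-1)).
Proof.
move=> b0 s0; have sb : 0 < s + b by rewrite addr_gt0.
have D := @der_comp _ (fun y => y `^ (- g)) (fun x => x + b) s _ _
  (powR_derive (- g) sb) (derD (der_id s) (der_cst s b)).
apply: der_eq (derZ (- g^-1) D) _ _ => [x|]; first by rewrite !mulNr mulrC.
rewrite /psi addr0 mulr1 mulrC; congr (_ * _ `^ _ * _); ring.
Qed.

Lemma psi_gt0 g b s : 0 < b -> 0 < s -> 0 < psi g b s.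
Proof. by move=> b0 s0; rewrite powR_gt0// addr_gt0. Qed.

Lemma psi_cpos g b : 0 < b -> cpos (psi g b).
Proof.
move=> b0 s s0; have sb : 0 < s + b by rewrite addr_gt0.
exact: (der_continuous (@der_comp _ (fun y => y `^ (- (1 + g))) (fun x => x + b)
  s _ _ (powR_derive (- (1 + g)) sb) (derD (der_id s) (der_cst s b)))).
Qed.

Lemma psi_Intg g b N : 0 < g -> 0 < b ->
  Intg (2 ^- N) (2 * 2 ^+ N) (psi g b) <= b `^ (- g) / g.
Proof.
move=> g0 b0; have D (s : R) : 0 < s ->
    is_derive s 1 (fun x => - (x + b) `^ (- g) / g) (psi g b s).
  move=> s0; apply: der_eq (psi_derive g b0 s0) _ _ => //.
  by rewrite mulrC mulrA mulrNN mulVf ?mul1r// gt_eqF.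
rewrite (Intg_FTC (exh_gt0 N) (exh_le N) (@psi_cpos g b b0) D).
rewrite !mulNr opprK addrC; apply: (@le_trans _ _ ((2 ^- N + b) `^ (- g) / g)).
  by rewrite gerBl divr_ge0 ?powR_ge0// ltW.
rewrite ler_wpM2r ?invr_ge0 ?(ltW g0)// !powRN lef_pV2 ?posrE ?powR_gt0//.
- apply: ge0_ler_powR; rewrite ?nnegrE ?(ltW g0) ?(ltW b0)//.
    by rewrite addr_ge0 ?(ltW (exh_gt0 N)) ?(ltW b0).
  by rewrite lerDr (ltW (exh_gt0 N)).
- by rewrite addr_gt0// exh_gt0.
Qed.

Lemma psi_half g b : 0 < g -> 0 < b ->
  mu.-integrable `]0, +oo[ (EFin \o psi g b) /\ Half (psi g b) <= b `^ (- g) / g.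
Proof.
move=> g0 b0; apply: half_integrable; first exact: psi_cpos.
  by move=> s s0; exact: ltW (psi_gt0 g b0 s0).
by move=> N; exact: psi_Intg.
Qed.

Lemma exp_pow_bound (N : nat) : exists2 C : R, 0 < C &
  forall y, 0 <= y -> expR (- (y / 4)) * (1 + y) ^+ N <= C.
Proof.
(* With this [M], the power [N.+1] of [expR ((1 + y) / M)] is [expR ((1 + y) / 4)], and expR x >= 1
   + x is enough. *)
pose M : R := 4 * N.+1%:R; have M0 : 0 < M by rewrite mulr_gt0.
have e0 := expR_gt0 (4^-1 : R).
exists (M ^+ N.+1 * expR 4^-1); first by rewrite mulr_gt0 ?exprn_gt0.
move=> y y0; have y1 : 0 < 1 + y by rewrite ltr_wpDr.
have H : ((1 + y) / M) ^+ N.+1 <= expR ((1 + y) / 4).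
  rewrite (_ : (1 + y) / 4 = N.+1%:R * ((1 + y) / M)); last first.
    by rewrite [RHS]mulrC /M invfM -!mulrA mulVf ?mulr1// pnatr_eq0.
  rewrite expRM_natl lerXn2r ?nnegrE ?expR_ge0 ?divr_ge0 ?(ltW M0) ?(ltW y1)//.
  by apply: le_trans (expR_ge1Dx _); rewrite lerDr.
rewrite expRN mulrC ler_pdivrMr ?expR_gt0// -mulrA -expRD.
rewrite (_ : 4^-1 + y / 4 = (1 + y) / 4); last by field.
apply: (@le_trans _ _ ((1 + y) ^+ N.+1)).
  by rewrite ler_weXn2l// lerDl.
by rewrite mulrC -ler_pdivrMr ?exprn_gt0// -expr_div_n.
Qed.

(* The subordination kernel, up to the factor t^(2g) / (4^g Gamma(g)); the powers
   of 1/s appear when it is differentiated. *)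
Definition kern g t k s : R :=
  expR (- (t ^+ 2 / (4 * s))) * s^-1 ^+ k * s `^ (- (1 + g)).

Lemma kern_ge0 g t k s : 0 < s -> 0 <= kern g t k s.
Proof.
move=> s0; rewrite /kern !mulr_ge0 ?expR_ge0 ?powR_ge0// exprn_ge0// invr_ge0.
exact: ltW.
Qed.

(** With y = t^2 / s, both sides are the same power of [s] times a function of y. The exponential
    pays for y^k and for (1 + y)^(1 + g), which is at most (1 + y)^2 as [g < 1]. *)
Lemma kern_bound g k : 0 < g < 1 -> exists2 C, 0 < C &
  forall t s, 0 < t -> 0 < s -> (t ^+ 2) ^+ k * kern g t k s <= C * psi g (t ^+ 2) s.
Proof.
move=> /andP[g0 g1]; have [C C0 HC] := exp_pow_bound (k + 2).
exists C => // t s t0 s0; have t2 : 0 < t ^+ 2 by rewrite exprn_gt0.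
pose y := t ^+ 2 / s; have y0 : 0 < y by rewrite divr_gt0.
have g10 : 0 <= 1 + g by rewrite addr_ge0// ltW.
have y1 : 0 < 1 + y by rewrite addr_gt0.
have ps0 : 0 < s `^ (- (1 + g)) by rewrite powR_gt0.
have E1 : s + t ^+ 2 = s * (1 + y) by rewrite /y; field; rewrite gt_eqF.
have -> : psi g (t ^+ 2) s = s `^ (- (1 + g)) * ((1 + y) `^ (1 + g))^-1.
  by rewrite /psi E1 powRM ?(ltW s0) ?(ltW y1)// [(1 + y) `^ _]powRN.
have -> : (t ^+ 2) ^+ k * kern g t k s =
    s `^ (- (1 + g)) * (expR (- (y / 4)) * y ^+ k).
  rewrite /kern (_ : t ^+ 2 / (4 * s) = y / 4); last by rewrite /y; field; rewrite gt_eqF.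
  by rewrite [y ^+ k]exprMn; ring.
rewrite [leRHS]mulrCA ler_wpM2l ?(ltW ps0)// ler_pdivlMr ?powR_gt0//.
apply: le_trans (HC y (ltW y0)); rewrite -mulrA ler_wpM2l ?expR_ge0// exprD.
apply: ler_pM; rewrite ?powR_ge0 ?exprn_ge0 ?(ltW y0)//.
  by rewrite lerXn2r ?nnegrE ?(ltW y0) ?(ltW y1)// lerDr.
rewrite -powR_mulrn ?(ltW y1)//; apply: ler_powR; first by rewrite lerDl ltW.
by rewrite mulr2n lerD2l ltW.
Qed.

Lemma kern_derive_t g t k s : 0 < s ->
  is_derive t 1 (fun x => kern g x k s) (- (t / 2) * kern g t k.+1 s).
Proof.
move=> s0.
have D := @der_comp _ expR (fun x => - (4 * s)^-1 * x ^+ 2) t _ _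
  (is_derive_expR _) (derZ (- (4 * s)^-1) (derX 2 (der_id t))).
apply: der_eq (derZ (s^-1 ^+ k * s `^ (- (1 + g))) D) _ _ => [x|].
  rewrite /kern [_ / (4 * s)]mulrC -mulNr; ring.
rewrite /kern /= expr1 mulr1 [s^-1 ^+ k.+1]exprS.
rewrite (_ : - (4 * s)^-1 * t ^+ 2 = - (t ^+ 2 / (4 * s))); last by ring.
have -> : - (4 * s)^-1 * (2 * t) = - (t / 2) * s^-1.
  by rewrite invfM; field; rewrite gt_eqF.
by move: (expR _) => e; ring.
Qed.

Lemma kern_cpos g t k : cpos (kern g t k).
Proof.
move=> s s0.
have cV : cpos (fun s : R => s^-1).
  by apply: cposV => [|x x0]; [exact: cpos_id | rewrite gt_eqF].
have cE : cpos (fun s : R => expR (- (t ^+ 2 / (4 * s)))).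
  apply: (cpos_comp (@continuous_expR R)).
  have -> : (fun s : R => - (t ^+ 2 / (4 * s))) = (fun s => - (t ^+ 2 / 4) * s^-1).
    by apply/funext => x; rewrite invfM mulrA mulNr.
  exact: cposM (cpos_cst _) cV.
have cP : cpos (fun s : R => s `^ (- (1 + g))).
  by move=> x x0; exact: (der_continuous (powR_derive _ x0)).
exact: (cposM (cposM cE (cposX k cV)) cP).
Qed.

Lemma kern_derive_s g t s : 0 < s ->
  is_derive s 1 (kern g t 0) (t ^+ 2 / 4 * kern g t 2 s - (1 + g) * kern g t 1 s).
Proof.
move=> s0; have sn0 : s != 0 by rewrite gt_eqF.
have DV := derZ (- (t ^+ 2 / 4)) (derV (der_id s) sn0).
have D := @der_comp _ expR (fun x => - (t ^+ 2 / 4) * x^-1) s _ _ (is_derive_expR _) DV.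
apply: der_eq (derM D (powR_derive (- (1 + g)) s0)) _ _ => [x|].
  rewrite /kern expr0 mulr1 (_ : t ^+ 2 / (4 * x) = t ^+ 2 / 4 * x^-1) ?mulNr//.
  by rewrite invfM mulrA.
have E : s `^ (- (1 + g) - 1) = s^-1 * s `^ (- (1 + g)).
  rewrite [in RHS](powR_pred (- (1 + g)) s0) mulrA mulVf// mul1r.
  by [].
rewrite E /kern expr1 (_ : t ^+ 2 / (4 * s) = t ^+ 2 / 4 * s^-1); last first.
  by rewrite invfM mulrA.
rewrite (_ : - (t ^+ 2 / 4) * s^-1 = - (t ^+ 2 / 4 / s)) ?mulNr//=.
by move: (expR _) => e; field.
Qed.

End Kernel.

Section KernelIntegrals.
Context {R : realType}.
Local Notation mu := (@lebesgue_measure R).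
Implicit Types (f h H : R -> R) (s t b g B : R) (N k : nat).

Definition iker g h k t : R := Half (fun s => kern g t k s * h s).

Lemma psi_mul_integrable g b B h : 0 < g -> 0 < b -> cpos h ->
  (forall s, 0 < s -> `|h s| <= B) ->
  cpos (fun s => psi g b s * h s) /\
  mu.-integrable `]0, +oo[ (EFin \o (fun s => psi g b s * h s)).
Proof.
move=> g0 b0 ch hB; have cp := @psi_cpos _ g b b0; have [Ip _] := psi_half g0 b0.
have cph := cposM cp ch; split => //.
apply: (@cpos_integrable_le _ _ (fun s => B * psi g b s)) => //.
  move=> s s0; have p0 := ltW (psi_gt0 g b0 s0).
  by rewrite normrM (ger0_norm p0) mulrC ler_wpM2r// hB.
exact: (integrableZl _ B Ip).
Qed.

Lemma kern_mul_integrable g t k B h : 0 < g < 1 -> 0 < t -> cpos h ->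
  (forall s, 0 < s -> `|h s| <= B) ->
  cpos (fun s => kern g t k s * h s) /\
  mu.-integrable `]0, +oo[ (EFin \o (fun s => kern g t k s * h s)).
Proof.
move=> gg t0 ch hB; have [C C0 HC] := kern_bound k gg.
have g0 : 0 < g by case/andP: gg.
have t2 : 0 < t ^+ 2 by rewrite exprn_gt0.
have tk : 0 < (t ^+ 2) ^+ k by rewrite exprn_gt0.
have [Ip _] := psi_half g0 t2.
have ckh : cpos (fun s => kern g t k s * h s) := cposM (@kern_cpos _ g t k) ch.
split => //.
apply: (@cpos_integrable_le _ _ (fun s => (C / (t ^+ 2) ^+ k * B) * psi g (t ^+ 2) s)) => //.
  move=> s s0; have k0 := kern_ge0 g t k s0.
  rewrite normrM (ger0_norm k0) [leRHS]mulrAC; apply: ler_pM => //; last exact: hB.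
  by rewrite [leRHS]mulrAC ler_pdivlMr// mulrC HC.
exact: (integrableZl _ _ Ip).
Qed.

Lemma iker_bound g k : 0 < g < 1 -> exists2 C, 0 < C &
  forall h H B t, cpos h -> cpos H -> (forall s, 0 < s -> `|h s| <= H s) ->
  (forall s, 0 < s -> `|H s| <= B) -> 0 < t ->
  (t ^+ 2) ^+ k * `|iker g h k t| <= C * Half (fun s => psi g (t ^+ 2) s * H s).
Proof.
move=> gg; have [C C0 HC] := kern_bound k gg; exists C => //.
move=> h H B t ch cH hH HB t0; have g0 : 0 < g by case/andP: gg.
have t2 : 0 < t ^+ 2 by rewrite exprn_gt0.
have tk : 0 < (t ^+ 2) ^+ k by rewrite exprn_gt0.
have [cp Ip] := psi_mul_integrable g0 t2 cH HB.
have ck := cposM (@kern_cpos _ g t k) ch.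
have -> : C * Half (fun s => psi g (t ^+ 2) s * H s) =
    Half (fun s => C * (psi g (t ^+ 2) s * H s)) by rewrite /Half RintegralZl.
have -> : (t ^+ 2) ^+ k * `|iker g h k t| =
    `|Half (fun s => (t ^+ 2) ^+ k * (kern g t k s * h s))|.
  have hB s : 0 < s -> `|h s| <= B.
    by move=> s0; apply: le_trans (HB s s0); apply: le_trans (hH s s0) (ler_norm _).
  have [_ Ik] := kern_mul_integrable k gg t0 ch hB.
  by rewrite /iker /Half RintegralZl// normrM (ger0_norm (ltW tk)).
apply: half_norm_le.
- exact: cposM (cpos_cst _) ck.
- exact: cposM (cpos_cst C) cp.
- exact: (integrableZl _ C Ip).
move=> s s0; have k0 := kern_ge0 g t k s0.
rewrite [X in `|X|]mulrA [leRHS]mulrA normrM (ger0_norm (mulr_ge0 (ltW tk) k0)).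
by apply: ler_pM => //; [rewrite mulr_ge0 ?(ltW tk) | exact: HC | exact: hH].
Qed.

Lemma iker_derive g h k t B : 0 < g < 1 -> 0 < t -> cpos h ->
  (forall s, 0 < s -> `|h s| <= B) ->
  is_derive t 1 (iker g h k) (- (t / 2) * iker g h k.+1 t).
Proof.
move=> gg t0 ch hB; have g0 : 0 < g by case/andP: gg.
have [C C0 HC] := kern_bound k.+1 gg.
pose f x s := kern g x k s * h s.
(* Domination for times x in (t / 2, 2 t): there [x / 2 <= t], and [b <= x ^+ 2] makes [psi] at [b]
   the larger one. *)
pose b := (t / 2) ^+ 2.
have th0 : 0 < t / 2 by rewrite divr_gt0.
have b0 : 0 < b by rewrite exprn_gt0.
have B0 : 0 <= B by exact: le_trans (hB 1 ltr01).
have bk : 0 < b ^+ k.+1 by rewrite exprn_gt0.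
pose K := t * (C / b ^+ k.+1 * B).
have K0 : 0 <= K by rewrite !mulr_ge0 ?invr_ge0 ?(ltW t0) ?(ltW C0) ?(ltW bk).
pose G s := K * psi g b s.
have [Ip _] := psi_half g0 b0.
have df (x s : R) : 0 < s -> is_derive x 1 (f ^~ s) (- (x / 2) * kern g x k.+1 s * h s).
  move=> s0; apply: der_eq (derM (kern_derive_t g x k s0) (der_cst x (h s))) _ _ => //.
  by rewrite mulr0 addr0.
have It : `]t / 2, 2 * t[%classic t.
  by rewrite /= in_itv /=; apply/andP; split; move: t0; clear; lra.
have D0 (y : R) : (`]0, +oo[%classic : set R) y -> 0 < y.
  by rewrite /= in_itv /= andbT.
have intf (x : R) : `]t / 2, 2 * t[%classic x -> mu.-integrable `]0, +oo[ (EFin \o f x).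
  rewrite /= in_itv /= => /andP[tx _]; have x0 := lt_trans th0 tx.
  by have [_] := kern_mul_integrable k gg x0 ch hB.
have derf (x y : R) : `]t / 2, 2 * t[%classic x -> (`]0, +oo[%classic : set R) y ->
    derivable (f ^~ y) x 1.
  by move=> _ /D0 y0; have [] := df x y y0.
have G0 y : 0 <= G y by rewrite mulr_ge0 ?powR_ge0.
have IG : mu.-integrable `]0, +oo[ (EFin \o G) by exact: (integrableZl _ K Ip).
have p1 (x y : R) : 0 < y -> partial1of2 f x y = - (x / 2) * kern g x k.+1 y * h y.
  by move=> y0; rewrite partial1of2E; have [_ ->] := df x y y0.
have Gub (x y : R) : `]t / 2, 2 * t[%classic x -> (`]0, +oo[%classic : set R) y ->
    `|partial1of2 f x y| <= G y.
  rewrite /= !in_itv /= andbT => /andP[tx xt] y0; rewrite p1//.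
  have x0 := lt_trans th0 tx; have x2 : 0 < x ^+ 2 by rewrite exprn_gt0.
  have kx := kern_ge0 g x k.+1 y0.
  have hx : x / 2 <= t by rewrite ler_pdivrMr// mulrC ltW.
  have bx : b <= x ^+ 2 by rewrite lerXn2r ?nnegrE ?ltW.
  have kb : kern g x k.+1 y <= C / b ^+ k.+1 * psi g b y.
    rewrite [leRHS]mulrAC ler_pdivlMr//.
    apply: (@le_trans _ _ ((x ^+ 2) ^+ k.+1 * kern g x k.+1 y)).
      by rewrite mulrC ler_wpM2r// lerXn2r ?nnegrE ?(ltW b0) ?(ltW x2).
    apply: le_trans (HC x y x0 y0) _; rewrite ler_wpM2l ?(ltW C0)//.
    rewrite /psi !powRN lef_pV2 ?posrE ?powR_gt0 ?addr_gt0//.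
    apply: ge0_ler_powR; rewrite ?nnegrE ?addr_ge0 ?(ltW y0) ?(ltW b0) ?(ltW x2) ?(ltW g0)//.
    by rewrite lerD2l.
  have x20 : 0 <= x / 2 by rewrite divr_ge0// ltW.
  rewrite 2!normrM (ger0_norm kx) normrN (ger0_norm x20).
  apply: le_trans (ler_pM (mulr_ge0 x20 kx) (normr_ge0 _)
    (ler_pM x20 kx hx kb) (hB y y0)) _.
  rewrite /G /K le_eqVlt; apply/orP; left; apply/eqP.
  by move: (b ^+ _)^-1 (psi _ _ _) => z w; ring.
have E : \int[mu]_(y in `]0, +oo[) partial1of2 f t y = - (t / 2) * iker g h k.+1 t.
  have [_ Ik] := kern_mul_integrable k.+1 gg t0 ch hB.
  rewrite /iker /Half -RintegralZl//; apply: eq_Rintegral => y /set_mem /D0 y0.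
  by rewrite p1// mulrA.
split.
  exact: (@derivable_under_integral R _ _ mu f _ (measurable_itv `]0, +oo[)
    t _ _ It intf derf G G0 IG Gub).
rewrite -derive1E -E.
exact: (@differentiation_under_integral R _ _ mu f _ (measurable_itv `]0, +oo[)
  t _ _ It intf derf G G0 IG Gub).
Qed.

End KernelIntegrals.

(** * Integration by parts in the subordination variable *)

Section ByParts.
Context {R : realType}.
Local Notation mu := (@lebesgue_measure R).
Implicit Types (f : int -> R) (h : R -> R) (s t b g B : R) (n : int).

Lemma hl_integrableD (p q : R -> R) : mu.-integrable `]0, +oo[ (EFin \o p) ->
  mu.-integrable `]0, +oo[ (EFin \o q) ->
  mu.-integrable `]0, +oo[ (EFin \o (fun s => p s + q s)).
Proof. by move=> Ip Iq; exact: (integrableD _ Ip Iq). Qed.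

Lemma hl_integrableB (p q : R -> R) : mu.-integrable `]0, +oo[ (EFin \o p) ->
  mu.-integrable `]0, +oo[ (EFin \o q) ->
  mu.-integrable `]0, +oo[ (EFin \o (fun s => p s - q s)).
Proof. by move=> Ip Iq; exact: (integrableB _ Ip Iq). Qed.

Lemma hl_integrableZ (c : R) (p : R -> R) : mu.-integrable `]0, +oo[ (EFin \o p) ->
  mu.-integrable `]0, +oo[ (EFin \o (fun s => c * p s)).
Proof. by move=> Ip; exact: (integrableZl _ c Ip). Qed.

Lemma cvg_half_pow (K : R) : (fun N => K * 2 ^- N) @ \oo --> (0 : R).
Proof.
rewrite -[X in _ --> X](mulr0 K); apply: cvgM; first exact: cvg_cst.
have : (fun N => 2^-1 ^+ N : R) @ \oo --> (0 : R).
  by apply: cvg_expr; rewrite ger0_norm// invf_lt1// ltr1n.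
by under eq_fun do rewrite exprVn.
Qed.

(* Integration by parts in [s]; with [kern_derive_t] it is what turns the heat
   equation for [h] into the extension problem. *)
Lemma iker_parts g h (h' : R -> R) t B B' : 0 < g < 1 -> 0 < t ->
  (forall s, 0 < s -> is_derive s 1 h (h' s)) -> cpos h' ->
  (forall s, 0 < s -> `|h s| <= B) -> (forall s, 0 < s -> `|h' s| <= B') ->
  iker g h' 0 t = (1 + g) * iker g h 1 t - t ^+ 2 / 4 * iker g h 2 t.
Proof.
move=> gg t0 dh ch' hB hB'; have ch : cpos h := cpos_derive dh.
have g0 : 0 < g by case/andP: gg.
have [c0 I0] := kern_mul_integrable 0 gg t0 ch' hB'.
have [c1 I1] := kern_mul_integrable 1 gg t0 ch hB.
have [c2 I2] := kern_mul_integrable 2 gg t0 ch hB.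
pose W s := kern g t 0 s * h s.
pose W' s := t ^+ 2 / 4 * (kern g t 2 s * h s) - (1 + g) * (kern g t 1 s * h s)
   + kern g t 0 s * h' s.
have dW s : 0 < s -> is_derive s 1 W (W' s).
  move=> s0; apply: der_eq (derM (kern_derive_s g t s0) (dh s s0)) _ _ => //.
  by rewrite /W'; move: (kern _ _ 2 s) (kern _ _ 1 s) (kern _ _ 0 s) => x y z; ring.
have cA := cposB (cposM (cpos_cst (t ^+ 2 / 4)) c2) (cposM (cpos_cst (1 + g)) c1).
have IZ2 := hl_integrableZ (t ^+ 2 / 4) I2; have IZ1 := hl_integrableZ (1 + g) I1.
have IA := hl_integrableB IZ2 IZ1.
have cW' : cpos W' := cposD cA c0.
have IW' : mu.-integrable `]0, +oo[ (EFin \o W') := hl_integrableD IA I0.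
have HW : Half W' = t ^+ 2 / 4 * iker g h 2 t - (1 + g) * iker g h 1 t + iker g h' 0 t.
  by rewrite /iker /Half /W' RintegralD// RintegralB// !RintegralZl.
suff H0 : Half W' = 0.
  move: HW; rewrite H0; move: (iker g h 2 t) (iker g h 1 t) (iker g h' 0 t) => x y z.
  by clear; lra.
have t2 : 0 < t ^+ 2 by rewrite exprn_gt0.
have B0 : 0 <= B by exact: le_trans (hB 1 ltr01).
have [C0 C00 HC0] := kern_bound 0 gg; have [C1 C10 HC1] := kern_bound 1 gg.
(* [K] controls both boundary terms: [|W s| <= K * s], as [kern] of order 0 is [s] times that of
   order 1, and [|W s| <= K / s] for [s >= 1], as the exponent [1 + g] is at least 1. *)
pose K := (C0 + C1 / t ^+ 2 * psi g (t ^+ 2) 0) * B.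
have K0 : 0 <= K.
  by rewrite mulr_ge0// addr_ge0 ?(ltW C00)// mulr_ge0 ?powR_ge0// divr_ge0 ?ltW.
have Wsmall s : 0 < s -> `|W s| <= K * s.
  move=> s0; rewrite /W normrM (ger0_norm (kern_ge0 _ _ _ s0)) /K [leRHS]mulrAC.
  apply: ler_pM; rewrite ?kern_ge0 ?hB//.
  have E : kern g t 0 s = s * kern g t 1 s.
    rewrite /kern expr0 expr1; move: (expR _) (s `^ _) => x y.
    by field; rewrite gt_eqF.
  rewrite E mulrC ler_wpM2r ?(ltW s0)//.
  apply: (@le_trans _ _ (C1 / t ^+ 2 * psi g (t ^+ 2) s)).
    by rewrite [leRHS]mulrAC ler_pdivlMr// mulrC -[t ^+ 2]expr1 HC1.
  apply: (@le_trans _ _ (C1 / t ^+ 2 * psi g (t ^+ 2) 0)); last by rewrite lerDr ltW.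
  rewrite ler_wpM2l ?divr_ge0 ?(ltW C10) ?(ltW t2)//.
  rewrite /psi add0r !powRN lef_pV2 ?posrE ?powR_gt0 ?addr_gt0//.
  apply: ge0_ler_powR; rewrite ?nnegrE ?addr_ge0 ?(ltW s0) ?(ltW t2) ?(ltW g0)//.
  by rewrite lerDr ltW.
have Wlarge s : 1 <= s -> `|W s| <= K / s.
  move=> s1; have s0 := lt_le_trans ltr01 s1.
  rewrite /W normrM (ger0_norm (kern_ge0 _ _ _ s0)) /K [leRHS]mulrAC.
  apply: ler_pM; rewrite ?kern_ge0 ?hB//.
  apply: (@le_trans _ _ (C0 / s)); last first.
    rewrite ler_wpM2r ?invr_ge0 ?(ltW s0)// lerDl mulr_ge0 ?powR_ge0//.
    by rewrite divr_ge0 ?(ltW C10) ?(ltW t2).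
  have := HC0 t s t0 s0; rewrite expr0 mul1r => /le_trans; apply.
  rewrite ler_wpM2l ?(ltW C00)// /psi powRN lef_pV2 ?posrE ?powR_gt0 ?addr_gt0//.
  apply: (@le_trans _ _ (s + t ^+ 2)); first by rewrite lerDl ltW.
  apply: le1r_powR; first by rewrite (le_trans s1)// lerDl ltW.
  by rewrite lerDl ltW.
have IN N : `|Intg (2 ^- N) (2 * 2 ^+ N) W'| <= (K + K) * 2 ^- N.
  rewrite (Intg_FTC (exh_gt0 N) (exh_le N) cW' dW).
  have n1 : 1 <= 2 * 2 ^+ N :> R by rewrite -exprS exprn_ege1// ler1n.
  apply: le_trans (ler_normB _ _) _; rewrite [leRHS]mulrDl; apply: lerD.
    apply: le_trans (Wlarge _ n1) _; rewrite ler_wpM2l//.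
    rewrite lef_pV2 ?posrE ?mulr_gt0 ?exprn_gt0//.
    by rewrite ler_peMl ?exprn_ge0// ler1n.
  exact: Wsmall (exh_gt0 N).
have c0W : (fun N => Intg (2 ^- N) (2 * 2 ^+ N) W') @ \oo --> (0 : R).
  have cu := cvg_half_pow (K + K).
  have cl : (fun N => - ((K + K) * 2 ^- N)) @ \oo --> (0 : R).
    by rewrite -[X in _ --> X]oppr0; exact: (cvgN cu).
  apply: (@squeeze_cvgr _ _ _ _ (fun N => - ((K + K) * 2 ^- N))
    (fun N => (K + K) * 2 ^- N)) cl cu; apply: nearW => N.
  by have := IN N; rewrite ler_norml.
exact: (cvg_unique _ (half_cvg cW' IW') c0W).
Qed.

Lemma psi_ht_le g b f n (E : R) : 0 < g -> 0 < b -> bounded_seq f ->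
  (forall s, 0 < s -> ht (fun m => `|f m|) n s <= E) ->
  Half (fun s => psi g b s * ht (fun m => `|f m|) n s) <= E * (b `^ (- g) / g).
Proof.
move=> g0 b0 fB hE; have fB' := bounded_norm fB.
have ch : cpos (ht (fun m => `|f m|) n) by move=> s _; exact: ht_continuous.
have h0 s : 0 < s -> 0 <= ht (fun m => `|f m|) n s.
  by move=> s0; apply: ht_ge0 => //; exact: ltW.
have E0 : 0 <= E by exact: le_trans (h0 1 ltr01) (hE 1 ltr01).
have [Ip Hp] := psi_half g0 b0; have cp := @psi_cpos _ g b b0.
have hb s : 0 < s -> `|ht (fun m => `|f m|) n s| <= E by move=> s0; rewrite ger0_norm ?h0 ?hE.
have [c1 I1] := psi_mul_integrable g0 b0 ch hb.
apply: (@le_trans _ _ (Half (fun s => E * psi g b s))).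
  apply: half_le => //; first exact: (cposM (cpos_cst E) cp).
    exact: hl_integrableZ.
  by move=> s s0; rewrite mulrC ler_wpM2r ?hE// ltW// psi_gt0.
by rewrite /Half RintegralZl// ler_wpM2l.
Qed.

(* [psi] decreases in [s], so integrating by parts against the primitive [htsum]
   replaces the heat averages by the maximal function. *)
Lemma psi_ht_maxfun g b f n : 0 < g -> 0 < b -> bounded_seq f ->
  Half (fun s => psi g b s * ht (fun m => `|f m|) n s) <=
  maxfun f n * (b `^ (- g) / g).
Proof.
move=> g0 b0 fB; have fB' := bounded_norm fB.
pose M := maxfun f n; have M0 : 0 <= M by exact: maxfun_ge0.
pose q := ht (fun m => `|f m|) n; pose Q := htsum f n.
have ch : cpos q by move=> s _; exact: ht_continuous.
have [B HB] := fB.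
have hb s : 0 < s -> `|q s| <= B.
  move=> s0; rewrite ger0_norm; first by apply: ht_le => //; exact: ltW.
  by apply: ht_ge0 => //; exact: ltW.
have cp := @psi_cpos _ g b b0.
have [c1 I1] := psi_mul_integrable g0 b0 ch hb.
have dQ s : is_derive s 1 (fun x => M * x - Q x) (M - q s).
  by apply: der_eq (derB (derZ M (der_id s)) (htsum_derive n s fB)) _ _ => //; rewrite mulr1.
pose dp s := - (1 + g) * (s + b) `^ (- (1 + g) - 1).
have dpsi s : 0 < s -> is_derive s 1 (psi g b) (dp s).
  move=> s0; have sb : 0 < s + b by rewrite addr_gt0.
  apply: der_eq (@der_comp _ (fun y => y `^ (- (1 + g))) (fun x => x + b) s _ _
    (powR_derive (- (1 + g)) sb) (derD (der_id s) (der_cst s b))) _ _ => //.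
  by rewrite addr0 mulr1.
have cdp : cpos dp.
  move=> s s0; have sb : 0 < s + b by rewrite addr_gt0.
  exact: (der_continuous (derZ (- (1 + g)) (@der_comp _ (fun y => y `^ (- (1 + g) - 1))
    (fun x => x + b) s _ _ (powR_derive (- (1 + g) - 1) sb) (derD (der_id s) (der_cst s b))))).
have D0 s : 0 < s -> 0 <= M * s - Q s.
  by move=> s0; rewrite subr_ge0 htsum_le// ltW.
have cD : cpos (fun s => M * s - Q s) by move=> s _; exact: der_continuous (dQ s).
have cMq : cpos (fun s => M - q s) := cposB (cpos_cst M) ch.
(* The last term bounds the boundary value at the lower end and disappears in the limit. *)
have step N : Intg (2 ^- N) (2 * 2 ^+ N) (fun s => psi g b s * q s) <=
    M * (b `^ (- g) / g) + psi g b 0 * M * 2 ^- N.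
  pose a : R := 2 ^- N; pose z : R := 2 * 2 ^+ N.
  have a0 : 0 < a := exh_gt0 N; have az : a <= z := exh_le N; have z0 := lt_le_trans a0 az.
  (* The derivative of psi (M s - Q) is at most psi (M - q): [psi] decreases, and [M * s - Q s] is
     nonnegative by [htsum_le]. *)
  have L : psi g b z * (M * z - Q z) - psi g b a * (M * a - Q a) <=
      Intg a z (fun s => psi g b s * (M - q s)).
    have dF s : 0 < s -> is_derive s 1 (fun x => psi g b x * (M * x - Q x))
        (dp s * (M * s - Q s) + psi g b s * (M - q s)).
      by move=> s0; exact: derM (dpsi s s0) (dQ s).
    have c2 := cposD (cposM cdp cD) (cposM cp cMq).
    rewrite -(Intg_FTC a0 az c2 dF); apply: (le_Intg a0 c2 (cposM cp cMq)) => s /andP[as_ _].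
    have s0 := lt_le_trans a0 as_; rewrite gerDr mulr_le0_ge0 ?D0//.
    by rewrite mulr_le0_ge0 ?powR_ge0// oppr_le0 addr_ge0// ltW.
  have E : Intg a z (fun s => psi g b s * (M - q s)) =
      M * Intg a z (psi g b) - Intg a z (fun s => psi g b s * q s).
    rewrite -(IntgZ _ _ a0 cp) -(IntgB _ a0 (cposM (cpos_cst M) cp) c1).
    by congr Intg; apply/funext => s; rewrite mulrBr [M * _]mulrC.
  have P1 : 0 <= psi g b z * (M * z - Q z) by rewrite mulr_ge0 ?D0// powR_ge0.
  have P2 : psi g b a * (M * a - Q a) <= psi g b 0 * M * a.
    rewrite -mulrA; apply: ler_pM; rewrite ?powR_ge0 ?D0//; last first.
      by rewrite gerBl htsum_ge0// ltW.
    rewrite /psi add0r !powRN lef_pV2 ?posrE ?powR_gt0 ?addr_gt0//.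
    apply: ge0_ler_powR; rewrite ?nnegrE ?addr_ge0 ?(ltW a0) ?(ltW b0) ?(ltW g0)//.
    by rewrite lerDr ltW.
  have P3 := ler_wpM2l M0 (psi_Intg N g0 b0).
  rewrite -/a -/z in P3 *; move: L P1 P2 P3; rewrite E.
  do 2!move: (Intg _ _ _) => ?; move: (psi g b z * _) (psi g b a * _) (psi g b 0 * M * a) => ? ? ?.
  move: (M * _) (M * _) => ? ?; clear; lra.
have lim := half_cvg c1 I1.
have bl : (fun N => M * (b `^ (- g) / g) + psi g b 0 * M * 2 ^- N) @ \oo -->
    M * (b `^ (- g) / g).
  rewrite -[X in _ --> X]addr0; apply: cvgD; first exact: cvg_cst.
  exact: cvg_half_pow.
rewrite -(cvg_lim _ lim)// -(cvg_lim _ bl)//.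
apply: ler_lim; [by apply/cvg_ex; eexists; exact: lim | by apply/cvg_ex; eexists; exact: bl |].
by apply: nearW => N; exact: step.
Qed.

End ByParts.

(** * The Poisson extension: equation, size, total mass *)

Section PoissonExtension.
Context {R : realType}.
Local Notation mu := (@lebesgue_measure R).
Implicit Types (f : int -> R) (s t g : R) (n : int).

Definition pcst g : R := (4 `^ g * Gamma g)^-1.

Lemma poissonE g f n t :
  poisson g Plus t f n = pcst g * t `^ (2 * g) * iker g (ht f n) 0 t.
Proof.
rewrite /poisson /pcst [X in X * _]mulrC; congr (_ * _).
rewrite /iker /Half; apply: eq_Rintegral => s _.
by rewrite /kern expr0 mulr1 powRN mulrAC.
Qed.

Lemma poisson_minus g f n t :
  poisson g Minus t f n = poisson g Plus t (f \o -%R) (- n).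
Proof.
rewrite /poisson; congr (_ * _); apply: eq_Rintegral => s _.
by rewrite heat_minus.
Qed.

Definition dpoisson g f n t : R := pcst g * t `^ (2 * g) *
  (2 * g / t * iker g (ht f n) 0 t - t / 2 * iker g (ht f n) 1 t).

Lemma ht_bound f : bounded_seq f ->
  exists B, forall n s, 0 < s -> `|ht f n s| <= B.
Proof.
move=> fB; have [B HB] := fB; exists B => n s s0.
apply: le_trans (ht_norm n fB (ltW s0)) _.
by apply: ht_le (bounded_norm fB) (ltW s0) _ => j.
Qed.

Lemma ht_cpos f n : bounded_seq f -> cpos (ht f n).
Proof. by move=> fB s _; exact: ht_continuous. Qed.

Lemma powR_derive_div (r x : R) : 0 < x ->
  is_derive x 1 (fun y => y `^ r) (r * (x `^ r / x)).
Proof.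
move=> x0; apply: der_eq (powR_derive r x0) _ _ => //; congr (_ * _).
by rewrite [x `^ r]powR_pred// mulrAC divff ?mul1r// gt_eqF.
Qed.

(** By the heat equation, [iker_parts] expresses [iker] at [n + 1] through its orders 0, 1 and 2 at
    [n], the very integrals produced by two derivatives in [t]. The rest is algebra: [iker] alone
    has the coefficient 1 + 2 g, and the factor t^(2 g) changes it into [1 - 2 * g]. *)
Lemma poisson_extension g f : 0 < g < 1 -> bounded_seq f ->
  extension (1 - 2 * g) (fun n t => poisson g Plus t f n) (dpoisson g f).
Proof.
move=> gg fB; have [B HB] := ht_bound fB.
have dI n k t (t0 : 0 < t) := iker_derive k gg t0 (@ht_cpos f n fB) (HB n).
split=> n t t0.
  have D := derM (derZ (pcst g) (powR_derive_div (2 * g) t0)) (dI n 0%N t t0).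
  apply: der_eq D _ _ => [s|]; first by rewrite poissonE.
  rewrite /dpoisson; move: (iker _ _ 0 t) (iker _ _ 1 t) (t `^ _) (pcst g) => x y z w.
  by field; rewrite gt_eqF.
have D1 := derM (derZ (2 * g) (derV (der_id t) (lt0r_neq0 t0))) (dI n 0%N t t0).
have D2 := derM (derZ 2^-1 (der_id t)) (dI n 1%N t t0).
have D := derM (derZ (pcst g) (powR_derive_div (2 * g) t0)) (derB D1 D2).
apply: der_eq D _ _ => [s|].
  by rewrite /dpoisson [s / 2]mulrC.
have P := @iker_parts _ g (ht f n) (fun s => ht f (n + 1) s - ht f n s) t B (B + B) gg t0.
have cn : cpos (ht f n) by exact: ht_cpos.
have cn1 : cpos (ht f (n + 1)) by exact: ht_cpos.
have {}P := P (fun s _ => ht_derive n s fB) (cposB cn1 cn) (HB n).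
have {}P : iker g (ht f (n + 1)) 0 t = iker g (ht f n) 0 t +
    ((1 + g) * iker g (ht f n) 1 t - t ^+ 2 / 4 * iker g (ht f n) 2 t).
  rewrite -P; last first.
    by move=> s s0; apply: le_trans (ler_normB _ _) _; rewrite lerD ?HB.
  have [_ I1] := kern_mul_integrable 0 gg t0 cn1 (HB (n + 1)).
  have [_ I0] := kern_mul_integrable 0 gg t0 cn (HB n).
  rewrite /iker [X in _ = _ + Half X](_ : _ = fun s => kern g t 0 s * ht f (n + 1) s -
    kern g t 0 s * ht f n s); last by apply/funext => s; rewrite mulrBr.
  by rewrite /Half RintegralB// [RHS]addrC subrK.
rewrite !poissonE P /dpoisson.
move: (iker _ _ 0 t) (iker _ _ 1 t) (iker _ _ 2 t) (t `^ (2 * g)) (pcst g) => x y z w c.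
by clear -t0; field; rewrite gt_eqF.
Qed.

Lemma poisson_derive1 g f n t : 0 < g < 1 -> bounded_seq f -> 0 < t ->
  derive1 (fun x => poisson g Plus x f n) t = dpoisson g f n t.
Proof.
move=> gg fB t0; rewrite derive1E.
by have [+ _] := poisson_extension gg fB => /(_ n t t0) [_ ->].
Qed.

(** A common majorant, up to constants, of the extension and of [t] times its derivative, built from
    [|f|]; it is bounded pointwise, at infinity and in total mass. *)
Definition pmaj g f n t : R :=
  t `^ (2 * g) * Half (fun s => psi g (t ^+ 2) s * ht (fun m => `|f m|) n s).

Lemma poisson_size g : 0 < g < 1 -> exists2 C, 0 <= C &
  forall f n t, bounded_seq f -> 0 < t ->
  `|poisson g Plus t f n| <= C * pmaj g f n t /\
  `|t * dpoisson g f n t| <= C * pmaj g f n t.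
Proof.
move=> gg; have g0 : 0 < g by case/andP: gg.
have [C0 C00 H0] := iker_bound 0 gg; have [C1 C10 H1] := iker_bound 1 gg.
exists (`|pcst g| * ((1 + 2 * g) * C0 + C1)).
  by rewrite mulr_ge0// addr_ge0 ?(ltW C10)// mulr_ge0 ?(ltW C00)// addr_ge0// mulr_ge0// ltW.
move=> f n t fB t0; have fB' := bounded_norm fB; have [B HB] := ht_bound fB'.
have c0 : cpos (ht f n) by exact: ht_cpos.
have c1 : cpos (ht (fun m => `|f m|) n) by exact: ht_cpos.
have hh s : 0 < s -> `|ht f n s| <= ht (fun m => `|f m|) n s.
  by move=> s0; apply: ht_norm => //; exact: ltW.
have := H0 _ _ _ _ c0 c1 hh (HB n) t0; have := H1 _ _ _ _ c0 c1 hh (HB n) t0.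
rewrite expr0 mul1r expr1 poissonE /dpoisson /pmaj.
set H := Half _; have H_ge0 : 0 <= H.
  apply: Rintegral_ge0 => s /=; rewrite in_itv /= andbT => s0.
  by rewrite mulr_ge0 ?powR_ge0// ht_ge0// ltW.
have A0 : 0 <= t `^ (2 * g) by exact: powR_ge0.
move: (iker _ _ 0 t) (iker _ _ 1 t) (t `^ _) A0 => x y A A0 hy hx.
have E (X : R) : `|X| <= ((1 + 2 * g) * C0 + C1) * H ->
    `|pcst g * A * X| <= `|pcst g| * ((1 + 2 * g) * C0 + C1) * (A * H).
  move=> XH; rewrite !normrM (ger0_norm A0) [leRHS]mulrACA.
  by rewrite ler_wpM2l// mulr_ge0.
have a0 : 0 <= C0 * H by rewrite mulr_ge0 ?(ltW C00).
have a1 : 0 <= C1 * H by rewrite mulr_ge0 ?(ltW C10).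
have g2 : 0 <= 2 * g by rewrite mulr_ge0// ltW.
have a2 : 0 <= 2 * g * (C0 * H) by rewrite mulr_ge0.
split.
  apply: E; apply: le_trans hx _.
  have -> : ((1 + 2 * g) * C0 + C1) * H = C0 * H + 2 * g * (C0 * H) + C1 * H by ring.
  by rewrite -addrA lerDl addr_ge0.
rewrite (_ : t * _ = pcst g * A * (2 * g * x - 2^-1 * (t ^+ 2 * y))); last first.
  by field; rewrite gt_eqF.
apply: E; apply: le_trans (ler_normB _ _) _.
have -> : ((1 + 2 * g) * C0 + C1) * H = C0 * H + (2 * g * (C0 * H) + C1 * H) by ring.
rewrite -[leLHS]add0r; apply: lerD => //; apply: lerD.
  rewrite normrM (ger0_norm g2).
  by rewrite ler_wpM2l.
have q0 : 0 <= t ^+ 2 by rewrite exprn_ge0// ltW.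
have h0 : 0 <= 2^-1 :> R by rewrite invr_ge0.
rewrite normrM [X in _ * X]normrM (ger0_norm q0) (ger0_norm h0).
apply: le_trans hy; rewrite -[leRHS]mul1r ler_wpM2r//; last by rewrite invf_le1// ler1n.
by rewrite mulr_ge0.
Qed.

(** Scaling: the factor in front of the kernel offsets the size of the integral of [psi] at b = t^2,
    so the bounds on [pmaj] are uniform in [t]. *)
Lemma pow_cancel g t : 0 < t -> t `^ (2 * g) * (t ^+ 2) `^ (- g) = 1.
Proof.
move=> t0; rewrite -powR_mulrn ?ltW// -powRrM -powRD; last by rewrite (gt_eqF t0) implybT.
by rewrite mulrN subrr powRr0.
Qed.

Lemma pmaj_scale g (H E t : R) : 0 < t -> H <= E * ((t ^+ 2) `^ (- g) / g) ->
  t `^ (2 * g) * H <= E / g.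
Proof.
move=> t0 HE; have := ler_wpM2l (powR_ge0 t (2 * g)) HE.
have -> // : t `^ (2 * g) * (E * ((t ^+ 2) `^ (- g) / g)) = E / g.
have := pow_cancel g t0; move: (t `^ _) (_ `^ (- g)) => x y xy.
by rewrite -[RHS]mul1r -xy; ring.
Qed.

Lemma pmaj_le g f n t (E : R) : 0 < g -> 0 < t -> bounded_seq f ->
  (forall j : nat, `|f (n + j%:Z)| <= E) -> pmaj g f n t <= E / g.
Proof.
move=> g0 t0 fB fE; apply: (pmaj_scale t0); apply: psi_ht_le => //.
  by rewrite exprn_gt0.
by move=> s s0; apply: ht_le (bounded_norm fB) (ltW s0) fE.
Qed.

Lemma pmaj_maxfun g f n t : 0 < g -> 0 < t -> bounded_seq f ->
  pmaj g f n t <= maxfun f n / g.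
Proof.
by move=> g0 t0 fB; apply: (pmaj_scale t0); apply: psi_ht_maxfun => //; rewrite exprn_gt0.
Qed.

(** The heat flow does not increase the total mass ([ht_tot]), so it suffices to take the finite sum
    inside the integral. *)
Lemma pmaj_tot g f t (K : R) : 0 < g -> 0 < t -> tot_le (fun n => `|f n|) K ->
  tot_le (fun n => pmaj g f n t) (K / g).
Proof.
move=> g0 t0 fK a L; have t2 : 0 < t ^+ 2 by rewrite exprn_gt0.
have fB : bounded_seq f by exists K => n; exact: tot_le_pt fK.
have fB' := bounded_norm fB; have [B HB] := ht_bound fB'.
have K0 := tot_le_ge0 fK.
rewrite wsumZ; apply: (pmaj_scale t0).
have cI n : cpos (fun s => psi g (t ^+ 2) s * ht (fun m => `|f m|) n s) /\
    mu.-integrable `]0, +oo[ (EFin \o (fun s => psi g (t ^+ 2) s * ht (fun m => `|f m|) n s)).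
  by apply: (psi_mul_integrable g0 t2 (B := B)); [exact: ht_cpos | exact: HB].
have S b M : cpos (fun s => psi g (t ^+ 2) s * wsum (fun n => ht (fun m => `|f m|) n s) b M) /\
    mu.-integrable `]0, +oo[ (EFin \o
      (fun s => psi g (t ^+ 2) s * wsum (fun n => ht (fun m => `|f m|) n s) b M)) /\
    wsum (fun n => Half (fun s => psi g (t ^+ 2) s * ht (fun m => `|f m|) n s)) b M =
    Half (fun s => psi g (t ^+ 2) s * wsum (fun n => ht (fun m => `|f m|) n s) b M).
  elim: M b => [|M IH] b.
    have -> : (fun s => psi g (t ^+ 2) s * wsum (fun n => ht (fun m => `|f m|) n s) b 0) =
        fun=> 0 by apply/funext => s; rewrite wsum0 mulr0.
    split; first exact: cpos_cst.
    split; first exact: integrable0.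
    by rewrite wsum0 /Half /Rintegral integral0.
  have [c [I E]] := IH (b + 1); have [c1 I1] := cI b.
  have -> : (fun s => psi g (t ^+ 2) s * wsum (fun n => ht (fun m => `|f m|) n s) b M.+1) =
      fun s => psi g (t ^+ 2) s * ht (fun m => `|f m|) b s +
        psi g (t ^+ 2) s * wsum (fun n => ht (fun m => `|f m|) n s) (b + 1) M.
    by apply/funext => s; rewrite wsumS mulrDr.
  split; first exact: cposD.
  split; first exact: hl_integrableD.
  by rewrite wsumS E /Half RintegralD.
have [c [I ->]] := S a L.
have [Ip Hp] := psi_half g0 t2; have cp := @psi_cpos _ g _ t2.
apply: (@le_trans _ _ (Half (fun s => K * psi g (t ^+ 2) s))).
  apply: half_le => //; first exact: (cposM (cpos_cst K) cp).
    exact: hl_integrableZ.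
  by move=> s s0; rewrite mulrC ler_wpM2r ?ht_tot// ltW// psi_gt0.
by rewrite /Half RintegralZl// ler_wpM2l.
Qed.

End PoissonExtension.

(** * Norms for the counting measure *)

Section CountingInt.
Context {R : realType}.
Local Notation cnt := (@counting int R).
Implicit Types (f h : int -> R) (F : int -> \bar R) (n a : int) (L N : nat).
Implicit Types (S : (int -> R) -> int -> \bar R).

Lemma counting_set1 n : cnt [set n] = 1%E.
Proof.
rewrite /counting; case: asboolP => [_|/(_ (finite_set1 n))//].
by rewrite fset_set1 finmap.cardfs1.
Qed.

Definition window a L : set int := [set n | a <= n < a + L%:Z].

Lemma window0 a : window a 0 = set0.
Proof. by apply/seteqP; split => // n; rewrite /window /=; lia. Qed.

Lemma windowS a L : window a L.+1 = [set a] `|` window (a + 1) L.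
Proof.
apply/seteqP; split => n; rewrite /window /=; last by case=> [->|]; lia.
by have [->|] := eqVneq n a; [left | right; lia].
Qed.

Lemma window_homo : {homo (fun N : nat => window (- N%:Z) (2 * N)) :
  i j / (i <= j)%N >-> (i <= j)%O}.
Proof.
by move=> i j ij; apply/subsetPset => n; rewrite /window /=; lia.
Qed.

Lemma window_bigcup : \bigcup_(N : nat) window (- N%:Z) (2 * N) = [set: int].
Proof.
apply/seteqP; split => // n _; exists (`|n|%N.+1) => //; rewrite /window /=; lia.
Qed.

Lemma window_integral h a L : (forall n, 0 <= h n) ->
  (\int[cnt]_(n in window a L) (h n)%:E)%E = (wsum h a L)%:E.
Proof.
move=> h0; elim: L a => [|L IH] a; first by rewrite window0 integral_set0 wsum0.
rewrite windowS ge0_integral_setU//=.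
- rewrite IH wsumS EFinD; congr (_ + _)%E.
  rewrite (eq_integral (cst (h a)%:E)); last by move=> n /set_mem /= ->.
  rewrite integral_cst// -[RHS]mule1; congr (_ * _)%E; exact: counting_set1.
- by move=> n _; rewrite lee_fin.
- by apply/disj_setPS => n [/= ->]; rewrite /window /=; lia.
Qed.

Lemma tot_le_integral h (T : R) : (forall n, 0 <= h n) ->
  ((\int[cnt]_n (h n)%:E)%E <= T%:E)%E <-> tot_le h T.
Proof.
move=> h0; split=> [hT a L|hT].
  rewrite -lee_fin -window_integral//; apply: le_trans hT.
  by apply: ge0_subset_integral => // n _; rewrite lee_fin.
have cvg : (\int[cnt]_(n in window (- N%:Z) (2 * N)) (h n)%:E)%E @[N --> \oo] -->
    (\int[cnt]_n (h n)%:E)%E.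
  rewrite -window_bigcup; apply: ge0_nondecreasing_set_cvg_integral => //.
    exact: window_homo.
  by move=> N n _; rewrite lee_fin.
rewrite -(cvg_lim _ cvg)//; apply: lime_le; first by apply/cvg_ex; eexists; exact: cvg.
by apply: nearW => N; rewrite window_integral// lee_fin.
Qed.

Lemma Lnorm_fin (p : R) f : 0 < p -> finite_norm cnt p%:E f ->
  exists2 T, 0 <= T & 'N[cnt]_p%:E[EFin \o f]%E = T%:E /\
  tot_le (fun n => `|f n| `^ p) (T `^ p).
Proof.
move=> p0 fp; have N0 := Lnorm_ge0 cnt p%:E (EFin \o f).
have Nfin : 'N[cnt]_p%:E[EFin \o f]%E \is a fin_num by rewrite ge0_fin_numE.
exists (fine 'N[cnt]_p%:E[EFin \o f]%E); first exact: fine_ge0.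
split; first by rewrite fineK.
apply/tot_le_integral => [n|]; first exact: powR_ge0.
by rewrite -poweR_EFin fineK// poweR_Lnorm// gt_eqF.
Qed.

Lemma bounded_of_tot (p : R) f T : 0 < p -> tot_le (fun n => `|f n| `^ p) T ->
  bounded_seq f.
Proof.
move=> p0 fT; exists (T `^ p^-1) => n; have := tot_le_pt n fT.
move=> /(ge0_ler_powR (r := p^-1)); rewrite -powRrM mulfV ?gt_eqF// powRr1//.
by apply; rewrite ?invr_ge0 ?(ltW p0) ?nnegrE ?powR_ge0// (tot_le_ge0 fT).
Qed.

(** The majorant [h] is real valued, which keeps the estimates out of the extended reals. The
    hypothesis compares p-th powers, so the norm constant is the p-th root of [C]. *)
Lemma strong_typeP (p C : R) S : 0 < p -> 0 <= C ->
  (forall f T, bounded_seq f -> tot_le (fun n => `|f n| `^ p) T ->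
    exists h, [/\ forall n, 0 <= h n, forall n, (`|S f n| <= (h n)%:E)%E &
      tot_le (fun n => h n `^ p) (C * T)]) ->
  strong_type p%:E S.
Proof.
move=> p0 C0 SC; exists (C `^ p^-1) => f /(Lnorm_fin p0)[T T0 [-> fT]].
have [h [h0 Sh hT]] := SC f _ (bounded_of_tot p0 fT) fT.
have pn : p != 0 by rewrite gt_eqF.
have I : ('N[cnt]_p%:E[S f] `^ p <= (C * T `^ p)%:E)%E.
  rewrite poweR_Lnorm//; move/tot_le_integral: hT => /(_ (fun n => powR_ge0 _ _)).
  apply: le_trans; apply: ge0_le_integral => // n _; rewrite ?poweR_ge0 ?lee_fin ?powR_ge0//.
  rewrite -poweR_EFin; apply: gt0_ler_poweR; rewrite ?in_itv /= ?leey ?andbT ?lee_fin//.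
  exact: ltW.
rewrite -[leLHS]poweRe1 ?Lnorm_ge0// -(mulfV pn) poweRrM.
have -> : ((C `^ p^-1)%:E * T%:E = (C * T `^ p)%:E `^ p^-1)%E.
  by rewrite poweR_EFin powRM ?powR_ge0// -powRrM mulfV// powRr1.
apply: gt0_ler_poweR I; rewrite ?in_itv /= ?leey ?andbT ?lee_fin ?poweR_ge0 ?invr_ge0 ?(ltW p0)//.
by rewrite mulr_ge0// powR_ge0.
Qed.

Lemma weak_typeP (C : R) S :
  (forall f T l, 0 < l -> tot_le (fun n => `|f n|) T ->
    tot_le (fun n => (l%:E < `|S f n|)%E%:R) (C / l * T)) ->
  weak_type11 S.
Proof.
move=> SC; exists C => f fp l l0.
have [T T0 [-> fT]] := Lnorm_fin ltr01 fp.
rewrite powRr1// in fT; have {}fT : tot_le (fun n => `|f n|) T.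
  by apply: tot_leW fT => n; rewrite powRr1.
have {}SC := SC f T l l0 fT.
rewrite -[X in cnt X]setIT -integral_indic// -EFinM.
rewrite (eq_integral (fun n => ((l%:E < `|S f n|)%E%:R)%:E)); last first.
  by move=> n _; rewrite indicE mem_setE.
by apply/tot_le_integral.
Qed.

Lemma negligible_counting (A : set int) : cnt.-negligible A -> A = set0.
Proof.
case=> B [_ B0 AB]; apply/seteqP; split => // n /AB Bn.
have : (cnt [set n] <= cnt B)%E by apply: le_measure; rewrite ?inE// => m ->.
by rewrite B0 counting_set1 lee_fin ler10.
Qed.

Lemma counting_setT_gt0 : (0 < cnt [set: int])%E.
Proof.
apply: (@lt_le_trans _ _ (cnt [set 0])); first by rewrite counting_set1.
by apply: le_measure; rewrite ?inE.
Qed.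

Lemma strong_typeyP (C : R) S : 0 <= C ->
  (forall f T, (forall n, `|f n| <= T) ->
    forall n, (`|S f n| <= (C * T)%:E)%E) ->
  strong_type +oo%E S.
Proof.
move=> C0 SC; exists C => f fp; have N0 := Lnorm_ge0 cnt +oo%E (EFin \o f).
have Nfin : 'N[cnt]_+oo[EFin \o f]%E \is a fin_num by rewrite ge0_fin_numE.
have E F : ('N[cnt]_+oo[F] = ess_sup cnt (abse \o F))%E.
  by rewrite unlock /= counting_setT_gt0.
have fT n : `|f n| <= fine 'N[cnt]_+oo[EFin \o f]%E.
  rewrite -lee_fin fineK// E.
  have /negligible_counting/seteqP[H _] := ess_sup_ge cnt (abse \o (EFin \o f)).
  by apply: contrapT => nf; exact: (H n nf).
rewrite -[in leRHS](fineK Nfin) -EFinM [leLHS]E; apply/ess_supP.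
by apply: nearW => n; exact: SC.
Qed.

End CountingInt.

(** * The four operators *)

Section Operators.
Context {R : realType}.
Local Notation mu := (@lebesgue_measure R).
Implicit Types (f h m : int -> R) (n a : int) (L N : nat) (g s t p l T : R).
Implicit Types (S : (int -> R) -> int -> \bar R).

Definition strong_bound p S := exists2 C, 0 <= C &
  forall f T, bounded_seq f -> tot_le (fun n => `|f n| `^ p) T ->
    exists h, [/\ forall n, 0 <= h n, forall n, (`|S f n| <= (h n)%:E)%E &
      tot_le (fun n => h n `^ p) (C * T)].

Definition weak_bound S := exists C : R, forall f T l, 0 < l ->
  tot_le (fun n => `|f n|) T ->
  tot_le (fun n => (l%:E < `|S f n|)%E%:R) (C / l * T).

Definition sup_bound S := exists2 C : R, 0 <= C &
  forall f T, (forall n, `|f n| <= T) -> forall n, (`|S f n| <= (C * T)%:E)%E.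

Definition reflected S S' := forall f n, S' f n = S (f \o -%R) (- n).

Lemma reflect_strong p S S' : reflected S S' -> strong_bound p S -> strong_bound p S'.
Proof.
move=> SS' [C C0 HC]; exists C => // f T fB fT.
have [h [h0 Sh hT]] := HC (f \o -%R) T (bounded_rev fB) (tot_le_rev fT).
exists (h \o -%R); split=> [n|n|]; first exact: h0.
  by rewrite SS'; exact: Sh.
exact: (tot_le_rev hT).
Qed.

Lemma reflect_weak S S' : reflected S S' -> weak_bound S -> weak_bound S'.
Proof.
move=> SS' [C HC]; exists C => f T l l0 fT.
have := tot_le_rev (HC (f \o -%R) T l l0 (tot_le_rev fT)).
by apply: tot_leW => n; rewrite SS'.
Qed.

Lemma reflect_sup S S' : reflected S S' -> sup_bound S -> sup_bound S'.
Proof.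
move=> SS' [C C0 HC]; exists C => // f T fT n.
by rewrite SS'; apply: HC => k; exact: fT.
Qed.

Lemma poisson_max_minus g : reflected (@poisson_max R g Plus) (poisson_max g Minus).
Proof.
move=> f n; rewrite /poisson_max; congr ereal_sup.
by apply: eq_imagel => t _; rewrite poisson_minus.
Qed.

Lemma square_fun_minus g : reflected (@square_fun R g Plus) (square_fun g Minus).
Proof.
move=> f n; rewrite /square_fun.
have -> // : (fun u => poisson g Minus u f n) = fun u => poisson g Plus u (f \o -%R) (- n).
by apply/funext => u; exact: poisson_minus.
Qed.

Lemma poisson_maxfun g : 0 < g < 1 -> exists2 D, 0 < D &
  forall f n t, bounded_seq f -> 0 < t ->
  `|poisson g Plus t f n| <= D * maxfun f n /\
  `|t * dpoisson g f n t| <= D * maxfun f n.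
Proof.
move=> gg; have g0 : 0 < g by case/andP: gg.
(* The summand 1 makes the constant positive: the weak type bounds divide the level by it. *)
have [C C0 HC] := @poisson_size R _ gg; exists (C / g + 1).
  by rewrite ltr_wpDl// divr_ge0// ltW.
move=> f n t fB t0; have [H1 H2] := HC f n t fB t0.
have H : C * pmaj g f n t <= (C / g + 1) * maxfun f n.
  apply: le_trans (ler_wpM2l C0 (pmaj_maxfun n g0 t0 fB)) _.
  by rewrite [leRHS]mulrDl mul1r mulrA mulrAC lerDl maxfun_ge0.
by split; [exact: le_trans H1 H | exact: le_trans H2 H].
Qed.

Lemma poisson_max_le g f n D : (forall t, 0 < t -> `|poisson g Plus t f n| <= D) ->
  (`|poisson_max g Plus f n| <= D%:E)%E.
Proof.
move=> H; rewrite gee0_abs; last first.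
  apply: le_trans (ereal_sup_ubound _); last by exists 1 => //=; exact: ltr01.
  by rewrite lee_fin.
by apply: ge_ereal_sup => _ [t /= t0 <-]; rewrite lee_fin H.
Qed.

Lemma poisson_max_strong g p : 0 < g < 1 -> 1 < p ->
  strong_bound p (@poisson_max R g Plus).
Proof.
move=> gg p1; have [D D0 HD] := poisson_maxfun gg; have [C C0 HC] := strong_maxfun p1.
exists (D `^ p * C); first by rewrite mulr_ge0 ?powR_ge0.
move=> f T fB fT; have M0 n := maxfun_ge0 n fB.
exists (fun n => D * maxfun f n); split=> [n|n|].
- by rewrite mulr_ge0// ltW.
- by apply: poisson_max_le => t t0; have [] := HD f n t fB t0.
rewrite -mulrA; apply: tot_leW (tot_leZ (powR_ge0 D p) (HC f T fB fT)) => n.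
by rewrite powRM// ltW.
Qed.

Lemma poisson_max_weak g : 0 < g < 1 -> weak_bound (@poisson_max R g Plus).
Proof.
move=> gg; have [D D0 HD] := poisson_maxfun gg; exists D => f T l l0 fT.
have fB : bounded_seq f by exists T => n; exact: tot_le_pt fT.
have -> : D / l * T = T / (l / D) by rewrite invf_div mulrC.
apply: tot_leW (weak_maxfun (divr_gt0 l0 D0) fT) => n; rewrite /above.
have H : (`|poisson_max g Plus f n| <= (D * maxfun f n)%:E)%E.
  by apply: poisson_max_le => t t0; have [] := HD f n t fB t0.
have [lS|//] := boolP (l%:E < _)%E.
have : (l%:E < (D * maxfun f n)%:E)%E by exact: lt_le_trans lS H.
by rewrite lte_fin mulrC -ltr_pdivrMr// => ->.
Qed.

Lemma poisson_max_sup g : 0 < g < 1 -> sup_bound (@poisson_max R g Plus).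
Proof.
move=> gg; have [D D0 HD] := poisson_maxfun gg; exists D; first exact: ltW.
move=> f T fT n; have fB : bounded_seq f by exists T.
apply: poisson_max_le => t t0; have [H _] := HD f n t fB t0.
by apply: le_trans H _; rewrite ler_wpM2l ?(ltW D0)// maxfun_le_bound.
Qed.

(** If [y <= 0], the bounds force the sequence to be constant, so continuity of the power at the
    origin is not called upon. *)
Lemma cvg_powR (x : nat -> R) y q : 0 < q -> (forall N, 0 <= x N) ->
  (forall N, x N <= y) -> x @ \oo --> y -> (fun N => x N `^ q) @ \oo --> y `^ q.
Proof.
move=> q0 x0 xy xc; have [y0|y0] := leP y 0.
  have E N : x N = y by apply/le_anti; rewrite xy (le_trans y0 (x0 N)).
  by under eq_fun do rewrite E; exact: cvg_cst.
apply: (cvg_comp x (fun z => z `^ q) xc); exact: (der_continuous (powR_derive q y0)).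
Qed.

Lemma tot_le_lim (x : nat -> int -> R) (y : int -> R) T :
  (forall n, (fun N => x N n) @ \oo --> y n) -> (forall N, tot_le (x N) T) -> tot_le y T.
Proof.
move=> xy xT a L; have cvg : (fun N => wsum (x N) a L) @ \oo --> wsum y a L.
  elim: L a => [|L IH] a.
    by under eq_fun do rewrite wsum0; rewrite wsum0; exact: cvg_cst.
  by under eq_fun do rewrite wsumS; rewrite wsumS; exact: cvgD (xy a) (IH (a + 1)).
rewrite -(cvg_lim _ cvg)//; apply: limr_le; first by apply/cvg_ex; eexists; exact: cvg.
by apply: nearW => N; exact: xT.
Qed.

Local Notation gsqN v N n := (gsq v (2 ^- N) (2 * 2 ^+ N) n).

Definition gfull (v : int -> R -> R) n : R := Half (fun t => t * v n t ^+ 2).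

(** Any bound [K], even one depending on [n], makes the integral finite; the real-valued [gfull] is
    then the true integral and the limit of its truncations. *)
Lemma square_fun_lim g f n K : 0 < g < 1 -> bounded_seq f ->
  (forall N, gsqN (dpoisson g f) N n <= K) ->
  [/\ square_fun g Plus f n = (gfull (dpoisson g f) n `^ 2^-1)%:E,
      forall N, gsqN (dpoisson g f) N n <= gfull (dpoisson g f) n,
      0 <= gfull (dpoisson g f) n &
      (fun N => gsqN (dpoisson g f) N n) @ \oo --> gfull (dpoisson g f) n].
Proof.
move=> gg fB HK; pose w t := t * dpoisson g f n t ^+ 2.
have cw : cpos w := cposM cpos_id (cposX 2 (ext_cv (poisson_extension gg fB) (n := n))).
have w0 t : 0 < t -> 0 <= w t by move=> t0; rewrite mulr_ge0 ?sqr_ge0 ?ltW.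
have [Iw Hw] := half_integrable cw w0 HK.
have cvg := half_cvg cw Iw.
have mono N : gsqN (dpoisson g f) N n <= gfull (dpoisson g f) n.
  have -> : gfull (dpoisson g f) n = Half w by [].
  rewrite -(cvg_lim _ cvg)//; apply: nondecreasing_cvgn_le.
    move=> i j ij; apply: (le_Intg_itv (exh_gt0 j) _ (exh_le i) _ cw w0).
      by rewrite lef_pV2 ?posrE ?exprn_gt0// ler_weXn2l// ler1n.
    by rewrite ler_wpM2l// ler_weXn2l// ler1n.
  by apply/cvg_ex; eexists; exact: cvg.
have G0 : 0 <= gfull (dpoisson g f) n.
  by apply: le_trans (mono 0%N); apply: gsq_ge0; exact: exh_gt0.
split=> //; rewrite /square_fun -poweR_EFin; congr (_ `^ _)%E.
rewrite /gfull /Half fineK; last exact: integrable_fin_num.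
apply: eq_integral => t /set_mem /=; rewrite in_itv /= andbT => t0.
rewrite poisson_derive1// /w real_normK ?num_real//; congr EFin.
by field; rewrite gt_eqF.
Qed.

Lemma kappa_range g : 0 < g < 1 -> -1 <= 1 - 2 * g <= 1.
Proof. by move=> /andP[g0 g1]; apply/andP; split; lra. Qed.

Lemma gsq_dpoisson_strong g p : 0 < g < 1 -> 1 < p -> exists2 C, 0 <= C &
  forall f T N, bounded_seq f -> tot_le (fun n => `|f n| `^ p) T ->
  tot_le (fun n => gsqN (dpoisson g f) N n `^ (p / 2)) (C * T).
Proof.
move=> gg p1; have [D D0 HD] := poisson_maxfun gg; have [C C0 HC] := strong_maxfun p1.
have mT f T : bounded_seq f -> tot_le (fun n => `|f n| `^ p) T ->
    tot_le (fun n => (D * maxfun f n) `^ p) (D `^ p * C * T).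
  move=> fB fT; rewrite -mulrA; apply: tot_leW (tot_leZ (powR_ge0 D p) (HC f T fB fT)) => n.
  by rewrite powRM ?maxfun_ge0// ltW.
have DC0 : 0 <= D `^ p * C by rewrite mulr_ge0 ?powR_ge0.
have H1 f n t (fB : bounded_seq f) (t0 : 0 < t) := (HD f n t fB t0).1.
have H2 f n t (fB : bounded_seq f) (t0 : 0 < t) := (HD f n t fB t0).2.
have [p2|p2] := leP p 2.
  have [B B0 HB] := gsq_strong_le2 (kappa_range gg) p1 p2.
  exists (B * (D `^ p * C)); first by rewrite mulr_ge0.
  move=> f T N fB fT; rewrite -mulrA.
  apply: (HB _ _ (fun n => D * maxfun f n) _ _ _ (poisson_extension gg fB)).
  - by move=> n; rewrite mulr_ge0 ?maxfun_ge0// ltW.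
  - by move=> n t t0; exact: H1.
  - by move=> n t t0; exact: H2.
  - exact: mT.
  - exact: exh_gt0.
  - exact: exh_le.
have [B B0 HB] := gsq_strong_gt2 p2.
exists (B * (D `^ p * C)); first by rewrite mulr_ge0.
move=> f T N fB fT; rewrite -mulrA.
apply: (HB _ _ _ (fun n => D * maxfun f n) _ _ _ (poisson_extension gg fB)).
- exact: kappa_range.
- by move=> n t t0; exact: H1.
- by move=> n t t0; exact: H2.
- exact: mT.
- exact: exh_gt0.
- by rewrite invf_le1 ?exprn_gt0// exprn_ege1// ler1n.
Qed.

Lemma square_fun_strong g p : 0 < g < 1 -> 1 < p ->
  strong_bound p (@square_fun R g Plus).
Proof.
move=> gg p1; have [C C0 HC] := gsq_dpoisson_strong gg p1; exists C => //.
have p0 : 0 < p := lt_trans ltr01 p1; have q0 : 0 < p / 2 by rewrite divr_gt0.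
move=> f T fB fT; have {}HC N := HC f T N fB fT.
pose v := dpoisson g f; have v0 N n : 0 <= gsqN v N n by apply: gsq_ge0; exact: exh_gt0.
have L n := @square_fun_lim g f n ((C * T) `^ (p / 2)^-1) gg fB.
have {}L n : [/\ square_fun g Plus f n = (gfull v n `^ 2^-1)%:E,
      forall N, gsqN v N n <= gfull v n, 0 <= gfull v n &
      (fun N => gsqN v N n) @ \oo --> gfull v n].
  apply: L => N; have := tot_le_pt n (HC N).
  move=> /(ge0_ler_powR (r := (p / 2)^-1)); rewrite -powRrM mulfV ?gt_eqF// powRr1//.
  apply; rewrite ?invr_ge0 ?(ltW q0) ?nnegrE ?powR_ge0//.
  exact: tot_le_ge0 (HC 0%N).
exists (fun n => gfull v n `^ 2^-1); split=> [n|n|]; first exact: powR_ge0.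
  by have [-> _ _ _] := L n; rewrite lee_fin ger0_norm ?powR_ge0.
apply: tot_le_lim HC => n; have [_ le0 G0 cv] := L n.
rewrite -powRrM [2^-1 * p]mulrC; apply: (@cvg_powR (fun N => gsqN v N n)) => // N.
Qed.

(** The forward operator at [n] sees only values of [f] at and to the right of [n], and these are
    small far out. *)
Lemma poisson_tail g f T : 0 < g < 1 -> tot_le (fun n => `|f n|) T ->
  uniform_tail (fun n t => poisson g Plus t f n).
Proof.
move=> gg fT; have g0 : 0 < g by case/andP: gg.
have fB : bounded_seq f by exists T => n; exact: tot_le_pt fT.
have [C C0 HC] := @poisson_size R _ gg => e e0.
have C1 : 0 < C + 1 by rewrite ltr_wpDl.
have e1 : 0 < e * g / (C + 1) by rewrite divr_gt0// mulr_gt0.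
have [N HN] := tot_le_tail (fun n => normr_ge0 (f n)) fT e1.
exists N => n t Nn t0; have [H _] := HC f n t fB t0; apply: le_trans H _.
have P : pmaj g f n t <= e * g / (C + 1) / g.
  by apply: pmaj_le => // j; apply: HN; exact: le_trans Nn (lerDl n j%:Z).
apply: le_trans (ler_wpM2l C0 P) _.
have -> : C * (e * g / (C + 1) / g) = C / (C + 1) * e by field; rewrite !gt_eqF.
by rewrite ler_piMl ?(ltW e0)// ler_pdivrMr// mul1r lerDl.
Qed.

Lemma square_fun_weak g : 0 < g < 1 -> weak_bound (@square_fun R g Plus).
Proof.
move=> gg; have [D D0 HD] := poisson_maxfun gg; have g0 : 0 < g by case/andP: gg.
have [A A0 HA] := @poisson_size R _ gg; have [B B0 HB] := gsq_weak (kappa_range gg).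
exists (D + B * (A / g)) => f T l l0 fT.
have fB : bounded_seq f by exists T => n; exact: tot_le_pt fT.
pose v := dpoisson g f; pose m n := D * maxfun f n.
have v0 N n : 0 <= gsqN v N n by apply: gsq_ge0; exact: exh_gt0.
have m0 n : 0 <= m n by rewrite mulr_ge0 ?maxfun_ge0// ltW.
have PT t : 0 < t -> tot_le (fun n => A * pmaj g f n t) (A / g * T).
  by move=> t0; rewrite mulrAC -mulrA; apply: tot_leZ => //; exact: pmaj_tot.
have W N x : 0 < x -> tot_le (fun n => (m n <= x)%R%:R * gsqN v N n) (B * x * (A / g * T)).
  move=> x0; apply: (HB _ _ m _ _ _ _ (poisson_extension gg fB)) => //.
  - exact: poisson_tail fT.
  - by move=> n t t0; have [] := HD f n t fB t0.
  - move=> t t0; apply: tot_leW (PT t t0) => n.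
    by have [] := HA f n t fB t0.
  - move=> t t0; apply: tot_leW (PT t t0) => n.
    by have [] := HA f n t fB t0.
  - exact: exh_le.
have L n : [/\ square_fun g Plus f n = (gfull v n `^ 2^-1)%:E,
      forall N, gsqN v N n <= gfull v n, 0 <= gfull v n &
      (fun N => gsqN v N n) @ \oo --> gfull v n].
  (* Finiteness at a single site: at the level [m n + 1] the truncation keeps [n]. *)
  apply: (@square_fun_lim g f n (B * (m n + 1) * (A / g * T)) gg fB) => N.
  have mn : 0 < m n + 1 by rewrite ltr_wpDl.
  have := tot_le_pt n (W N (m n + 1) mn).
  by rewrite lerDl ler01 mul1r.
have WG : tot_le (fun n => (m n <= l)%R%:R * gfull v n) (B * l * (A / g * T)).
  apply: (@tot_le_lim (fun N n => (m n <= l)%R%:R * gsqN v N n)) => [n|N]; last exact: W.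
  by have [_ _ _ cv] := L n; apply: cvgM cv; exact: cvg_cst.
have l2 : 0 < l ^+ 2 by rewrite exprn_gt0.
have l2' : 0 <= (l ^+ 2)^-1 by rewrite invr_ge0 ltW.
(* The level set lies in the union of {m > l}, counted by the weak type of [maxfun], and of {m <= l,
   gfull > l^2}, counted by Chebyshev's inequality from [WG]. *)
have H := tot_leD (weak_maxfun (divr_gt0 l0 D0) fT) (tot_leZ l2' WG).
have E : (D + B * (A / g)) / l * T =
    T / (l / D) + (l ^+ 2)^-1 * (B * l * (A / g * T)).
  by field; rewrite !gt_eqF.
rewrite E; apply: tot_leW H => n; rewrite /above.
have [SE _ G0 _] := L n; rewrite SE lte_fin ger0_norm ?powR_ge0//.
have [lG|_] := boolP (l < _); last first.
  by rewrite addr_ge0// mulr_ge0// mulr_ge0.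
have [ml|ml] := leP (m n) l; last first.
  rewrite ltr_pdivrMr// mulrC ml mul0r mulr0 addr0//.
have lG2 : l ^+ 2 <= gfull v n.
  have : l `^ 2 <= (gfull v n `^ 2^-1) `^ 2.
    by apply: ge0_ler_powR; rewrite ?nnegrE ?powR_ge0// ltW.
  by rewrite -powRrM mulVf// powRr1// powR_mulrn// ltW.
rewrite mul1r -[leLHS]add0r; apply: lerD => //.
by rewrite mulrC ler_pdivlMr// mul1r.
Qed.

End Operators.

Theorem theorem8 (R : realType) (gamma : R) (gamma_gt0 : 0 < gamma)
    (gamma_lt1 : gamma < 1) :
  (forall S : (int -> R) -> int -> \bar R,
     [\/ S = poisson_max gamma Plus, S = poisson_max gamma Minus,
         S = square_fun gamma Plus | S = square_fun gamma Minus] ->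
     (forall p : R, 1 < p -> strong_type p%:E S) /\ weak_type11 S) /\
  (forall S : (int -> R) -> int -> \bar R,
     S = poisson_max gamma Plus \/ S = poisson_max gamma Minus ->
     strong_type +oo%E S).
Proof.
have gg : 0 < gamma < 1 by rewrite gamma_gt0.
split=> S HS; last first.
  have [C C0 HC] : sup_bound S.
    case: HS => ->; first exact: poisson_max_sup.
    exact: reflect_sup (@poisson_max_minus R gamma) (poisson_max_sup gg).
  exact: strong_typeyP C0 HC.
split=> [p p1|].
  have [C C0 HC] : strong_bound p S.
    case: HS => ->.
    - exact: poisson_max_strong.
    - exact: reflect_strong (@poisson_max_minus R gamma) (poisson_max_strong gg p1).
    - exact: square_fun_strong.
    - exact: reflect_strong (@square_fun_minus R gamma) (square_fun_strong gg p1).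
  exact: strong_typeP (lt_trans ltr01 p1) C0 HC.
have [C HC] : weak_bound S.
  case: HS => ->.
  - exact: poisson_max_weak.
  - exact: reflect_weak (@poisson_max_minus R gamma) (poisson_max_weak gg).
  - exact: square_fun_weak.
  - exact: reflect_weak (@square_fun_minus R gamma) (square_fun_weak gg).
exact: weak_typeP HC.
Qed.
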